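(* Let $K$ be a $1$-reduced simplicial set. The Alexander-Whitney cobar diagonal $\psi_K:\Omega C(K)\to \Omega C(K)\otimes\Omega C(K)$ is cocommutative up to homotopy of chain algebras: if $sw:\Omega C(K)\otimes\Omega C(K)\to\Omega C(K)\otimes\Omega C(K)$ denotes the (graded) tensor switch map, then there is a derivation homotopy from $\psi_K$ to $sw\circ\psi_K$.
   Context: A simplicial set is $1$-reduced if it has exactly one $0$-simplex and its only $1$-simplex is the degenerate one. $C(K)$ is the normalized integral chain complex of $K$. For $x\in K_n$ and $0\le a_0<\dots<a_p\le n$, $x_{a_0\dots a_p}\in K_p$ is the face of $x$ with vertices $a_0,\dots,a_p$. The Koszul sign convention is used throughout. Eilenberg-Zilber data. For simplicial sets $K,L$ define $f_{K,L}:C(K\times L)\to C(K)\otimes C(L)$ by $f_{K,L}(x,y)=\sum_{i=0}^n x_{0\dots i}\otimes y_{i\dots n}$ for $(x,y)\in K_n\times L_n$, and $\nabla_{K,L}:C(K)\otimes C(L)\to C(K\times L)$ by $\nabla_{K,L}(x\otimes y)=\sum_{(\mu,\nu)}(-1)^{\mathrm{sgn}(\mu)}(s_{\nu_q}\cdots s_{\nu_1}x,\,s_{\mu_p}\cdots s_{\mu_1}y)$ for $x\in K_p$, $y\in L_q$, the sum being over all $(p,q)$-shuffles $(\mu,\nu)$ of $\{0,\dots,p+q-1\}$ and $(-1)^{\mathrm{sgn}(\mu)}$ the sign of the shuffle. The chain homotopy $\varphi_{K,L}:C(K\times L)\to C(K\times L)$ of degree $+1$ is defined as follows. For a monotone map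 $\alpha:[0,p]\to[0,n]$ let $\alpha':[0,p+1]\to[0,n+1]$ be $\alpha'(0)=0$, $\alpha'(j+1)=\alpha(j)+1$ (so that the derived operator of $s_j$ is $s_{j+1}$ and that of $\partial_j$ is $\partial_{j+1}$), and extend the prime termwise to integer combinations of pairs of simplicial operators acting on pairs $(x,y)$. With $g_n$ the degree $n$ part of $\nabla_{K,L}f_{K,L}$, put $\varphi_0=0$ and $\varphi_n=(g_n)'s_0-(\varphi_{n-1})'$. Then $f\nabla=1$, $d\varphi+\varphi d=\nabla f-1$, $\varphi\nabla=0$, $f\varphi=0$, $\varphi^2=0$. The coproduct of the chain coalgebra $C(K)$ is $f_{K,K}\circ(\Delta_K)_\sharp$, where $\Delta_K:K\to K\times K$ is the diagonal and $(\cdot)_\sharp$ denotes induced maps on normalized chains; $C(K)\otimes C(L)$ carries the tensor product coproduct. Cobar construction. For a connected chain coalgebra $(C,d)$ with reduced coproduct $\overline\Delta$, $\Omega C$ is the tensor algebra $T(s^{-1}C_+)$ ($C_+=C_{>0}$, $s^{-1}$ desuspension) with the derivation differential given on generators by $d_\Omega=-s^{-1}ds+(s^{-1}\otimes s^{-1})\overline\Delta s$. A coalgebra map induces a chain algebra map of cobar constructions, denoted $\Omega(\cdot)$. The map $\widetilde\Omega f_{K,L}$. For $1$-reduced $K,L$, let $F_1=f_{K,L}$ and recursively $F_k=-\sum_{i+j=k}(F_i\otimes F_j)\Delta_{C(K\times L)}\varphi_{K,L}:C(K\times L)\to (C(K)\otimes C(L))^{\otimes k}$, where $\Delta_{C(K\times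 L)}$ is the coproduct of $C(K\times L)$. Then $\widetilde\Omega f_{K,L}:\Omega C(K\times L)\to\Omega(C(K)\otimes C(L))$ is the chain algebra map given on generators by $\sum_{k\ge1}(s^{-1})^{\otimes k}F_ks$ (with $s^{-1}$ of degree-$0$ elements set to $0$). Milgram's map. $q:\Omega(C\otimes C')\to\Omega C\otimes\Omega C'$ is the chain algebra map with $q(s^{-1}(x\otimes1))=s^{-1}x\otimes1$, $q(s^{-1}(1\otimes y))=1\otimes s^{-1}y$, $q(s^{-1}(x\otimes y))=0$ for $x\in C_+$, $y\in C'_+$. Alexander-Whitney cobar diagonal. For $K$ $1$-reduced, $\psi_K=q\circ\widetilde\Omega f_{K,K}\circ\Omega(\Delta_K)_\sharp:\Omega C(K)\to\Omega C(K)\otimes\Omega C(K)$. Derivation homotopy. For chain algebra maps $f,g:(A,d)\to(B,d)$, an $(f,g)$-derivation is a degree $+1$ linear map $h:A\to B$ with $h\mu=\mu(h\otimes g+f\otimes h)$, $\mu$ denoting multiplication; it is a derivation homotopy from $f$ to $g$ if moreover $dh+hd=f-g$.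
   Formalization: The recursion is taken as F_k = -Σ_{i+j=k} (-1)^{(i-1)j} (F_i⊗F_j)Δφ; with the printed signs and the Koszul convention the map Ω̃f, and hence ψ_K, is not a chain map (it fails on the 5-simplex of Δ^5/sk_1). *)

(* Defs.v *)
From mathcomp Require Import all_boot all_order all_algebra.
From mathcomp Require Import finmap boolp.
From mathcomp.multinomials Require Import monalg.

Set Implicit Arguments.
Unset Strict Implicit.
Unset Printing Implicit Defensive.

Import GRing.Theory.
Local Open Scope ring_scope.

(* Every complex involved is a graded free abelian group with a preferred
   basis.  It is represented by its basis [B] together with the degrees of the
   basis elements; the group is then [{malg B}], the group of finite formal
   integer combinations of elements of [B] (the direct sum of all degrees), and
   [<< b >>] is the basis element [b].  A tensor product has the product of the
   bases as its basis, a tensor algebra [T(V)] the words in the basis of [V]. *)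

Definition lin (A B : choiceType) (f : A -> {malg B}) (c : {malg A}) :
    {malg B} :=
  \sum_(a <- msupp c) c@_a *: f a.

Definition tens (A B : choiceType) (c : {malg A}) (c' : {malg B}) :
    {malg (A * B)%type} :=
  lin (fun a => lin (fun b => << (a, b) >>) c') c.

Definition sgn (n : nat) : int := (-1) ^+ n.

Record gbasis := GBasis { gsort :> choiceType; gdeg : gsort -> nat }.
Arguments gdeg {g} _.

Definition homog (B : gbasis) (n : nat) (c : {malg B}) : Prop :=
  forall b : B, b \in msupp c -> gdeg b = n.

Definition gtens (A B : gbasis) : gbasis :=
  @GBasis (A * B)%type (fun ab => (gdeg ab.1 + gdeg ab.2)%N).

Section Koszul.
Variables (A B : gbasis) (A' B' : choiceType).

(* [f (x) g] for [g] of degree congruent to [e] modulo 2. *)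
Definition tensmap (e : nat) (f : A -> {malg A'}) (g : B -> {malg B'})
    (ab : A * B) : {malg (A' * B')%type} :=
  sgn (e * gdeg ab.1) *: tens (f ab.1) (g ab.2).

End Koszul.

Definition tens_diff (A B : gbasis) (dA : A -> {malg A}) (dB : B -> {malg B})
    (ab : gtens A B) : {malg gtens A B} :=
  tensmap 0 dA (fun b => << b >>) ab + tensmap 1 (fun a => << a >>) dB ab.

Definition switch (A B : gbasis) : {malg gtens A B} -> {malg gtens B A} :=
  lin (fun ab : gtens A B => << sgn (gdeg ab.1 * gdeg ab.2) *g (ab.2, ab.1) >>).

(* Only the structure maps are recorded in [coalg] and [dga]: the axioms play
   no part in the constructions below. *)

Record coalg := Coalg {
  cbas :> gbasis;
  cdiff : cbas -> {malg cbas};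
  ccop : cbas -> {malg (cbas * cbas)%type} }.
Arguments cdiff {c} _.
Arguments ccop {c} _.

Record dga := Dga {
  abas :> gbasis;
  aone : {malg abas};
  amul : abas -> abas -> {malg abas};
  adiff : abas -> {malg abas} }.
Arguments aone d : clear implicits.
Arguments amul {d} _ _.
Arguments adiff {d} _.

Section ChainAlgebras.
Variables (A B : dga).

Definition mul (R : dga) (x y : {malg R}) : {malg R} :=
  lin (fun ab : R * R => amul ab.1 ab.2) (tens x y).

Definition diff (R : dga) : {malg R} -> {malg R} := lin adiff.

Record chain_algebra_map (f : {malg A} -> {malg B}) : Prop := ChainAlgebraMap {
  cam_linear : linear f;
  cam_deg : forall n x, homog n x -> homog n (f x);
  cam_one : f (aone A) = aone B;
  cam_mul : forall x y, f (mul x y) = mul (f x) (f y);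
  cam_diff : forall x, f (diff x) = diff (f x) }.

Record derivation (f g h : {malg A} -> {malg B}) : Prop := Derivation {
  der_linear : linear h;
  der_deg : forall n x, homog n x -> homog n.+1 (h x);
  der_mul : forall n x y, homog n x ->
    h (mul x y) = mul (h x) (g y) + sgn n *: mul (f x) (h y) }.

Record derivation_homotopy (f g h : {malg A} -> {malg B}) : Prop :=
  DerivationHomotopy {
    dh_source : chain_algebra_map f;
    dh_target : chain_algebra_map g;
    dh_derivation : derivation f g h;
    dh_homotopy : forall x, diff (h x) + h (diff x) = f x - g x }.

Definition dga_tens : dga :=
  @Dga (gtens A B) (tens (aone A) (aone B))
    (fun x y => sgn (gdeg x.2 * gdeg y.1) *:
                tens (amul x.1 y.1) (amul x.2 y.2))
    (tens_diff adiff adiff).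

End ChainAlgebras.

Definition coalg_tens (C D : coalg) : coalg :=
  @Coalg (gtens C D) (tens_diff cdiff cdiff)
    (fun xy => lin
       (fun t : (C * C) * (D * D) =>
          << sgn (gdeg t.1.2 * gdeg t.2.1) *g
             ((t.1.1, t.2.1), (t.1.2, t.2.2)) >>)
       (tens (ccop xy.1) (ccop xy.2))).

Section Cobar.
Variable C : coalg.

(* The generator [s^-1 x] is represented by [x] itself, in degree [|x| - 1]. *)
Definition cobar_gen : choiceType := {x : C | (0 < gdeg x)%N}.

Definition gen_deg (x : cobar_gen) : nat := (gdeg (val x)).-1.

Definition cobar_basis : gbasis :=
  @GBasis (seq cobar_gen) (fun w => \sum_(x <- w) gen_deg x)%N.

(* [(s^-1)^{(x) k} (x_1 (x) ... (x) x_k)], with [s^-1] of degree -1 set to 0 on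
   elements of degree 0.  Moving the last [k - 1] factors [s^-1] past [x_1]
   yields the sign. *)
Fixpoint desusp (w : seq C) : {malg cobar_basis} :=
  if w is x :: w' then
    if insub x is Some g then
      sgn (size w' * gdeg x) *:
        lin (fun v : cobar_basis => << (g :: v : cobar_basis) >>) (desusp w')
    else 0
  else << ([::] : cobar_basis) >>.

(* As [desusp] vanishes on words with a letter of degree 0, only the component
   of the coproduct in [C_+ (x) C_+], i.e. the reduced coproduct, contributes. *)
Definition cobar_diff_gen (x : cobar_gen) : {malg cobar_basis} :=
  - lin (fun y : C => desusp [:: y]) (cdiff (val x))
  + lin (fun t : C * C => desusp [:: t.1; t.2]) (ccop (val x)).

Fixpoint cobar_diff (w : cobar_basis) : {malg cobar_basis} :=
  if w is x :: w' then
    lin (fun u : cobar_basis => << (u ++ w' : cobar_basis) >>)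
      (cobar_diff_gen x)
    + sgn (gen_deg x) *:
        lin (fun u : cobar_basis => << (x :: u : cobar_basis) >>)
          (cobar_diff w')
  else 0.

Definition cobar : dga :=
  @Dga cobar_basis << ([::] : cobar_basis) >>
    (fun u v => << (u ++ v : cobar_basis) >>) cobar_diff.

Section Extension.
Variables (R : dga) (f : cobar_gen -> {malg R}).

Fixpoint alg_ext_word (w : cobar_basis) : {malg R} :=
  if w is x :: w' then mul (f x) (alg_ext_word w') else aone R.

(* The algebra map that takes the value [f x] on each generator [s^-1 x]. *)
Definition alg_ext : {malg cobar} -> {malg R} := lin alg_ext_word.

End Extension.

End Cobar.

Definition cobar_map (C D : coalg) (f : C -> {malg D}) :
    {malg cobar C} -> {malg cobar D} :=
  alg_ext (R := cobar D)
    (fun x : cobar_gen C => lin (fun y : D => desusp [:: y]) (f (val x))).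

(* In a connected coalgebra the only basis element of degree 0 is 1. *)
Definition milgram_gen (C D : coalg) (t : cobar_gen (coalg_tens C D)) :
    {malg dga_tens (cobar C) (cobar D)} :=
  let: (x, y) := val t in
  if gdeg y == 0 then tens (desusp [:: x]) (aone (cobar D))
  else if gdeg x == 0 then tens (aone (cobar C)) (desusp [:: y])
  else 0.

Definition milgram (C D : coalg) :
    {malg cobar (coalg_tens C D)} -> {malg dga_tens (cobar C) (cobar D)} :=
  alg_ext (@milgram_gen C D).

(* [simpop m n] is the set of monotone maps [0,m] -> [0,n]. *)

Definition monotone m n (f : {ffun 'I_m.+1 -> 'I_n.+1}) : bool :=
  [forall i : 'I_m.+1, forall j : 'I_m.+1, (i <= j) ==> (f i <= f j)]%N.

Definition simpop m n := {f : {ffun 'I_m.+1 -> 'I_n.+1} | monotone f}.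

Lemma monotoneP m n (f : {ffun 'I_m.+1 -> 'I_n.+1}) :
  reflect (forall i j : 'I_m.+1, (i <= j)%N -> (f i <= f j)%N) (monotone f).
Proof.
apply: (iffP forallP) => [H i j ij|H i].
  by move/forallP/(_ j)/implyP: (H i); apply.
by apply/forallP => j; apply/implyP/H.
Qed.

Lemma idop_proof n : monotone [ffun i : 'I_n.+1 => i].
Proof. by apply/monotoneP => i j; rewrite !ffunE. Qed.

Definition idop n : simpop n n := exist (@monotone _ _) _ (idop_proof n).

Lemma compop_proof l m n (a : simpop m n) (b : simpop l m) :
  monotone [ffun i => val a (val b i)].
Proof.
apply/monotoneP => i j ij; rewrite !ffunE.
by apply: (monotoneP _ (valP a)); apply: (monotoneP _ (valP b)).
Qed.

Definition compop l m n (a : simpop m n) (b : simpop l m) : simpop l n :=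
  exist (@monotone _ _) _ (compop_proof a b).

Lemma natop_proof m n (f : nat -> nat) (hf : {homo f : i j / (i <= j)%N}) :
  monotone [ffun i : 'I_m.+1 => inord (minn (f i) n) : 'I_n.+1].
Proof.
apply/monotoneP => i j ij; rewrite !ffunE !inordK ?ltnS ?geq_minr //.
by rewrite leq_min geq_minr andbT (leq_trans (geq_minl _ _)) ?hf.
Qed.

(* The monotone map [i |-> min (f i) n]; it is only used where [f] maps [0,m]
   into [0,n]. *)
Definition natop m n (f : nat -> nat) (hf : {homo f : i j / (i <= j)%N}) :
  simpop m n := exist (@monotone _ _) _ (natop_proof m n hf).

Lemma bump_homo k : {homo bump k : i j / (i <= j)%N}.
Proof. by move=> i j; rewrite leq_bump2. Qed.

Lemma unbump_homo k : {homo unbump k : i j / (i <= j)%N}.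
Proof.
move=> i j ij; rewrite /unbump; case: (ltnP k i) => ki.
  by rewrite (leq_trans ki ij) leq_sub2r.
case: (ltnP k j) => kj; last by rewrite !subn0.
by rewrite subn0 (leq_trans ki) // subn1 -ltnS (ltn_predK kj).
Qed.

Lemma front_homo : {homo (fun i : nat => i) : i j / (i <= j)%N}.
Proof. by []. Qed.

Lemma back_homo k : {homo addn k : i j / (i <= j)%N}.
Proof. by move=> i j; rewrite leq_add2l. Qed.

Lemma shuffle_homo n (mu : {set 'I_n}) :
  {homo (fun j => #|[set m in mu | (m < j)%N]|) : i j / (i <= j)%N}.
Proof.
move=> i j ij; apply/subset_leq_card/fintype.subsetP => m.
by rewrite !inE => /andP[-> mi]; apply: leq_trans mi ij.
Qed.

(* The operators of the face [d_i] and of the degeneracy [s_i]. *)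
Definition faceop n (i : nat) : simpop n n.+1 := natop n n.+1 (bump_homo i).
Definition degop n (i : nat) : simpop n.+1 n := natop n.+1 n (unbump_homo i).

(* For [p <= n]: the operators of [x |-> x_{0...p}] and
   [x |-> x_{n-p...n}]. *)
Definition frontop p n : simpop p n := natop p n front_homo.
Definition backop p n : simpop p n := natop p n (back_homo (n - p)).

(* For [mu] of cardinality [p] in [{0,...,n-1}], with complement
   [nu_1 < ... < nu_q]: the operator of [s_{nu_q} ... s_{nu_1}], i.e. the
   surjection [0,n] -> [0,p] with equal values at [j] and [j+1] exactly when
   [j] belongs to [nu]. *)
Definition shuffleop n p (mu : {set 'I_n}) : simpop n p :=
  natop n p (shuffle_homo mu).

(* Number of inversions of the shuffle. *)
Definition shuffle_sgn n (mu : {set 'I_n}) : nat :=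
  #|[set t : 'I_n * 'I_n | [&& t.1 \in mu, t.2 \notin mu & (t.2 < t.1)%N]]|.

Lemma derop_proof m n (a : simpop m n) :
  monotone [ffun i : 'I_m.+2 =>
    if unlift ord0 i is Some j then lift ord0 (val a j) else ord0 : 'I_n.+2].
Proof.
apply/monotoneP => i j ij; rewrite !ffunE.
case: (unliftP ord0 i) ij => [i' ->|-> //] ij.
case: (unliftP ord0 j) ij => [j' ->|->] //.
by rewrite !lift0 !ltnS => ij; apply: (monotoneP _ (valP a)).
Qed.

Definition derop m n (a : simpop m n) : simpop m.+1 n.+1 :=
  exist (@monotone _ _) _ (derop_proof a).

Definition oppair m n : choiceType := (simpop m n * simpop m n)%type.

Definition derive m n : {malg oppair m n} -> {malg oppair m.+1 n.+1} :=
  lin (fun ab => << ((derop ab.1, derop ab.2) : oppair m.+1 n.+1) >>).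

(* The composite of [f] followed by [nabla], as a combination of pairs of
   operators: the outer sum is that of [f], the inner one runs over the
   [(i, n - i)]-shuffles [(mu, nu)], with [nu] the complement of [mu]. *)
Definition nabla_f_op n : {malg oppair n n} :=
  \sum_(i < n.+1) \sum_(mu : {set 'I_n} | #|mu| == i)
    << sgn (shuffle_sgn mu) *g
       ((compop (frontop i n) (shuffleop i mu),
         compop (backop (n - i) n) (shuffleop (n - i) (~: mu)))
         : oppair n n) >>.

Fixpoint phi_op n : {malg oppair n.+1 n} :=
  if n is n'.+1 return {malg oppair n.+1 n} then
    lin (fun ab : oppair n'.+2 n'.+2 =>
           << ((compop (degop n'.+1 0) ab.1, compop (degop n'.+1 0) ab.2)
               : oppair n'.+2 n'.+1) >>)
      (derive (nabla_f_op n'.+1))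
    - derive (phi_op n')
  else 0.

Record sset := SSet {
  simplex :> nat -> choiceType;
  act : forall m n, simpop m n -> simplex n -> simplex m;
  act_id : forall n (x : simplex n), act (idop n) x = x;
  act_comp : forall l m n (a : simpop m n) (b : simpop l m) (x : simplex n),
    act (compop a b) x = act b (act a x) }.
Arguments act {s m n} a x.

Definition one_reduced (K : sset) : Prop :=
  exists v : K 0, (forall w : K 0, w = v) /\
                  (forall x : K 1, x = act (degop 0 0) v).

Section Product.
Variables K L : sset.

Definition prod_simplex n : choiceType := (K n * L n)%type.

Definition prod_act m n (a : simpop m n) (x : prod_simplex n) :
  prod_simplex m := (act a x.1, act a x.2).

Lemma prod_act_id n (x : prod_simplex n) : prod_act (idop n) x = x.
Proof. by case: x => x y; rewrite /prod_act !act_id. Qed.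

Lemma prod_act_comp l m n (a : simpop m n) (b : simpop l m)
  (x : prod_simplex n) : prod_act (compop a b) x = prod_act b (prod_act a x).
Proof. by rewrite /prod_act !act_comp. Qed.

Definition sprod : sset := SSet prod_act_id prod_act_comp.

End Product.

Definition degenerate (K : sset) n : K n -> Prop :=
  if n is m.+1 return K n -> Prop then
    fun x => exists (i : 'I_m.+1) (y : K m), x = act (degop m i) y
  else fun _ => False.

Section Chains.
Variable K : sset.

Definition nondeg n : choiceType := {x : K n | ~~ `[< degenerate x >]}.

(* The normalized chains are free on the nondegenerate simplices; the class of
   an arbitrary simplex is [nchain x], which is 0 if [x] is degenerate. *)
Definition chain_basis : gbasis := @GBasis {n : nat & nondeg n} (@tag _ _).

Definition nchain n (x : K n) : {malg chain_basis} :=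
  if insub x is Some y then << (Tagged nondeg y : chain_basis) >> else 0.

Definition chain_diff_simplex n : K n -> {malg chain_basis} :=
  if n is m.+1 return K n -> {malg chain_basis} then
    fun x => \sum_(i < m.+2) sgn i *: nchain (act (faceop m i) x)
  else fun _ => 0.

Definition chain_diff (b : chain_basis) : {malg chain_basis} :=
  chain_diff_simplex (val (tagged b)).

End Chains.

Section EilenbergZilber.
Variables K L : sset.

Definition alexander_whitney (b : chain_basis (sprod K L)) :
    {malg gtens (chain_basis K) (chain_basis L)} :=
  let n := tag b in let xy := val (tagged b) in
  \sum_(i < n.+1) tens (nchain (act (frontop i n) xy.1))
                       (nchain (act (backop (n - i) n) xy.2)).

Definition phi (b : chain_basis (sprod K L)) :
    {malg chain_basis (sprod K L)} :=
  let n := tag b in let xy := val (tagged b) in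
  lin (fun ab : oppair n.+1 n =>
         nchain ((act ab.1 xy.1, act ab.2 xy.2) : sprod K L n.+1))
      (phi_op n).

End EilenbergZilber.

Definition diag (K : sset) (b : chain_basis K) :
    {malg chain_basis (sprod K K)} :=
  let x := val (tagged b) in nchain ((x, x) : sprod K K (tag b)).

Definition chains (K : sset) : coalg :=
  @Coalg (chain_basis K) (@chain_diff K)
    (fun b => lin (@alexander_whitney K K) (diag b)).

Section OmegaTilde.
Variables K L : sset.

Let CKL := chains (sprod K L).
Let T := coalg_tens (chains K) (chains L).

(* The tensor powers of [C(K) (x) C(L)] are all taken inside its tensor
   algebra.  [F_rec N k] is [F_k] for [1 <= k <= N].

   As [|F_k| = k - 1], the composite of [(s^-1)^{(x) i} (x) (s^-1)^{(x) j}]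
   with [F_i (x) F_j] is [(-1)^{(i-1)j}] times
   [(s^-1)^{(x) i} F_i (x) (s^-1)^{(x) j} F_j].  The sign [sgn (i.-1 * j)]
   below compensates for this, so that the recursion reads
   [t_k = - \sum_{i+j=k} (t_i (x) t_j) Delta phi] for the desuspended maps
   [t_k = (s^-1)^{(x) k} F_k] of degree -1.  Without it the map
   [omega_tilde_f] would not commute with the differentials (from degree 5
   on). *)
Fixpoint F_rec (N k : nat) : CKL -> {malg seq T} :=
  if N is N'.+1 then
    if k == 1 then
      fun x => lin (fun t : T => << [:: t] >>) (alexander_whitney x)
    else
      fun x => - \sum_(1 <= i < k)
        sgn (i.-1 * (k - i)) *:
        lin (fun w : seq T * seq T => << w.1 ++ w.2 >>)
          (lin (tensmap (k - i).-1 (F_rec N' i) (F_rec N' (k - i)))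
             (lin ccop (phi x : {malg CKL})))
  else fun _ => 0.

Definition F (k : nat) : CKL -> {malg seq T} := F_rec k k.

(* [F_k x] has degree [|x| + k - 1], whereas, for 1-reduced [K] and [L], a word
   of length [k] on which [desusp] does not vanish has degree at least [2 k];
   hence the terms with [k >= |x|] of the sum over all [k >= 1] are zero. *)
Definition omega_tilde_f_gen (x : cobar_gen CKL) : {malg cobar T} :=
  \sum_(1 <= k < (gdeg (val x)).+1) lin (@desusp T) (F k (val x)).

Definition omega_tilde_f : {malg cobar CKL} -> {malg cobar T} :=
  alg_ext omega_tilde_f_gen.

End OmegaTilde.

Definition cobar_diagonal (K : sset) :
    {malg cobar (chains K)} ->
    {malg dga_tens (cobar (chains K)) (cobar (chains K))} :=
  fun c => @milgram (chains K) (chains K)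
    (@omega_tilde_f K K
      (cobar_map (C := chains K) (D := chains (sprod K K)) (@diag K) c)).

(* Main.v *)
(* Write [t_k] for the desuspended maps [F_k].  The sum [t] of their images under
   [q] satisfies [t = alpha f - (t u t) phi], where [alpha] is the restriction of
   [q] to generators and [u] is the cup product of maps
   [C(K x K) -> Omega C(K) (x) Omega C(K)].
   The Eilenberg-Zilber identities alone imply that [t] is a twisting cochain
   and that [t nabla = alpha]: the defect of the twisting equation satisfies a
   recursion through [phi] whose only solution is 0.

   Conjugating [t] by the two switch maps gives another twisting cochain [t'],
   and [t' nabla = t nabla] because [nabla] and [alpha] are symmetric.  Hence
   [H = (t - t' - H u t' + t u H) phi] recursively defines a homotopy between
   [t] and [t'].  The diagonal of [K] is invariant under the switch, so pulling
   [t], [t'] and [H] back along it yields twisting cochains for [psi] and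
   [sw psi], and a homotopy that extends to a derivation homotopy.

   The Eilenberg-Zilber identities themselves are proved for formal
   combinations of vertex lists, a simplex of [K x L] being a list of pairs of
   vertices: the recursion for [phi] and the last-vertex recursion for shuffles
   become recursions on lists. *)

From HB Require Import structures.
From Pilot Require Import Defs.
From mathcomp Require Import all_boot all_order all_algebra.
From mathcomp Require Import finmap boolp ring zify.
From mathcomp.multinomials Require Import monalg.

Set Implicit Arguments.
Unset Strict Implicit.
Unset Printing Implicit Defensive.

Import GRing.Theory.
Local Open Scope ring_scope.

(** * Linear extension and tensor products *)

(** Neither f nor phi is compatible with exchanging the factors, so psi and its switched version
    obey different recursions. What they share is the restriction along nabla; the homotopy identity
    for phi spreads information from the image of nabla to all of C(K x K). Hence each equation is
    proved through its error, which is expressed by phi applied to cup products containing the error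
    again.

    Such recursions end by degree, and here 1-reducedness acts: no basis element has degree 1 and
    twisting cochains vanish in degree 0, so in a cup product the other factor is evaluated at least
    two degrees lower, while phi raises the degree by one only.

    After desuspension all t_k have degree -1. This makes their sum a single map t and the double
    sum over i + j = k a single cup square with a uniform sign.

    The list calculus uses the augmented complex: a single vertex has the empty list as its
    boundary, so that prepending a vertex is a contracting homotopy. Empty lists and lists with a
    repeated neighbour disappear only on evaluation in normalized chains; until then identities hold
    exactly or up to such lists. *)

(* [lin], [tens] and the basis elements are locked: otherwise failing
   unification problems unfold them down to finite maps. *)
HB.lock Definition mon (A : choiceType) (a : A) : {malg A} := << a >>.
HB.lock Definition lext (A B : choiceType) (f : A -> {malg B}) (c : {malg A}) :
  {malg B} := lin f c.
HB.lock Definition ten (A B : choiceType) (c : {malg A}) (c' : {malg B}) :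
  {malg (A * B)%type} := tens c c'.

Lemma monE (A : choiceType) (a : A) : << a >> = mon a.
Proof. by rewrite mon.unlock. Qed.

Lemma lextE (A B : choiceType) : @lin A B = @lext A B.
Proof. by rewrite lext.unlock. Qed.

Lemma tenE (A B : choiceType) : @tens A B = @ten A B.
Proof. by rewrite ten.unlock. Qed.

Lemma monZE (A : choiceType) (z : int) (a : A) :
  << z *g a >> = z *: mon a :> {malg A}.
Proof.
by rewrite -monE; apply/malgP => k; rewrite mcoeffZ !mcoeffU mulrnAr mulr1.
Qed.

Lemma lin_widen (A B : choiceType) (f : A -> {malg B}) (c : {malg A})
    (d : {fset A}) :
  {subset msupp c <= d} -> lin f c = \sum_(a <- d) c@_a *: f a.
Proof.
move=> cd; apply: big_fset_incl; first by apply/fsubsetP.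
by move=> a _ /mcoeff_outdom ->; rewrite scale0r.
Qed.

Fact lext_is_linear (A B : choiceType) (f : A -> {malg B}) : linear (lext f).
Proof.
move=> z c c'; rewrite -lextE; pose d := (msupp c `|` msupp c')%fset.
rewrite !(@lin_widen _ _ _ _ d); first last.
- move=> a /(fsubsetP (msuppD_le _ _)); rewrite !inE => /orP[|->];
    last by rewrite orbT.
  by move/(fsubsetP (msuppZ_le _ _)) ->.
- by move=> a ac; rewrite !inE ac.
- by move=> a ac; rewrite !inE ac orbT.
rewrite scaler_sumr -big_split; apply: eq_bigr => a _.
by rewrite mcoeffD mcoeffZ scalerDl scalerA.
Qed.

HB.instance Definition _ (A B : choiceType) (f : A -> {malg B}) :=
  GRing.isLinear.Build int {malg A} {malg B} *:%R (lext f) (lext_is_linear f).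

Lemma lextP (A B : choiceType) (f : A -> {malg B}) z c c' :
  lext f (z *: c + c') = z *: lext f c + lext f c'.
Proof. exact: linearP. Qed.

Lemma lextD (A B : choiceType) (f : A -> {malg B}) c c' :
  lext f (c + c') = lext f c + lext f c'.
Proof. exact: linearD. Qed.

Lemma lextB (A B : choiceType) (f : A -> {malg B}) c c' :
  lext f (c - c') = lext f c - lext f c'.
Proof. exact: linearB. Qed.

Lemma lextN (A B : choiceType) (f : A -> {malg B}) c : lext f (- c) = - lext f c.
Proof. exact: linearN. Qed.

Lemma lextZ (A B : choiceType) (f : A -> {malg B}) z c :
  lext f (z *: c) = z *: lext f c.
Proof. exact: linearZ. Qed.

Lemma lext0 (A B : choiceType) (f : A -> {malg B}) : lext f 0 = 0.
Proof. exact: linear0. Qed.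

Lemma lext_sum (A B : choiceType) (f : A -> {malg B}) I (r : seq I) (P : pred I)
    (F : I -> {malg A}) :
  lext f (\sum_(i <- r | P i) F i) = \sum_(i <- r | P i) lext f (F i).
Proof. exact: linear_sum. Qed.

Lemma lextU (A B : choiceType) (f : A -> {malg B}) a : lext f (mon a) = f a.
Proof.
rewrite -lextE -monE (@lin_widen _ _ _ _ [fset a]%fset).
  by rewrite big_seq_fset1 mcoeffUU scale1r.
by apply/fsubsetP/msuppU_le.
Qed.

(** [homog n] is the instance with predicate [gdeg b = n], so the closure lemmas for [allsupp] serve
    alike for degrees, for degeneracy and for monotonicity of vertex lists. *)
Definition allsupp (A : choiceType) (Q : A -> Prop) (c : {malg A}) :=
  forall a, a \in msupp c -> Q a.

Lemma malg_ind_in (A : choiceType) (Q : A -> Prop) (P : {malg A} -> Prop) :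
  P 0 -> (forall z a c, Q a -> P c -> P (z *: (mon a) + c)) ->
  forall c, allsupp Q c -> P c.
Proof.
move=> P0 PD c Qc; rewrite (monalgE c).
elim: (msupp c : seq A) (Qc : forall a, a \in (msupp c : seq A) -> Q a).
  by move=> _; rewrite big_nil.
move=> a s IH Qs; rewrite big_cons monZE; apply: PD.
  by apply: Qs; rewrite mem_head.
by apply: IH => b bs; apply: Qs; rewrite inE bs orbT.
Qed.

Lemma malg_ind (A : choiceType) (P : {malg A} -> Prop) :
  P 0 -> (forall z a c, P c -> P (z *: (mon a) + c)) -> forall c, P c.
Proof.
by move=> P0 PD c; apply: (@malg_ind_in _ (fun=> True)) => // z a c' _; apply: PD.
Qed.

Lemma eq_lext_in (A B : choiceType) (Q : A -> Prop) (f g : A -> {malg B}) c :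
  allsupp Q c -> (forall a, Q a -> f a = g a) -> lext f c = lext g c.
Proof.
move=> Qc fg; elim/(@malg_ind_in _ Q): c / Qc => [|z a c Qa IH].
  by rewrite !lext0.
by rewrite !lextP !lextU fg // IH.
Qed.

Lemma eq_lext (A B : choiceType) (f g : A -> {malg B}) c :
  f =1 g -> lext f c = lext g c.
Proof. by move=> fg; apply: (@eq_lext_in _ _ (fun=> True)). Qed.

Lemma lext_id (A : choiceType) (c : {malg A}) : lext (fun a => (mon a)) c = c.
Proof.
elim/malg_ind: c => [|z a c IH]; first by rewrite lext0.
by rewrite lextP lextU IH.
Qed.

Lemma lext_comp (A B C : choiceType) (g : {linear {malg B} -> {malg C}})
  (f : A -> {malg B}) c : g (lext f c) = lext (fun a => g (f a)) c.
Proof.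
elim/malg_ind: c => [|z a c IH]; first by rewrite lext0 !linear0.
by rewrite !lextP linearP !lextU IH.
Qed.

Lemma lext_lext (A B C : choiceType) (g : B -> {malg C})
  (f : A -> {malg B}) c : lext g (lext f c) = lext (fun a => lext g (f a)) c.
Proof. exact: lext_comp. Qed.

Lemma lext_map (A B C : choiceType) (h : B -> {malg C}) (g : A -> B) c :
  lext h (lext (fun a => (mon (g a))) c) = lext (fun a => h (g a)) c.
Proof. by rewrite lext_lext; apply: eq_lext => a; rewrite lextU. Qed.

Lemma lextDf (A B : choiceType) (f g : A -> {malg B}) c :
  lext (fun a => f a + g a) c = lext f c + lext g c.
Proof.
elim/malg_ind: c => [|z a c IH]; first by rewrite !lext0 ?addr0.
by rewrite !lextP !lextU IH scalerDr addrACA.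
Qed.

Lemma lextZf (A B : choiceType) z (f : A -> {malg B}) c :
  lext (fun a => z *: f a) c = z *: lext f c.
Proof.
elim/malg_ind: c => [|y a c IH]; first by rewrite !lext0 scaler0.
by rewrite !lextP !lextU IH scalerDr !scalerA mulrC.
Qed.

Lemma lextNf (A B : choiceType) (f : A -> {malg B}) c :
  lext (fun a => - f a) c = - lext f c.
Proof.
by rewrite -scaleN1r -lextZf; apply: eq_lext => a; rewrite scaleN1r.
Qed.

Lemma lextBf (A B : choiceType) (f g : A -> {malg B}) c :
  lext (fun a => f a - g a) c = lext f c - lext g c.
Proof. by rewrite lextDf lextNf. Qed.

Lemma lext0f (A B : choiceType) c : lext (fun _ : A => 0 : {malg B}) c = 0.
Proof.
elim/malg_ind: c => [|y a c IH]; first by rewrite !lext0.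
by rewrite lextP lextU IH scaler0 addr0.
Qed.

Lemma lext_sumf (A B : choiceType) I (r : seq I) (P : pred I)
    (f : I -> A -> {malg B}) c :
  lext (fun a => \sum_(i <- r | P i) f i a) c = \sum_(i <- r | P i) lext (f i) c.
Proof.
elim: r => [|i r IH].
  by rewrite big_nil (eq_lext (g := fun=> 0)) ?lext0f // => a; rewrite big_nil.
rewrite big_cons -IH; case: ifP => Pi; last first.
  by apply: eq_lext => a; rewrite big_cons Pi.
by rewrite -lextDf; apply: eq_lext => a; rewrite big_cons Pi.
Qed.

Lemma lext_exchange (A B C : choiceType) (h : A -> B -> {malg C}) c c' :
  lext (fun a => lext (h a) c') c = lext (fun b => lext (h^~ b) c) c'.
Proof.
elim/malg_ind: c => [|z a c IH].
  by rewrite lext0 (eq_lext (g := fun=> 0)) ?lext0f // => b; rewrite lext0.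
rewrite lextP lextU IH -lextZf -lextDf; apply: eq_lext => b.
by rewrite lextP lextU.
Qed.

Lemma ten_lextE (A B : choiceType) (c : {malg A}) (c' : {malg B}) :
  ten c c' = lext (fun a => lext (fun b => mon (a, b)) c') c.
Proof.
rewrite -tenE /tens lextE; apply: eq_lext => a; rewrite lextE.
by apply: eq_lext => b; rewrite monE.
Qed.

Lemma lext_ten (A B C : choiceType) (h : A * B -> {malg C}) c c' :
  lext h (ten c c') = lext (fun a => lext (fun b => h (a, b)) c') c.
Proof.
rewrite ten_lextE lext_lext; apply: eq_lext => a; rewrite lext_lext.
by apply: eq_lext => b; rewrite lextU.
Qed.

Lemma lext_tenC (A B C : choiceType) (h : A * B -> {malg C}) c c' :
  lext h (ten c c') = lext (fun b => lext (fun a => h (a, b)) c) c'.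
Proof. by rewrite lext_ten lext_exchange. Qed.

Lemma tenUU (A B : choiceType) (a : A) (b : B) :
  ten (mon a) (mon b) = (mon (a, b)).
Proof. by rewrite ten_lextE !lextU. Qed.

Lemma ten_lextC (A B : choiceType) (c : {malg A}) (c' : {malg B}) :
  ten c c' = lext (fun b => lext (fun a => (mon (a, b))) c) c'.
Proof. by rewrite ten_lextE lext_exchange. Qed.

Fact ten_is_linear (A B : choiceType) (c : {malg A}) :
  linear (@ten A B c).
Proof. by move=> z u v; rewrite !ten_lextC lextP. Qed.

HB.instance Definition _ (A B : choiceType) (c : {malg A}) :=
  GRing.isLinear.Build int {malg B} {malg (A * B)%type} *:%R (@ten A B c)
    (@ten_is_linear A B c).

(** Gives linearity in the first argument a head constant of its own, so that it can be registered
    as an instance and fed to [lext_comp]. *)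
Definition tenr (A B : choiceType) (c : {malg B}) (c' : {malg A}) :=
  ten c' c.

Fact tenr_is_linear (A B : choiceType) (c : {malg B}) :
  linear (@tenr A B c).
Proof. by move=> z u v; rewrite /tenr !ten_lextE lextP. Qed.

HB.instance Definition _ (A B : choiceType) (c : {malg B}) :=
  GRing.isLinear.Build int {malg A} {malg (A * B)%type} *:%R (@tenr A B c)
    (@tenr_is_linear A B c).

Lemma tenDr (A B : choiceType) (c : {malg A}) (c' d : {malg B}) :
  ten c (c' + d) = ten c c' + ten c d.
Proof. exact: linearD. Qed.

Lemma tenNr (A B : choiceType) (c : {malg A}) (c' : {malg B}) :
  ten c (- c') = - ten c c'.
Proof. exact: linearN. Qed.

Lemma tenZr (A B : choiceType) z (c : {malg A}) (c' : {malg B}) :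
  ten c (z *: c') = z *: ten c c'.
Proof. exact: linearZ. Qed.

Lemma ten0r (A B : choiceType) (c : {malg A}) :
  ten c (0 : {malg B}) = 0.
Proof. exact: linear0. Qed.

Lemma tenDl (A B : choiceType) (c d : {malg A}) (c' : {malg B}) :
  ten (c + d) c' = ten c c' + ten d c'.
Proof. exact: (linearD (tenr c')). Qed.

Lemma tenNl (A B : choiceType) (c : {malg A}) (c' : {malg B}) :
  ten (- c) c' = - ten c c'.
Proof. exact: (linearN (tenr c')). Qed.

Lemma tenZl (A B : choiceType) z (c : {malg A}) (c' : {malg B}) :
  ten (z *: c) c' = z *: ten c c'.
Proof. exact: (linearZZ (tenr c')). Qed.

Lemma ten0l (A B : choiceType) (c' : {malg B}) :
  ten (0 : {malg A}) c' = 0.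
Proof. exact: (linear0 (tenr c')). Qed.

Lemma ten_lextl (A B C : choiceType) (f : C -> {malg A}) c (c' : {malg B}) :
  ten (lext f c) c' = lext (fun a => ten (f a) c') c.
Proof. exact: (lext_comp (tenr c')). Qed.

Lemma ten_lextr (A B C : choiceType) (f : C -> {malg B}) c (c' : {malg A}) :
  ten c' (lext f c) = lext (fun a => ten c' (f a)) c.
Proof. exact: lext_comp. Qed.

Lemma ten_lext (A B C D : choiceType) (f : C -> {malg A}) (g : D -> {malg B})
    c c' :
  ten (lext f c) (lext g c') =
  lext (fun t => ten (f t.1) (g t.2)) (ten c c').
Proof.
rewrite lext_ten ten_lextl; apply: eq_lext => a.
by rewrite ten_lextr.
Qed.

Lemma allsupp0 (A : choiceType) (Q : A -> Prop) : allsupp Q 0.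
Proof. by move=> a; rewrite msupp0. Qed.

Lemma allsuppU (A : choiceType) (Q : A -> Prop) a : Q a -> allsupp Q (mon a).
Proof. by rewrite -monE => Qa b /(fsubsetP msuppU_le); rewrite inE => /eqP ->. Qed.

Lemma allsuppD (A : choiceType) (Q : A -> Prop) c c' :
  allsupp Q c -> allsupp Q c' -> allsupp Q (c + c').
Proof.
move=> Qc Qc' a /(fsubsetP (msuppD_le _ _)); rewrite !inE => /orP[].
  exact: Qc.
exact: Qc'.
Qed.

Lemma allsuppZ (A : choiceType) (Q : A -> Prop) z c :
  allsupp Q c -> allsupp Q (z *: c).
Proof. by move=> Qc a /(fsubsetP (msuppZ_le _ _)) /Qc. Qed.

Lemma allsuppN (A : choiceType) (Q : A -> Prop) c :
  allsupp Q c -> allsupp Q (- c).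
Proof. by move=> Qc; rewrite -scaleN1r; apply: allsuppZ. Qed.

Lemma allsuppB (A : choiceType) (Q : A -> Prop) c c' :
  allsupp Q c -> allsupp Q c' -> allsupp Q (c - c').
Proof. by move=> Qc Qc1; apply: allsuppD => //; apply: allsuppN. Qed.

Lemma allsupp_sum (A : choiceType) (Q : A -> Prop) I (r : seq I) (P : pred I)
    (f : I -> {malg A}) :
  (forall i, P i -> allsupp Q (f i)) -> allsupp Q (\sum_(i <- r | P i) f i).
Proof.
move=> Qf; elim/big_ind: _ => //; first exact: allsupp0.
by move=> x y; apply: allsuppD.
Qed.

Lemma allsupp_lext (A B : choiceType) (Q : A -> Prop) (R : B -> Prop)
    (f : A -> {malg B}) c :
  allsupp Q c -> (forall a, Q a -> allsupp R (f a)) -> allsupp R (lext f c).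
Proof.
move=> Qc Rf; elim/(@malg_ind_in _ Q): c / Qc => [|z a c Qa IH].
  by rewrite lext0; apply: allsupp0.
by rewrite lextP lextU; apply: allsuppD => //; apply: allsuppZ; apply: Rf.
Qed.

Lemma allsupp_lext_all (A B : choiceType) (R : B -> Prop)
    (f : A -> {malg B}) c :
  (forall a, allsupp R (f a)) -> allsupp R (lext f c).
Proof. by move=> Rf; apply: (@allsupp_lext _ _ (fun=> True)). Qed.

Lemma allsuppW (A : choiceType) (Q R : A -> Prop) c :
  allsupp Q c -> (forall a, Q a -> R a) -> allsupp R c.
Proof. by move=> Qc QR a /Qc /QR. Qed.

Lemma allsupp_ten (A B : choiceType) (Q : A -> Prop) (R : B -> Prop) c c' :
  allsupp Q c -> allsupp R c' ->
  allsupp (fun t => Q t.1 /\ R t.2) (ten c c').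
Proof.
move=> Qc Rc'; rewrite ten_lextE; apply: (allsupp_lext Qc) => a Qa.
by apply: (allsupp_lext Rc') => b Rb; apply: allsuppU.
Qed.

Lemma allsuppI (A : choiceType) (Q R : A -> Prop) c :
  allsupp Q c -> allsupp R c -> allsupp (fun a => Q a /\ R a) c.
Proof. by move=> Qc Rc a ac; split; [apply: Qc | apply: Rc]. Qed.

Lemma lext_eq0_in (A B : choiceType) (Q : A -> Prop) (f : A -> {malg B}) c :
  allsupp Q c -> (forall a, Q a -> f a = 0) -> lext f c = 0.
Proof. by move=> Qc f0; rewrite (eq_lext_in (g := fun=> 0) Qc) // lext0f. Qed.

Lemma sgnD m n : sgn (m + n) = sgn m * sgn n.
Proof. exact: exprD. Qed.

Lemma sgn_odd n : sgn n = (-1) ^+ odd n.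
Proof. by rewrite signr_odd. Qed.

Lemma sgnS n : sgn n.+1 = - sgn n.
Proof. by rewrite /sgn exprS mulN1r. Qed.

Lemma sgn0 : sgn 0 = 1. Proof. by []. Qed.

Lemma sgn_sqr n : sgn n * sgn n = 1.
Proof. by rewrite /sgn -expr2 sqrr_sign. Qed.

(** * Reflection for linear identities with integer coefficients *)

Section ModuleExpressions.
Variable V : lmodType int.

Inductive mexpr :=
  | MAtom of nat | MZero | MAdd of mexpr & mexpr | MOpp of mexpr
  | MScale of int & mexpr.

Fixpoint meval (l : seq V) (e : mexpr) : V :=
  match e with
  | MAtom i => nth 0 l i
  | MZero => 0
  | MAdd e1 e2 => meval l e1 + meval l e2
  | MOpp e => - meval l e
  | MScale z e => z *: meval l e
  end.

(** [Nat.eqb] is a comparison that [cbn] computes when [module] unfolds the coefficients for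
    [ring]. *)
Fixpoint mcoef (i : nat) (e : mexpr) : int :=
  match e with
  | MAtom j => if Nat.eqb i j then 1 else 0
  | MZero => 0
  | MAdd e1 e2 => mcoef i e1 + mcoef i e2
  | MOpp e => - mcoef i e
  | MScale z e => z * mcoef i e
  end.

Fixpoint meq (n : nat) (e1 e2 : mexpr) : Prop :=
  if n is m.+1 then mcoef m e1 = mcoef m e2 /\ meq m e1 e2 else True.

Lemma mevalE l e : meval l e = \sum_(i < size l) mcoef i e *: nth 0 l i.
Proof.
elim: e => [j||e1 IH1 e2 IH2|e IH|z e IH] /=.
- case: (ltnP j (size l)) => [jl|lj].
    rewrite (bigD1 (Ordinal jl)) //= big1 => [|i ij].
      by rewrite PeanoNat.Nat.eqb_refl scale1r addr0.
    case: PeanoNat.Nat.eqb_spec => [ij'|_]; last by rewrite scale0r.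
    by case/eqP: ij; apply: val_inj.
  rewrite nth_default // big1 // => i _.
  case: PeanoNat.Nat.eqb_spec => [ij|_]; last by rewrite scale0r.
  by have := ltn_ord i; rewrite ij ltnNge lj.
- by rewrite big1 // => i _; rewrite scale0r.
- by rewrite IH1 IH2 -big_split; apply: eq_bigr => i _; rewrite scalerDl.
- by rewrite IH -sumrN; apply: eq_bigr => i _; rewrite scaleNr.
- by rewrite IH scaler_sumr; apply: eq_bigr => i _; rewrite scalerA.
Qed.

Lemma meqP l e1 e2 : meq (size l) e1 e2 -> meval l e1 = meval l e2.
Proof.
move=> H; rewrite !mevalE; apply: eq_bigr => i _; congr (_ *: _).
elim: (size l) H i => [_ []//|n IH /= [H0 /IH H] i].
by case: (unliftP ord_max i) => [j|] ->; rewrite ?lift_max.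
Qed.

End ModuleExpressions.

Ltac mlookup t l :=
  match l with
  | cons ?u ?l' => match u with
      | t => constr:(O)
      | _ => let n := mlookup t l' in constr:(S n)
      end
  end.

(** Fallback up to conversion: an atom may occur in syntactically different forms, and treating
    these as two atoms would break the cancellation between them. *)
Ltac mlookup_conv t l :=
  match l with
  | cons ?u ?l' =>
      let _ := match goal with _ => unify t u end in constr:(O)
  | cons ?u ?l' => let n := mlookup_conv t l' in constr:(S n)
  end.

Ltac mfind t l := match l with
  | _ => mlookup t l
  | _ => mlookup_conv t l
  end.

Ltac matoms t l :=
  match t with
  | @GRing.add _ ?a ?b => let l := matoms a l in matoms b l
  | @GRing.opp _ ?a => matoms a l
  | @GRing.scale _ _ _ ?a => matoms a l
  | @GRing.zero _ => l
  | _ => match l with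
      | _ => let n := mfind t l in l
      | _ => constr:(cons t l)
      end
  end.

Ltac mreify t l :=
  match t with
  | @GRing.add _ ?a ?b =>
      let a := mreify a l in let b := mreify b l in constr:(MAdd a b)
  | @GRing.opp _ ?a => let a := mreify a l in constr:(MOpp a)
  | @GRing.scale _ _ ?z ?a => let a := mreify a l in constr:(MScale z a)
  | @GRing.zero _ => constr:(MZero)
  | _ => let n := mfind t l in constr:(MAtom n)
  end.

(* Decides linear identities over [int], with [ring] for the coefficients; the
   signs [sgn n] are treated as indeterminates. *)
Ltac module :=
  repeat (let y := fresh "y" in set y := (sgn _); clearbody y);
  match goal with |- @eq ?T ?a ?b =>
    let l := matoms a (@nil T) in let l := matoms b l in
    let ea := mreify a l in let eb := mreify b l in
    refine (@meqP _ l ea eb _)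
  end;
  cbn [meq mcoef size Nat.eqb]; repeat split; ring.

(** In [module] a sign is an indeterminate whose square is not known to be 1. Identities that depend
    on this are first split by the value of the sign. *)
Lemma sgn_cases n : sgn n = 1 \/ sgn n = -1.
Proof. by rewrite sgn_odd; case: odd; [right | left]. Qed.

(** * Vertex lists *)

Section Lists.
Variable V : choiceType.

Definition lcons (v : V) : {malg seq V} -> {malg seq V} :=
  lext (fun s : seq V => (mon (v :: s))).

(** The alternating sum of faces in the form taken by the boundary of a cone with apex [v]. It is
    augmented: a single vertex has the empty list as its boundary. *)
Fixpoint bdry (s : seq V) : {malg seq V} :=
  if s is v :: s' then (mon (s')) - lcons v (bdry s') else 0.

Definition lconsl (v : V) :
    {malg (seq V * seq V)%type} -> {malg (seq V * seq V)%type} :=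
  lext (fun t : seq V * seq V => (mon (v :: t.1, t.2))).

(** The Alexander-Whitney coproduct: the list is cut at each vertex in turn, and both halves keep
    the vertex of the cut. *)
Fixpoint cop (s : seq V) : {malg (seq V * seq V)%type} :=
  if s is v :: s' then (mon ([:: v], s)) + lconsl v (cop s') else 0.

(* A simplex with such a vertex list is degenerate. *)
Definition dup (s : seq V) : bool := ~~ sorted (fun u v => u != v) s.

Lemma dup_cons v s : dup s -> dup (v :: s).
Proof. by rewrite /dup; case: s => //= u s /negPf ->; rewrite andbF. Qed.

Lemma dup_cons2 v s : dup (v :: v :: s).
Proof. by rewrite /dup /= eqxx. Qed.

Lemma dup_consE v s :
  dup (v :: s) -> dup s \/ exists s', s = v :: s'.
Proof.
rewrite /dup; case: s => //= u s; case: eqVneq => [<- _|_ /=]; last by left.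
by right; exists s.
Qed.

Lemma allsupp_lcons (Q R : seq V -> Prop) v c :
  allsupp Q c -> (forall s, Q s -> R (v :: s)) -> allsupp R (lcons v c).
Proof.
by move=> Qc QR; apply: (allsupp_lext Qc) => s /QR; apply: allsuppU.
Qed.

Lemma lext_lcons (C : choiceType) (h : seq V -> {malg C}) v c :
  lext h (lcons v c) = lext (fun s => h (v :: s)) c.
Proof. exact: lext_map. Qed.

Lemma lext_lconsl (C : choiceType) (h : seq V * seq V -> {malg C}) v c :
  lext h (lconsl v c) = lext (fun t => h (v :: t.1, t.2)) c.
Proof. exact: lext_map. Qed.

Lemma bdry_cons v s : bdry (v :: s) = mon s - lcons v (bdry s).
Proof. by []. Qed.

Lemma bdry1 v : bdry [:: v] = mon [::].
Proof. by rewrite /= /lcons lext0 subr0. Qed.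

Lemma bdry_size s : allsupp (fun r => (size r).+1 = size s) (bdry s).
Proof.
elim: s => [|v s IH] /=; first exact: allsupp0.
by apply: allsuppB; [exact: allsuppU | apply: (allsupp_lcons IH) => r /= ->].
Qed.

Lemma bdry_dup s : dup s -> allsupp dup (bdry s).
Proof.
elim: s => [|v s IH] //= /dup_consE[ds|[s' ->]] /=.
  apply: allsuppB; first exact: allsuppU.
  by apply: (allsupp_lcons (IH ds)) => r; apply: dup_cons.
(* The two faces that omit one copy of [v] cancel; all others still contain both copies. *)
rewrite /lcons lextB lextU opprB addrC addrNK.
rewrite -/(lcons v (bdry s')) /lcons lext_lext.
by apply: allsupp_lext_all => r; rewrite lextU; apply: allsuppU; apply: dup_cons2.
Qed.

Lemma lconsD v c c' : lcons v (c + c') = lcons v c + lcons v c'.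
Proof. exact: lextD. Qed.

Lemma lconsB v c c' : lcons v (c - c') = lcons v c - lcons v c'.
Proof. exact: lextB. Qed.

Lemma lconsZ v z c : lcons v (z *: c) = z *: lcons v c.
Proof. exact: lextZ. Qed.

Lemma lcons_lext (T : choiceType) v (f : T -> {malg seq V}) c :
  lcons v (lext f c) = lext (fun a => lcons v (f a)) c.
Proof. exact: lext_lext. Qed.

Lemma lcons0 v : lcons v 0 = 0.
Proof. exact: lext0. Qed.

Lemma lconsU v s : lcons v (mon s) = mon (v :: s).
Proof. exact: lextU. Qed.

Lemma bdry_subseq s : allsupp (fun r => subseq r s) (bdry s).
Proof.
elim: s => [|v s IH] /=; first exact: allsupp0.
apply: allsuppB; first by apply: allsuppU; apply: subseq_cons.
by apply: (allsupp_lcons IH) => r; rewrite eqxx.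
Qed.

Lemma cop_size s : allsupp (fun t => (0 < size t.1)%N /\ (0 < size t.2)%N /\
  (size t.1 + size t.2)%N = (size s).+1) (cop s).
Proof.
elim: s => [|v s IH] /=; first exact: allsupp0.
apply: allsuppD; first by apply: allsuppU; rewrite /= add1n.
by apply: (allsupp_lext IH) => t [_ [t2 ts]]; apply: allsuppU => /=; rewrite addSn ts.
Qed.

Lemma cop_dup s : dup s -> allsupp (fun t => dup t.1 || dup t.2) (cop s).
Proof.
elim: s => [|v s IH] // ds /=; apply: allsuppD.
  by apply: allsuppU; rewrite ds orbT.
case: (dup_consE ds) => [/IH ds'|[s' ->]].
  apply: (allsupp_lext ds') => t dt; apply: allsuppU => /=.
  by case/orP: dt => [/dup_cons -> //|->]; rewrite orbT.
rewrite /lconsl /= lextD lextU; apply: allsuppD.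
  by apply: allsuppU; rewrite dup_cons2.
rewrite lext_lext; apply: allsupp_lext_all => t; rewrite lextU; apply: allsuppU.
by rewrite dup_cons2.
Qed.

Lemma cop_subseq s :
  allsupp (fun t => subseq t.1 s /\ subseq t.2 s) (cop s).
Proof.
elim: s => [|v s IH] /=; first exact: allsupp0.
apply: allsuppD; first by apply: allsuppU; rewrite /= eqxx sub0seq subseq_refl.
apply: (allsupp_lext IH) => t [t1 t2]; apply: allsuppU; rewrite /= eqxx.
by split=> //; exact: (subseq_trans t2 (subseq_cons _ _)).
Qed.

Lemma lext_bdry_lcons v c : lext bdry (lcons v c) = c - lcons v (lext bdry c).
Proof.
by rewrite /lcons lext_map lext_lext -{2}(lext_id c) -lextBf.
Qed.

Lemma lext_cop_lcons v c :
  lext cop (lcons v c) =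
  lext (fun s => (mon ([:: v], v :: s))) c + lconsl v (lext cop c).
Proof.
by rewrite /lcons /lconsl lext_map lext_lext -lextDf.
Qed.

Definition bdry2 (t : seq V * seq V) : {malg (seq V * seq V)%type} :=
  lext (fun r : seq V => (mon (r, t.2))) (bdry t.1) +
  sgn (size t.1).-1 *: lext (fun r : seq V => (mon (t.1, r))) (bdry t.2).

Lemma lext_bdry2_lconsl v c :
  allsupp (fun t => (0 < size t.1)%N) c ->
  lext bdry2 (lconsl v c) = c - lconsl v (lext bdry2 c).
Proof.
move=> cP; rewrite lext_lconsl /lconsl lext_lext -{2}(lext_id c) -lextBf.
apply: (eq_lext_in cP) => -[s1 s2] /= s1P; rewrite /bdry2 /=.
rewrite lextB lextD lextU lextZ lext_lcons !lext_map /=.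
rewrite -[in sgn (size s1)](prednK s1P) sgnS.
module.
Qed.

(** The two extra terms are due to the augmentation: when one half is a single vertex, its boundary
    is the empty list instead of 0. They vanish as soon as empty lists are evaluated to 0. *)
Lemma lext_bdry2_cop s :
  lext bdry2 (cop s) = lext cop (bdry s) +
    (if nilp s then 0 else (mon ([::], s)) + sgn (size s).-1 *: (mon (s, [::]))).
Proof.
elim: s => [|v s IH]; first by rewrite /= !lext0 addr0.
rewrite [cop _]/= [bdry _]/= lextD lextU lextB lextU lext_cop_lcons.
rewrite lext_bdry2_lconsl; last by apply: (allsuppW (@cop_size s)) => t [].
rewrite IH {1}/bdry2 bdry1 [bdry _]/= lextU lextB lextU lext_lcons.
rewrite sgn0 scale1r /=; case: s {IH} => [|u s] /=.
  by rewrite /lconsl !(lext0, addr0, subr0) sgn0 scale1r add0r.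
rewrite /lconsl !lextD !lextZ !lextU /= sgnS.
module.
Qed.

End Lists.

(** * Shuffles of vertex lists *)

Definition corner (V W : choiceType) (A : seq V) (B : seq W) :
    {malg seq (V * W)%type} :=
  if nilp A && nilp B then mon [::] else 0.

(* [shuf A B] stands for [nabla (A (x) B)]: the signed sum of the lattice paths
   through the grid [A x B], sorted by their first step; [corner] accounts for
   the end of the path. *)
Fixpoint shuf_rec (V W : choiceType) (A : seq V) :
    seq W -> {malg seq (V * W)%type} :=
  if A is a :: A' then
    fix shufA B := if B is b :: B' then
      lcons (a, b) (corner A' B' + shuf_rec A' B + sgn (size A') *: shufA B') else 0
  else fun _ => 0.

HB.lock Definition shuf (V W : choiceType) (A : seq V) (B : seq W) :
  {malg seq (V * W)%type} := shuf_rec A B.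

Section Shuffles.
Variables V W : choiceType.
Implicit Types (A : seq V) (B : seq W).

(** [size A] is the dimension of [a :: A]. A path whose first step is in the second direction has
    that step before all [size A] steps in the first direction, which accounts for as many
    inversions. *)
Lemma shufE a A b B :
  shuf (a :: A) (b :: B) =
  lcons (a, b) (corner A B + shuf A (b :: B) + sgn (size A) *: shuf (a :: A) B).
Proof. by rewrite shuf.unlock. Qed.

Lemma shuf0r A : shuf A ([::] : seq W) = 0.
Proof. by rewrite shuf.unlock; case: A. Qed.

Lemma shuf0l B : shuf ([::] : seq V) B = 0.
Proof. by rewrite shuf.unlock. Qed.

(** The augmentation term of [bdry_shuf]: two single vertices shuffle to a single vertex, whose
    boundary is the empty list. *)
Definition single A B : {malg seq (V * W)%type} :=
  if (size A == 1)%N && (size B == 1)%N then mon [::] else 0.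

Lemma bdry_nilp (U T : choiceType) (s : seq U) (c : {malg T}) :
  lext (fun r => if nilp r then c else 0) (bdry s) =
  if (size s == 1)%N then c else 0.
Proof.
case: s => [|u [|u' s]]; first by rewrite /= lext0.
  by rewrite bdry1 lextU.
by apply: (lext_eq0_in (@bdry_size _ _)) => -[].
Qed.

Lemma lext_shufl a A b B :
  lext (fun r => shuf (a :: r) (b :: B)) (bdry A) =
  lcons (a, b) (single A (b :: B) + lext (fun r => shuf r (b :: B)) (bdry A)
    - sgn (size A) *: lext (fun r => shuf (a :: r) B) (bdry A)).
Proof.
have -> : single A (b :: B) = lext (fun r => corner r B) (bdry A).
  rewrite (eq_lext (g := fun r => if nilp r then
      (if nilp B then mon [::] else 0) else 0)); first last.
    by move=> r; rewrite /corner; case: nilp.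
  by rewrite bdry_nilp /single /= eqSS; case: eqP => // _; case: B.
rewrite -lextDf -lextZf -lextBf lcons_lext.
apply: (eq_lext_in (@bdry_size _ _)) => r <-.
by rewrite shufE sgnS scaleNr opprK.
Qed.

Lemma lext_shufr a A b B :
  lext (fun r => shuf (a :: A) (b :: r)) (bdry B) =
  lcons (a, b) (single (a :: A) B + lext (fun r => shuf A (b :: r)) (bdry B)
    + sgn (size A) *: lext (shuf (a :: A)) (bdry B)).
Proof.
have -> : single (a :: A) B = lext (fun r => corner A r) (bdry B).
  rewrite (eq_lext (g := fun r => if nilp r then
      (if nilp A then mon [::] else 0) else 0)); first last.
    by move=> r; rewrite /corner andbC; case: nilp.
  by rewrite bdry_nilp /single /= eqSS andbC; case: eqP => // _; case: A.
rewrite -lextDf -lextZf -lextDf lcons_lext; apply: eq_lext => r.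
by rewrite shufE.
Qed.

(** Induction along [shufE]. The paths that cross the first square of the grid diagonally, [(a, b)]
    followed by [shuf A B], arise from both recursive summands with opposite signs: this is the
    classical cancellation of the faces at the corners of a path. *)
Lemma bdry_shuf A B :
  lext (@bdry _) (shuf A B) =
  lext (fun r => shuf r B) (bdry A) + sgn (size A).-1 *: lext (shuf A) (bdry B)
  + single A B.
Proof.
elim: A B => [|a A IHA] B.
  rewrite shuf0l (eq_lext (g := fun=> 0) (bdry B)); last exact: shuf0l.
  by rewrite !lext0f !lext0 /single /= !(add0r, addr0) scaler0.
elim: B => [|b B IHB].
  rewrite shuf0r /= !lext0 scaler0 /single andbF !addr0.
  by rewrite (eq_lext (g := fun=> 0)) ?lext0f // => r; rewrite shuf0r.
have E : lext (@bdry _) (corner A B + shuf A (b :: B)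
    + sgn (size A) *: shuf (a :: A) B) =
  lext (fun r => shuf r (b :: B)) (bdry A) - sgn (size A) *: lext (shuf A) (bdry (b :: B))
  + single A (b :: B) + sgn (size A) *: (lext (fun r => shuf r B) (bdry (a :: A)) +
    sgn (size A) *: lext (shuf (a :: A)) (bdry B) + single (a :: A) B).
  rewrite 2!lextD lextZ IHA IHB; congr (_ + _).
  have -> : lext (@bdry _) (corner A B) = 0.
    by rewrite /corner; case: ifP => _; rewrite ?lextU ?lext0.
  rewrite add0r; congr (_ + _ + _).
  (* For empty [A] the exponent [(size A).-1] is truncated, but then the shuffle itself is 0. *)
  case: A {IHA IHB} => [|a' A]; last by rewrite sgnS scaleNr opprK.
  rewrite (eq_lext (g := fun=> 0)); last exact: shuf0l.
  by rewrite lext0f !scaler0 oppr0.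
rewrite shufE lext_bdry_lcons E !bdry_cons !lextB !lextU !lext_lcons.
cbv beta; rewrite lext_shufl lext_shufr /lcons !(lextD, lextN, lextZ).
have -> : single (a :: A) (b :: B) = corner A B by [].
rewrite [(size (a :: A)).-1]/=.
by case: (sgn_cases (size A)) => ->; module.
Qed.

End Shuffles.

Lemma bdry_map (V W : choiceType) (h : V -> W) s :
  bdry (map h s) = lext (fun r => mon (map h r)) (bdry s).
Proof.
elim: s => [|v s IH]; first by rewrite lext0.
rewrite bdry_cons lextB lextU lext_lcons -/(map h) [map _ _]/= bdry_cons IH.
by rewrite lcons_lext; congr (_ - _); apply: eq_lext => r; rewrite lconsU.
Qed.

Lemma cop_map (V W : choiceType) (h : V -> W) s :
  cop (map h s) = lext (fun t => mon (map h t.1, map h t.2)) (cop s).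
Proof.
elim: s => [|v s IH] /=; first by rewrite lext0.
by rewrite lextD lextU lext_lconsl IH /lconsl lext_map.
Qed.

(** * The Eilenberg-Zilber homotopy on lists of pairs *)

Section EilenbergZilberLists.
Variables V W : choiceType.
Implicit Type s : seq (V * W).

(* On lists of pairs of vertices, [ez] stands for [nabla f] and [ezh] for
   [phi]. *)
Definition shuf2 (t : seq (V * W) * seq (V * W)) : {malg seq (V * W)%type} :=
  shuf (unzip1 t.1) (unzip2 t.2).

Definition ez s : {malg seq (V * W)%type} :=
  (if nilp s then mon [::] else 0) + lext shuf2 (cop s).

Fixpoint ezh s : {malg seq (V * W)%type} :=
  if s is v :: s' then lcons v (ez s) - lcons v (ezh s') else 0.

Lemma ezh_cons v s : ezh (v :: s) = lcons v (ez (v :: s)) - lcons v (ezh s).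
Proof. by []. Qed.

(** Both [cop] and [shuf] respect boundaries up to augmentation terms. Those of [cop] die because a
    shuffle with an empty list is 0; that of [shuf] survives only for a one-vertex list and matches
    the value of [ez] on the empty list. *)
Lemma bdry_ez s : lext (@bdry _) (ez s) = lext ez (bdry s).
Proof.
have E (t : seq (V * W) * seq (V * W)) : lext (@bdry _) (shuf2 t) =
    lext shuf2 (bdry2 t) + single (unzip1 t.1) (unzip2 t.2).
  rewrite bdry_shuf /bdry2 lextD lextZ !lext_map /shuf2 /=.
  by rewrite !bdry_map !lext_map size_map.
rewrite /ez lextD lext_lext (eq_lext _ E) lextDf -lext_lext lext_bdry2_cop.
rewrite lextDf -lext_lext lextD.
have -> : lext (@bdry _) (if nilp s then mon [::] else 0 : {malg seq (V * W)%type}) = 0.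
  by case: ifP; rewrite ?lextU ?lext0.
have -> : lext shuf2 (if nilp s then 0 else
    mon ([::], s) + sgn (size s).-1 *: mon (s, [::])) = 0.
  case: ifP; rewrite ?lext0 // lextD lextZ !lextU /shuf2 /= shuf0r shuf0l => _.
  by rewrite add0r scaler0.
rewrite add0r addr0 addrC bdry_nilp; congr (_ + _).
case: s => [|v [|w s]] /=; first exact: lext0.
  by rewrite /lconsl lext0 addr0 lextU.
apply: (lext_eq0_in (@cop_size _ [:: v, w & s])) => -[r1 r2] /= [_ [_ rs]].
rewrite /single !size_map; case: eqP => //= r1E; case: eqP => // r2E.
by move: rs; rewrite r1E r2E.
Qed.

(** Prepending [v] is a contracting homotopy by [lext_bdry_lcons]. Together with [bdry_ez] and the
    induction hypothesis this makes all other terms cancel, and the identity holds exactly, not only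
    up to degenerate lists. *)
Lemma bdry_ezh s :
  lext (@bdry _) (ezh s) + lext ezh (bdry s) = ez s - mon s.
Proof.
elim: s => [|v s IH].
  by rewrite /ez /= !lext0 addr0 addr0 subrr.
have E : lext ezh (lcons v (bdry s)) =
    lcons v (lext ez (lcons v (bdry s))) - lcons v (lext ezh (bdry s)).
  by rewrite !lext_lcons !lcons_lext -lextBf.
rewrite ezh_cons lextB !lext_bdry_lcons bdry_ez bdry_cons !lextB !lextU E.
rewrite !lconsB -lconsU.
have -> : lcons v (lext (@bdry _) (ezh s)) =
   lcons v (ez s) - lcons v (mon s) - lcons v (lext ezh (bdry s)).
  by rewrite -!lconsB -IH addrK.
module.
Qed.

End EilenbergZilberLists.

Section Coassociativity.
Variable V : choiceType.

Definition cop_l (t : seq V * seq V) : {malg (seq V * seq V * seq V)%type} :=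
  lext (fun u : seq V * seq V => mon (u.1, u.2, t.2)) (cop t.1).

Definition cop_r (t : seq V * seq V) : {malg (seq V * seq V * seq V)%type} :=
  lext (fun u : seq V * seq V => mon (t.1, u.1, u.2)) (cop t.2).

Lemma copA s : lext cop_l (cop s) = lext cop_r (cop s).
Proof.
elim: s => [|v s IH]; first by rewrite !lext0.
pose k (t : seq V * seq V * seq V) : {malg (seq V * seq V * seq V)%type} :=
  mon (v :: t.1.1, t.1.2, t.2).
rewrite [cop _]/= !lextD !lextU !lext_lconsl.
have -> : lext (fun t => cop_l (v :: t.1, t.2)) (cop s) =
    lext (fun t => mon ([:: v], v :: t.1, t.2)) (cop s) +
    lext k (lext cop_l (cop s)).
  rewrite (lext_lext k) -lextDf; apply: eq_lext => t.
  by rewrite /cop_l /= lextD lextU lext_lconsl lext_map.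
have -> : lext (fun t => cop_r (v :: t.1, t.2)) (cop s) =
    lext k (lext cop_r (cop s)).
  rewrite (lext_lext k); apply: eq_lext => t.
  by rewrite /cop_r /= lext_map.
rewrite IH addrA; congr (_ + _).
by rewrite /cop_l /cop_r /= /lconsl !lext0 addr0 lextU lextD lextU lext_map.
Qed.

End Coassociativity.

Section ShuffleProperties.
Variables V W : choiceType.
Implicit Types (A : seq V) (B : seq W).

Lemma shuf_size A B :
  allsupp (fun r => (size r).+1 = (size A + size B)%N) (shuf A B).
Proof.
elim: A B => [|a A IHA] B; first by rewrite shuf0l; apply: allsupp0.
elim: B => [|b B IHB]; first by rewrite shuf0r; apply: allsupp0.
have H : allsupp (fun r => (size r).+1 = (size A + size B).+1)
    (corner A B + shuf A (b :: B) + sgn (size A) *: shuf (a :: A) B).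
  apply: allsuppD; first apply: allsuppD.
  - rewrite /corner; case: ifP => [/andP[/nilP -> /nilP ->]|_].
      exact: allsuppU.
    exact: allsupp0.
  - by apply: (allsuppW (@IHA (b :: B))) => r; rewrite /= addnS.
  - by apply: allsuppZ; apply: (allsuppW IHB) => r; rewrite /= addSn.
by rewrite shufE; apply: (allsupp_lcons H) => r /= ->; rewrite addSn addnS.
Qed.

Lemma shuf_head a A b B :
  allsupp (fun r => exists r', r = (a, b) :: r') (shuf (a :: A) (b :: B)).
Proof.
rewrite shufE /lcons; apply: allsupp_lext_all => r; apply: allsuppU.
by exists r.
Qed.

Lemma shuf1 (a : V) B :
  shuf [:: a] B = if nilp B then 0 else mon [seq (a, b) | b <- B].
Proof.
elim: B => [|b B IH]; first by rewrite shuf0r.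
rewrite shufE shuf0l addr0 sgn0 scale1r IH.
by rewrite /corner /=; case: ifP => [/nilP ->|_] /=;
  rewrite ?addr0 ?add0r lconsU.
Qed.

(** A path advances in one coordinate at a time. The step between two equal neighbours of [A] or [B]
    therefore changes neither coordinate. *)
Lemma shuf_dup A B : dup A || dup B -> allsupp (@dup _) (shuf A B).
Proof.
elim: A B => [|a A IHA] B dAB; first by rewrite shuf0l; apply: allsupp0.
elim: B dAB => [|b B IHB] dAB; first by rewrite shuf0r; apply: allsupp0.
rewrite shufE !lconsD lconsZ; apply: allsuppD; first apply: allsuppD.
- rewrite /corner; case: ifP => [/andP[/nilP A0 /nilP B0]|_].
    by rewrite A0 B0 in dAB.
  by rewrite lcons0; apply: allsupp0.
- case/orP: dAB => [/dup_consE[dA|[A' EA]]|dB].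
  + have := IHA (b :: B); rewrite dA => /(_ isT) H.
    by apply: (allsupp_lcons H) => r; apply: dup_cons.
  + rewrite EA; apply: (allsupp_lcons (@shuf_head _ _ _ _)) => r [r' ->].
    exact: dup_cons2.
  + have := IHA (b :: B); rewrite dB orbT => /(_ isT) H.
    by apply: (allsupp_lcons H) => r; apply: dup_cons.
- apply: allsuppZ; case/orP: dAB => [dA|/dup_consE[dB|[B' EB]]].
  + have := IHB; rewrite dA => /(_ isT) H.
    by apply: (allsupp_lcons H) => r; apply: dup_cons.
  + have := IHB; rewrite dB orbT => /(_ isT) H.
    by apply: (allsupp_lcons H) => r; apply: dup_cons.
  + rewrite EB; apply: (allsupp_lcons (@shuf_head _ _ _ _)) => r [r' ->].
    exact: dup_cons2.
Qed.

Lemma shuf_path (le1 : rel V) (le2 : rel W) u A B :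
  reflexive le1 -> reflexive le2 -> path le1 u.1 A -> path le2 u.2 B ->
  allsupp (path (fun p q => le1 p.1 q.1 && le2 p.2 q.2) u) (shuf A B).
Proof.
move=> r1 r2; elim: A B u => [|a A IHA] B u.
  by move=> *; rewrite shuf0l; apply: allsupp0.
elim: B u => [|b B IHB] u; first by move=> *; rewrite shuf0r; apply: allsupp0.
rewrite /= => /andP[ua pA] /andP[ub pB]; rewrite shufE.
have H : allsupp (path (fun p q => le1 p.1 q.1 && le2 p.2 q.2) (a, b))
    (corner A B + shuf A (b :: B) + sgn (size A) *: shuf (a :: A) B).
  apply: allsuppD; first apply: allsuppD.
  - rewrite /corner; case: ifP => _; [exact: allsuppU | exact: allsupp0].
  - by apply: IHA => //=; rewrite r2.
  - by apply: allsuppZ; apply: IHB => //=; rewrite r1.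
by apply: (allsupp_lcons H) => r /= ->; rewrite ua ub.
Qed.

(** The property of shuffles behind phi nabla = 0: a step never changes both coordinates. *)
Definition lattice (p q : V * W) := (p.1 == q.1) || (p.2 == q.2).

Lemma shuf_lattice A B : allsupp (sorted lattice) (shuf A B).
Proof.
elim: A B => [|a A IHA] B; first by rewrite shuf0l; apply: allsupp0.
elim: B => [|b B IHB]; first by rewrite shuf0r; apply: allsupp0.
rewrite shufE !lconsD lconsZ; apply: allsuppD; first apply: allsuppD.
- rewrite /corner; case: ifP => _; rewrite ?lcons0 ?lconsU;
    [exact: allsuppU | exact: allsupp0].
- case: A IHA IHB => [|a' A] IHA IHB.
    by rewrite ?(shuf0l, shuf0r) lcons0; apply: allsupp0.
  apply: (allsupp_lcons (allsuppI (IHA (b :: B)) (@shuf_head _ _ _ _))).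
  by move=> r [rP [r' Er]]; move: rP; rewrite Er /= => ->; rewrite /lattice eqxx orbT.
- apply: allsuppZ; case: B IHB => [|b' B] IHB.
    by rewrite ?(shuf0l, shuf0r) lcons0; apply: allsupp0.
  apply: (allsupp_lcons (allsuppI IHB (@shuf_head _ _ _ _))).
  by move=> r [rP [r' Er]]; move: rP; rewrite Er /= => ->; rewrite /lattice eqxx.
Qed.

Lemma shuf_dup_unzip2 A B :
  (1 < size A)%N -> allsupp (fun r => dup (unzip2 r)) (shuf A B).
Proof.
case: A => [|a [|a' A]] // _.
elim: B => [|b B IHB]; first by rewrite shuf0r; apply: allsupp0.
rewrite shufE !lconsD lconsZ; apply: allsuppD; first apply: allsuppD.
- by rewrite /corner /= lcons0; apply: allsupp0.
- apply: (allsupp_lcons (@shuf_head _ _ _ _)) => r [r' ->].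
  exact: dup_cons2.
- by apply: allsuppZ; apply: (allsupp_lcons IHB) => r; apply: dup_cons.
Qed.

(** Reflecting the grid exchanges the two recursive summands of [shufE]. The sign is the Koszul sign
    for lists of dimensions [(size A).-1] and [(size B).-1]. *)
Lemma shuf_swap A B :
  lext (fun r => mon [seq (p.2, p.1) | p <- r]) (shuf A B) =
  sgn ((size A).-1 * (size B).-1) *: shuf B A.
Proof.
elim: A B => [|a A IHA] B; first by rewrite shuf0l lext0 shuf0r scaler0.
elim: B => [|b B IHB]; first by rewrite shuf0r shuf0l lext0 scaler0.
rewrite !shufE lext_lcons.
rewrite (eq_lext (g := fun r => lcons (b, a)
  (mon [seq (p.2, p.1) | p <- r]))); last by move=> r; rewrite lconsU.
rewrite -lcons_lext 2!lextD lextZ IHA IHB /= -lconsZ; congr lcons.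
have -> : lext (fun r => mon [seq (p.2, p.1) | p <- r]) (corner A B) =
    sgn (size A * size B) *: corner B A.
  rewrite /corner [in RHS]andbC; case: ifP => [/andP[/nilP -> _]|_].
    by rewrite lextU sgn0 scale1r.
  by rewrite lext0 scaler0.
(* Up to parity the exponents differ only through truncation at an empty list, where the shuffle is
   0; likewise in the next step. *)
have -> : sgn ((size A).-1 * size B) *: shuf (b :: B) A =
    (sgn (size A * size B) * sgn (size B)) *: shuf (b :: B) A.
  case: A {IHA IHB} => [|a' A] /=; first by rewrite shuf0r !scaler0.
  by congr (_ *: _); rewrite mulSn addnC sgnD -mulrA sgn_sqr mulr1.
have -> : sgn (size A * (size B).-1) *: shuf B (a :: A) =
    (sgn (size A * size B) * sgn (size A)) *: shuf B (a :: A).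
  case: B {IHA IHB} => [|b' B] /=; first by rewrite shuf0l !scaler0.
  by congr (_ *: _); rewrite mulnS addnC sgnD -mulrA sgn_sqr mulr1.
by case: (sgn_cases (size A)) => ->; module.
Qed.

End ShuffleProperties.

Lemma shuf_map (V W V' W' : choiceType) (h : V -> V') (k : W -> W') A B :
  shuf (map h A) (map k B) =
  lext (fun r => mon [seq (h p.1, k p.2) | p <- r]) (shuf A B).
Proof.
elim: A B => [|a A IHA] B; first by rewrite !shuf0l lext0.
elim: B => [|b B IHB]; first by rewrite !shuf0r lext0.
rewrite [map h _]/= [map k _]/= !shufE lext_lcons.
rewrite (eq_lext (g := fun r => lcons (h a, k b)
  (mon [seq (h p.1, k p.2) | p <- r]))); last by move=> r; rewrite lconsU.
rewrite -lcons_lext 2!lextD lextZ -IHB -IHA /= size_map; congr (lcons _ (_ + _ + _)).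
rewrite /corner /nilp !size_map; case: ifP => _; by rewrite ?lextU ?lext0.
Qed.

Section ShuffleCoproduct.
Variables V W : choiceType.
Implicit Types (A : seq V) (B : seq W).

(** Koszul sign for moving the back half of the first list past the front half of the second. *)
Definition cop_shuf2 (t : (seq V * seq V) * (seq W * seq W)) :
    {malg (seq (V * W) * seq (V * W))%type} :=
  sgn ((size t.1.2).-1 * (size t.2.1).-1) *:
    ten (shuf t.1.1 t.2.1) (shuf t.1.2 t.2.2).

Lemma ten_lcons (U : choiceType) (v : U) c c' :
  ten (lcons v c) c' = lconsl v (ten c c').
Proof.
rewrite /lcons /lconsl ten_lextl ten_lextE lext_lext; apply: eq_lext => s.
rewrite lext_lext ten_lextE lextU; apply: eq_lext => s'.
by rewrite lextU.
Qed.

Lemma shuf1l (a : V) (b : W) B :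
  shuf [:: a] (b :: B) = lcons (a, b) (corner [::] B + shuf [:: a] B).
Proof. by rewrite shufE shuf0l addr0 sgn0 scale1r. Qed.

Lemma shuf1r a (b : W) A :
  shuf (a :: A) [:: b] = lcons (a, b) (corner A [::] + shuf A [:: b]).
Proof. by rewrite shufE shuf0r scaler0 addr0. Qed.

Lemma corner0r A B : (0 < size B)%N -> corner A B = 0.
Proof. by case: B => // b B _; rewrite /corner andbF. Qed.

Lemma corner0l A B : (0 < size A)%N -> corner A B = 0.
Proof. by case: A. Qed.

Lemma lext_cop_corner A B : lext (@cop _) (corner A B) = 0.
Proof. by rewrite /corner; case: ifP => _; rewrite ?lext0 ?lextU. Qed.

(** nabla is a map of coalgebras, since cutting a lattice path at a grid point cuts [A] and [B] at
    its two coordinates. Cuts at the first grid point are split off; [E2], [E3] and [E4] treat those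
    that leave the first vertex in the second list only, in the first list only, or in both. *)
Lemma cop_shuf A B :
  lext (@cop _) (shuf A B) = lext cop_shuf2 (ten (cop A) (cop B)).
Proof.
elim: A B => [|a A IHA] B; first by rewrite shuf0l lext0 ten0l lext0.
elim: B => [|b B IHB]; first by rewrite shuf0r lext0 ten0r lext0.
rewrite shufE lext_cop_lcons.
have -> : lext (fun s => mon ([:: (a, b)], (a, b) :: s))
    (corner A B + shuf A (b :: B) + sgn (size A) *: shuf (a :: A) B) =
    cop_shuf2 (([:: a], a :: A), ([:: b], b :: B)).
  rewrite /cop_shuf2 muln0 sgn0 scale1r shuf1l lconsD [shuf [:: a] _]shuf0r.
  rewrite lcons0 addr0 lconsU shufE.
  rewrite ten_lextE lextU lext_lcons.
  by apply: eq_lext.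
rewrite 2!lextD lextZ IHA IHB lext_cop_corner add0r.
rewrite [cop (a :: A)]/= [cop (b :: B)]/=.
set cA := cop A; set cB := cop B.
rewrite !(tenDl, tenDr) !lextD.
rewrite [lext _ (ten (mon _) (mon _))]lext_ten !lextU.
have E2 : lext cop_shuf2 (ten (mon ([:: a], a :: A)) (lconsl b cB)) =
    sgn (size A) *: lconsl (a, b)
      (lext cop_shuf2 (ten (mon ([:: a], a :: A)) cB)).
  rewrite !lext_ten !lextU lext_lconsl /lconsl lext_lext -lextZf.
  apply: (eq_lext_in (@cop_size _ B)) => -[t1 t2] /= [t1P _].
  rewrite /cop_shuf2 /= shuf1l (corner0r _ t1P) add0r ten_lcons.
  rewrite -[in sgn (_ * size t1)](prednK t1P) mulnS sgnD -scalerA; congr (_ *: _).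
  by rewrite /lconsl lextZ.
have E3 : lext cop_shuf2 (ten (lconsl a cA) (mon ([:: b], b :: B))) =
    lconsl (a, b) (lext cop_shuf2 (ten cA (mon ([:: b], b :: B)))).
  rewrite !lext_tenC !lextU lext_lconsl /lconsl lext_lext.
  apply: (eq_lext_in (@cop_size _ A)) => -[t1 t2] /= [t1P _].
  rewrite /cop_shuf2 /= muln0 sgn0 !scale1r shuf1r (corner0l _ t1P).
  by rewrite add0r ten_lcons.
have E4 : lext cop_shuf2 (ten (lconsl a cA) (lconsl b cB)) =
    lconsl (a, b) (lext cop_shuf2 (ten cA (lconsl b cB)) +
      sgn (size A) *: lext cop_shuf2 (ten (lconsl a cA) cB)).
  rewrite !lext_ten !lext_lconsl -lextZf -lextDf /lconsl lext_lext.
  apply: (eq_lext_in (@cop_size _ A)) => -[t1 t2] /= [t1P [t2P tE]].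
  rewrite !lext_lconsl -lextZf -lextDf lext_lext.
  apply: (eq_lext_in (@cop_size _ B)) => -[u1 u2] /= [u1P _].
  rewrite /cop_shuf2 /= shufE (corner0l _ t1P).
  rewrite add0r ten_lcons tenDl tenZl -/(lconsl _ _).
  set x := ten _ _; set y := ten _ _.
  have -> : sgn (size A) *: (sgn ((size t2).-1 * (size u1).-1) *: y) =
      sgn ((size t2).-1 * size u1) *: (sgn (size t1) *: y).
    rewrite !scalerA -!sgnD !sgn_odd; congr (_ ^+ _ *: _).
    move: tE; rewrite -(prednK t2P) -(prednK u1P) addnS => -[/(congr1 odd)].
    by rewrite !(oddD, oddM) /= => <-; do 3!case: odd.
  by rewrite -scalerDr [in RHS]/lconsl lextZ.
rewrite E2 E3 E4 /lconsl !(lextD, lextZ).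
module.
Qed.

End ShuffleCoproduct.

Section EZProperties.
Variables V W : choiceType.
Implicit Type s : seq (V * W).

Lemma dup_map (U T : choiceType) (h : U -> T) (r : seq U) :
  dup r -> dup (map h r).
Proof.
elim: r => [|u r IH] // /dup_consE[/IH/dup_cons|[r' ->]]; first exact.
exact: dup_cons2.
Qed.

Lemma ez_dup s : dup s -> allsupp (@dup _) (ez s).
Proof.
move=> ds; apply: allsuppD.
  by case: s ds => // v s _; apply: allsupp0.
apply: (allsupp_lext (cop_dup ds)) => t dt; apply: shuf_dup.
by case/orP: dt => [/(dup_map fst)|/(dup_map snd)] ->; rewrite ?orbT.
Qed.

Lemma ezh_dup s : dup s -> allsupp (@dup _) (ezh s).
Proof.
elim: s => [|v s IH] // ds; rewrite ezh_cons; apply: allsuppB.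
  by apply: (allsupp_lcons (ez_dup ds)) => r; apply: dup_cons.
case: (dup_consE ds) => [/IH H|[s' ->]].
  by apply: (allsupp_lcons H) => r; apply: dup_cons.
rewrite ezh_cons -lconsB lcons_lext; apply: allsupp_lext_all => r.
by rewrite lconsU; apply: allsuppU; apply: dup_cons2.
Qed.

(** Here [w] is the vertex of the cut. Either some step of the front half keeps the first
    coordinate, which repeats a vertex of the first projection, or every step keeps the second
    coordinate, up to and including [w]. *)
Lemma cop_lattice s : sorted (@lattice V W) s ->
  allsupp (fun t => exists v w t1 t2, t = (v :: t1, w :: t2) /\
    (dup (unzip1 t.1) \/ v.2 = w.2)) (cop s).
Proof.
elim: s => [|v s IH] ls; first exact: allsupp0.
rewrite [cop _]/=; apply: allsuppD.
  by apply: allsuppU; exists v, v, [::], s; split=> //; right.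
have := IH (path_sorted ls).
case: s ls {IH} => [|u s] ls H; first by rewrite /lconsl lext0; apply: allsupp0.
have Hh : allsupp (fun t => exists t1, t.1 = u :: t1) (cop (u :: s)).
  rewrite [cop _]/=; apply: allsuppD; first by apply: allsuppU; exists [::].
  by rewrite /lconsl; apply: allsupp_lext_all => t; apply: allsuppU; exists t.1.
apply: (allsupp_lext (allsuppI H Hh)) => t [[x [w [t1 [t2 [-> d]]]]] [t3 /= [xu _]]].
rewrite xu in d *; apply: allsuppU; exists v, w, (u :: t1), t2; split=> //=.
case: d => [d|d]; first by left; apply: dup_cons.
by case/andP: ls => /orP[/eqP-> _|/eqP-> _]; [left; apply: dup_cons2 | right].
Qed.

(** By [cop_lattice] each summand of [ez] is either degenerate already or a shuffle that starts at
    [(v.1, w.2)], which is [v], so that prepending [v] repeats it. *)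
Lemma ezh_lattice s : sorted (@lattice V W) s -> allsupp (@dup _) (ezh s).
Proof.
elim: s => [|v s IH] ls; first exact: allsupp0.
rewrite ezh_cons; apply: allsuppB; last first.
  by apply: (allsupp_lcons (IH (path_sorted ls))) => r; apply: dup_cons.
rewrite /ez add0r lcons_lext.
have Hh : allsupp (fun t => exists t1, t.1 = v :: t1) (cop (v :: s)).
  rewrite [cop _]/=; apply: allsuppD; first by apply: allsuppU; exists [::].
  by rewrite /lconsl; apply: allsupp_lext_all => t; apply: allsuppU; exists t.1.
apply: (allsupp_lext (allsuppI (cop_lattice ls) Hh)).
move=> t [[x [w [t1 [t2 [-> d]]]]] [t3 /= [xv _]]]; rewrite xv {x xv} in d *.
case: d => [d|vw].
  by apply: (allsupp_lcons (shuf_dup (B := unzip2 (w :: t2)) _));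
    rewrite ?d // => r; apply: dup_cons.
rewrite /shuf2 /=; apply: (allsupp_lcons (@shuf_head _ _ _ _ _ _)).
by move=> r [r' ->]; rewrite -vw -surjective_pairing; apply: dup_cons2.
Qed.

Lemma ez_map (V' W' : choiceType) (h : V -> V') (k : W -> W') s :
  ez [seq (h p.1, k p.2) | p <- s] =
  lext (fun r => mon [seq (h p.1, k p.2) | p <- r]) (ez s).
Proof.
rewrite /ez lextD /nilp size_map; congr (_ + _).
  by case: ifP; rewrite ?lextU ?lext0.
rewrite cop_map lext_map lext_lext; apply: eq_lext => t.
by rewrite /shuf2 -shuf_map /= /unzip1 /unzip2 -!map_comp.
Qed.

Lemma ezh_map (V' W' : choiceType) (h : V -> V') (k : W -> W') s :
  ezh [seq (h p.1, k p.2) | p <- s] =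
  lext (fun r => mon [seq (h p.1, k p.2) | p <- r]) (ezh s).
Proof.
elim: s => [|v s IH]; first by rewrite lext0.
rewrite ezh_cons lextB !lext_lcons [map _ _]/= ezh_cons IH.
rewrite -[_ :: map _ _]/(map _ (v :: s)) ez_map !lcons_lext.
by congr (_ - _); apply: eq_lext => r; rewrite lconsU.
Qed.

Lemma ez_path (le1 : rel V) (le2 : rel W) u s :
  reflexive le1 -> reflexive le2 -> transitive le1 -> transitive le2 ->
  path (fun p q => le1 p.1 q.1 && le2 p.2 q.2) u s ->
  allsupp (path (fun p q => le1 p.1 q.1 && le2 p.2 q.2) u) (ez s).
Proof.
move=> r1 r2 t1 t2 us; apply: allsuppD.
  by case: ifP => _; [apply: allsuppU | apply: allsupp0].
have tr : transitive (fun p q : V * W => le1 p.1 q.1 && le2 p.2 q.2).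
  move=> y x z /andP[xy1 xy2] /andP[yz1 yz2].
  by rewrite (t1 _ _ _ xy1 yz1) (t2 _ _ _ xy2 yz2).
apply: (allsupp_lext (@cop_subseq _ s)) => t [ts1 ts2]; apply: shuf_path => //.
  rewrite path_map; apply: sub_path (subseq_path tr ts1 us) => p q.
  by case/andP.
rewrite path_map; apply: sub_path (subseq_path tr ts2 us) => p q.
by case/andP.
Qed.

Lemma ezh_path (le1 : rel V) (le2 : rel W) u s :
  reflexive le1 -> reflexive le2 -> transitive le1 -> transitive le2 ->
  path (fun p q => le1 p.1 q.1 && le2 p.2 q.2) u s ->
  allsupp (path (fun p q => le1 p.1 q.1 && le2 p.2 q.2) u) (ezh s).
Proof.
move=> r1 r2 t1 t2; elim: s u => [|v s IH] u; first by move=> _; apply: allsupp0.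
move=> /= /andP[uv vs]; apply: allsuppB.
  have vvs : path (fun p q => le1 p.1 q.1 && le2 p.2 q.2) v (v :: s).
    by rewrite /= r1 r2.
  by apply: (allsupp_lcons (ez_path r1 r2 t1 t2 vvs)) => r /= ->; rewrite uv.
by apply: (allsupp_lcons (IH _ vs)) => r /= ->; rewrite uv.
Qed.

Lemma ez_size s : allsupp (fun r => size r = size s) (ez s).
Proof.
apply: allsuppD.
  by case: s => [|v s]; [apply: allsuppU | apply: allsupp0].
apply: (allsupp_lext (@cop_size _ s)) => t [_ [_ st]].
apply: (allsuppW (@shuf_size _ _ _ _)) => r; rewrite !size_map st.
by case.
Qed.

Lemma ezh_size s : allsupp (fun r => size r = (size s).+1) (ezh s).
Proof.
elim: s => [|v s IH]; first exact: allsupp0.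
apply: allsuppB; first by apply: (allsupp_lcons (@ez_size _)) => r /= ->.
by apply: (allsupp_lcons IH) => r /= ->.
Qed.

End EZProperties.

(** * The Alexander-Whitney map on lists of pairs *)

Section AlexanderWhitneyLists.
Variables V W : choiceType.
Implicit Types (A : seq V) (B : seq W) (s : seq (V * W)).

Definition aws s : {malg (seq V * seq W)%type} :=
  lext (fun t : seq (V * W) * seq (V * W) => mon (unzip1 t.1, unzip2 t.2)) (cop s).

Definition dup2 (t : seq V * seq W) := dup t.1 || dup t.2.

Definition consl (a : V) :
    {malg (seq V * seq W)%type} -> {malg (seq V * seq W)%type} :=
  lext (fun t : seq V * seq W => mon (a :: t.1, t.2)).

Lemma aws_cons v s :
  aws (v :: s) = mon ([:: v.1], unzip2 (v :: s)) + consl v.1 (aws s).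
Proof. by rewrite /aws [cop _]/= lextD lextU lext_lconsl /consl lext_map. Qed.

Lemma lext_aws_lcons v c :
  lext aws (lcons v c) =
  lext (fun s => mon ([:: v.1], unzip2 s)) (lcons v c) + consl v.1 (lext aws c).
Proof.
rewrite !lext_lcons /consl lext_lext -lextDf; apply: eq_lext => s.
exact: aws_cons.
Qed.

Lemma aws_head v s : allsupp (fun t => exists t1, t.1 = v.1 :: t1) (aws (v :: s)).
Proof.
rewrite aws_cons; apply: allsuppD; first by apply: allsuppU; exists [::].
by apply: allsupp_lext_all => t; apply: allsuppU; exists t.1.
Qed.

Lemma consl_dup2 a c : allsupp dup2 c -> allsupp dup2 (consl a c).
Proof.
move=> H; apply: (allsupp_lext H) => t dt; apply: allsuppU; rewrite /dup2 /=.
by case/orP: dt => [/dup_cons ->|->] //; rewrite orbT.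
Qed.

(** Only the path that runs through [A] first and is cut at its bend contributes. If [A] has two or
    more vertices, a cut at the first vertex leaves a repetition in the second projection ([D1]);
    after a first step along [B], every later cut has a front beginning with [a] twice ([D3]); a
    first step along [A] is the induction ([D2]). *)
Lemma aws_shuf A B : (0 < size A)%N -> (0 < size B)%N ->
  allsupp dup2 (lext aws (shuf A B) - mon (A, B)).
Proof.
elim: A B => [|a A IHA] // B _.
elim: B => [|b B IHB] // _.
case: A IHA IHB => [|a' A] IHA IHB.
  rewrite shuf1 [nilp _]/= lextU [map _ _]/= aws_cons.
  have -> : unzip2 ((a, b) :: [seq (a, b) | b <- B]) = b :: B.
    by rewrite /unzip2 /= -map_comp map_id.
  rewrite (addrC (mon _)) addrK.
  case: B {IHB} => [|b' B]; first by rewrite /aws /consl !lext0; apply: allsupp0.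
  apply: (allsupp_lext (@aws_head _ _)) => t [t1 Et]; apply: allsuppU.
  by rewrite /dup2 Et /= dup_cons2.
have D1 : allsupp dup2 (lext (fun s => mon ([:: a], unzip2 s))
   (shuf [:: a, a' & A] (b :: B))).
  apply: (allsupp_lext (@shuf_dup_unzip2 _ _ [:: a, a' & A] (b :: B) isT)).
  by move=> r dr; apply: allsuppU; rewrite /dup2 dr orbT.
have D2 := consl_dup2 (a := a) (IHA (b :: B) isT isT).
have D3 : allsupp dup2 (consl a (lext aws (shuf [:: a, a' & A] B))).
  case: B IHB {D1 D2} => [|b' B] IHB.
    by rewrite shuf0r /consl !lext0; apply: allsupp0.
  have H := consl_dup2 (a := a) (IHB isT).
  have E : allsupp dup2 (consl a (mon ([:: a, a' & A], b' :: B))).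
    by rewrite /consl lextU; apply: allsuppU; rewrite /dup2 dup_cons2.
  have := allsuppD H E; rewrite {1}/consl lextB -/(consl _ _) -/(consl _ _).
  by rewrite addrNK.
have E : lext aws (shuf [:: a, a' & A] (b :: B)) - mon ([:: a, a' & A], b :: B) =
    lext (fun s => mon ([:: a], unzip2 s)) (shuf [:: a, a' & A] (b :: B)) +
    consl a (lext aws (shuf (a' :: A) (b :: B)) - mon (a' :: A, b :: B)) +
    sgn (size (a' :: A)) *: consl a (lext aws (shuf [:: a, a' & A] B)).
  rewrite shufE lext_aws_lcons -shufE /corner [nilp _ && _]/= add0r.
  by rewrite /consl lextD lextZ lextD lextZ lextB lextU; module.
by rewrite E; apply: allsuppD; [apply: allsuppD | apply: allsuppZ].
Qed.

End AlexanderWhitneyLists.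

(** * Simplices given by vertex lists *)

HB.lock Definition nch (K : sset) n (x : K n) : {malg chain_basis K} := nchain x.

Lemma nchE K n (x : simplex K n) : nchain x = nch x.
Proof. by rewrite nch.unlock. Qed.

Section NormalizedChains.
Variable K : sset.

Lemma nch_degenerate n (x : K n) : degenerate x -> nch x = 0.
Proof.
rewrite -nchE /nchain => dx; case: insubP => // y.
by move/negP; case; apply/asboolP.
Qed.

Lemma nch_mon n (y : nondeg K n) :
  nch (val y) = mon (Tagged (nondeg K) y : chain_basis K).
Proof. by rewrite -nchE /nchain valK monE. Qed.

Lemma nch_basis (b : chain_basis K) : nch (val (tagged b)) = mon b.
Proof. by rewrite nch_mon; case: b. Qed.

Lemma nchP n (x : K n) : degenerate x \/ exists y : nondeg K n, val y = x.
Proof.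
case: (boolP `[< degenerate x >]) => [/asboolP|] xP; first by left.
by right; exists (exist _ x xP).
Qed.

(** The device for leaving the basis of nondegenerate simplices: a map given on it by a formula
    obeys the same formula on all simplices once the formula kills the degenerate ones. *)
Lemma lext_nch (B : choiceType) (G : chain_basis K -> {malg B})
    (F : forall n, K n -> {malg B}) :
  (forall b, G b = F _ (val (tagged b))) ->
  (forall n (x : K n), degenerate x -> F n x = 0) ->
  forall n (x : K n), lext G (nch x) = F n x.
Proof.
move=> GF F0 n x; case: (nchP x) => [dx|[y <-]].
  by rewrite nch_degenerate // lext0 F0.
by rewrite nch_mon lextU GF.
Qed.

Lemma homog_nch n (x : K n) : homog n (nch x).
Proof.
case: (nchP x) => [/nch_degenerate ->|[y <-]]; first exact: allsupp0.
by rewrite nch_mon; apply: allsuppU.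
Qed.

End NormalizedChains.

Lemma dupP (V : choiceType) (s : seq V) :
  dup s -> exists s1 v s2, s = s1 ++ [:: v, v & s2].
Proof.
elim: s => [|v s IH] // /dup_consE[/IH[s1 [w [s2 ->]]]|[s' ->]].
  by exists (v :: s1), w, s2.
by exists [::], v, s'.
Qed.

Lemma bdry_sum (V : choiceType) (s : seq V) :
  bdry s = \sum_(i < size s) sgn i *: mon (take i s ++ drop i.+1 s).
Proof.
elim: s => [|v s IH]; first by rewrite big_ord0.
rewrite bdry_cons big_ord_recl /= drop0 sgn0 scale1r IH /lcons lext_sum -sumrN.
congr (_ + _); apply: eq_bigr => i _.
by rewrite lextZ lextU /= /bump add1n sgnS scaleNr.
Qed.

Lemma cop_sum (V : choiceType) (s : seq V) :
  cop s = \sum_(i < size s) mon (take i.+1 s, drop i s).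
Proof.
elim: s => [|v s IH]; first by rewrite big_ord0.
rewrite big_ord_recl /= take0 IH /lconsl lext_sum.
by congr (_ + _); apply: eq_bigr => i _; rewrite lextU.
Qed.

Lemma simpop_le l m (a : simpop l m) (i j : 'I_l.+1) :
  (i <= j)%N -> (val a i <= val a j)%N.
Proof. exact: (monotoneP _ (valP a)). Qed.

Lemma natopE m n f (hf : {homo f : i j / (i <= j)%N}) (i : 'I_m.+1) :
  val (natop m n hf) i = minn (f i) n :> nat.
Proof. by rewrite ffunE inordK // ltnS geq_minr. Qed.

Lemma simpopP l m (a b : simpop l m) :
  (forall i, val a i = val b i :> nat) -> a = b.
Proof.
by move=> ab; apply: val_inj; apply/ffunP => i; apply: val_inj; apply: ab.
Qed.

Lemma compopE l m n (a : simpop m n) (b : simpop l m) i :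
  val (compop a b) i = val a (val b i).
Proof. by rewrite ffunE. Qed.

(* A coherent family of simplices of [S], one for each admissible vertex
   list. *)
Definition realizes (S : sset) (V : choiceType) (ok : pred (seq V))
    (rz : forall m, seq V -> S m) :=
  (forall s s', subseq s' s -> ok s -> ok s') /\
  forall l m (a : simpop l m) (s s' : seq V), ok s -> size s = m.+1 ->
    size s' = l.+1 ->
    (forall x0 (i : 'I_l.+1), nth x0 s' i = nth x0 s (val a i)) ->
    act a (rz m s) = rz l s'.

(** The value 0 on the empty list discards the augmentation terms of the list calculus. *)
Definition evr (S : sset) (V : choiceType) (rz : forall m, seq V -> S m)
    (s : seq V) : {malg chain_basis S} :=
  if s is v :: s' then nch (rz (size s') s) else 0.

Lemma evrE (S : sset) (V : choiceType) (rz : forall m, seq V -> S m) m s :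
  size s = m.+1 -> evr rz s = nch (rz m s).
Proof. by case: s => // v s [<-]. Qed.

Lemma homog_evr (S : sset) (V : choiceType) (rz : forall m, seq V -> S m) s :
  homog (size s).-1 (evr rz s).
Proof. by case: s => [|v s]; [apply: allsupp0 | apply: homog_nch]. Qed.

Definition diff_simplex (S : sset) n (x : S n) : {malg chain_basis S} :=
  chain_diff_simplex x.

Definition aw_simplex (K L : sset) n (x : K n) (y : L n) :
    {malg (chain_basis K * chain_basis L)%type} :=
  \sum_(i < n.+1)
    ten (nch (act (frontop i n) x)) (nch (act (backop (n - i) n) y)).

Section Realizer.
Variables (S : sset) (V : choiceType) (ok : pred (seq V)).
Variable (rz : forall m, seq V -> S m).
Hypothesis rzP : realizes ok rz.

Lemma degop_dup m (s1 s2 : seq V) v x0 (i : 'I_m.+2) :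
  (size s1 <= m)%N ->
  nth x0 (s1 ++ [:: v, v & s2]) i =
  nth x0 (s1 ++ v :: s2) (val (degop m (size s1)) i).
Proof.
move=> s1m; rewrite natopE /unbump.
case: (ltngtP (size s1) i) => /= i1.
- have Hi : (i - 1 <= m)%N by rewrite leq_subLR add1n -ltnS ltn_ord.
  rewrite (minn_idPl Hi) !nth_cat.
  have -> : (i < size s1)%N = false by lia.
  have -> : (i - 1 < size s1)%N = false by lia.
  by have -> : (i - size s1 = (i - 1 - size s1).+1)%N by lia.
- rewrite subn0 (minn_idPl _); last exact: leq_trans (ltnW i1) s1m.
  by rewrite !nth_cat i1.
- rewrite subn0 -i1 (minn_idPl s1m).
  by rewrite !nth_cat ltnn subnn.
Qed.

Lemma evr_dup s : ok s -> dup s -> evr rz s = 0.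
Proof.
move=> oks /dupP[s1 [v [s2 Es]]].
have ss : size s = (size s1 + size s2).+2 by rewrite Es size_cat /= !addnS.
rewrite (evrE _ ss); apply: nch_degenerate.
have H1 : (size s1 < (size s1 + size s2).+1)%N by rewrite ltnS leq_addr.
exists (Ordinal H1), (rz _ (s1 ++ v :: s2)); symmetry.
apply: rzP.2.
- apply: rzP.1 oks; rewrite Es; apply: cat_subseq => //.
  exact: subseq_cons.
- by rewrite size_cat /= addnS.
- by [].
- by move=> x0 i; rewrite Es; apply: degop_dup; rewrite leq_addr.
Qed.

Lemma diff_simplex_rz m s : ok s -> size s = m.+1 ->
  diff_simplex (rz m s) = lext (evr rz) (bdry s).
Proof.
move=> oks ss; rewrite bdry_sum lext_sum ss.
case: m ss => [|m] ss.
  rewrite big_ord1 lextZ lextU take0 (drop_oversize (n := 1)) ?ss //=.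
  by rewrite scaler0.
apply: eq_bigr => i _; rewrite lextZ lextU nchE; congr (_ *: _).
have ts : size (take i s ++ drop i.+1 s) = m.+1.
  rewrite size_cat size_drop size_take ss ltn_ord subSS.
  by rewrite addnC subnK // -ltnS.
rewrite (evrE _ ts); congr nch; apply: rzP.2 => // x0 j.
rewrite natopE nth_cat size_take ss ltn_ord /bump.
case: ltnP => [ji|ij]; first by rewrite add0n nth_take // (minn_idPl _) // ltnW.
rewrite add1n (minn_idPl _) // nth_drop addSn subnKC //.
Qed.

End Realizer.

Lemma aw_simplex_rz (K L : sset) (V : choiceType) (ok : pred (seq V))
    (rK : forall m, seq V -> K m) (rL : forall m, seq V -> L m) :
  realizes ok rK -> realizes ok rL ->
  forall m s, ok s -> size s = m.+1 ->
  aw_simplex (rK m s) (rL m s) =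
  lext (fun t => ten (evr rK t.1) (evr rL t.2)) (cop s).
Proof.
move=> hK hL m s oks ss; rewrite cop_sum lext_sum ss; apply: eq_bigr => i _.
have im : (i <= m)%N by rewrite -ltnS.
rewrite lextU /=; congr ten.
  have ts : size (take i.+1 s) = i.+1 by rewrite size_takel // ss.
  rewrite (evrE _ ts); congr nch; apply: hK.2 => // x0 j.
  rewrite natopE nth_take // (minn_idPl _) // (leq_trans _ im) // -ltnS.
  exact: ltn_ord.
have ts : size (drop i s) = (m - i).+1 by rewrite size_drop ss subSn.
rewrite (evrE _ ts); congr nch; apply: hL.2 => // x0 j.
rewrite natopE nth_drop (subKn im) (minn_idPl _) //.
by rewrite -leq_subRL // -ltnS.
Qed.

(* For sorted [s] this is [nth 0 s i]; the maximum makes it monotone for every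
   [s], as [natop] requires. *)
Definition runmax (s : seq nat) (i : nat) : nat := \max_(j < i.+1) nth 0%N s j.

Lemma runmax_homo s : {homo runmax s : i j / (i <= j)%N}.
Proof.
move=> i j ij; apply/bigmax_leqP => k _.
have kj : (k < j.+1)%N by apply: leq_trans (ltn_ord k) _.
exact: (leq_bigmax (Ordinal kj)).
Qed.

Lemma runmaxE s i : sorted leq s -> (i < size s)%N -> runmax s i = nth 0%N s i.
Proof.
move=> ss si; apply/eqP; rewrite eqn_leq; apply/andP; split.
  apply/bigmax_leqP => k _; have ki : (k <= i)%N by rewrite -ltnS.
  apply: (sorted_leq_nth leq_trans leqnn) => //.
  by rewrite inE (leq_ltn_trans ki).
exact: (leq_bigmax (Ordinal (ltnSn i))).
Qed.

(* The operator [0,m] -> [0,n] with the sorted list [s] of vertices as its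
   values. *)
Definition listop m n (s : seq nat) : simpop m n := natop m n (runmax_homo s).

Lemma listopE m n s (i : 'I_m.+1) : sorted leq s -> size s = m.+1 ->
  val (listop m n s) i = minn (nth 0%N s i) n :> nat.
Proof. by move=> ss sm; rewrite natopE runmaxE // sm. Qed.

Definition face (K : sset) n (x : K n) m (s : seq nat) : K m :=
  act (listop m n s) x.

Lemma sorted_comp l m (a : simpop l m) (s s' : seq nat) :
  sorted leq s -> size s = m.+1 -> size s' = l.+1 ->
  (forall i : 'I_l.+1, nth 0%N s' i = nth 0%N s (val a i)) -> sorted leq s'.
Proof.
move=> ss sm sl s's; rewrite (sorted_pairwise leq_trans).
apply/(pairwiseP 0%N) => i j; rewrite !inE sl => il jl ij.
rewrite (s's (Ordinal il)) (s's (Ordinal jl)).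
apply: (sorted_leq_nth leq_trans leqnn) => //; rewrite ?inE ?sm ?ltn_ord //.
by apply: simpop_le; apply: ltnW.
Qed.

Lemma face_realizes (K : sset) n (x : K n) :
  realizes (sorted leq) (face x).
Proof.
split=> [s s' ss'|l m a s s' ss sm sl s's].
  exact: (subseq_sorted leq_trans).
rewrite /face -act_comp; congr act; apply: simpopP => i.
have ss' := sorted_comp ss sm sl (s's 0%N).
by rewrite compopE !listopE // s's.
Qed.

Lemma face_iota (K : sset) n (x : K n) : face x n (iota 0 n.+1) = x.
Proof.
rewrite -[RHS]act_id /face; congr act; apply: simpopP => i.
rewrite listopE ?size_iota ?iota_sorted // nth_iota // ffunE add0n.
by rewrite (minn_idPl _) // -ltnS.
Qed.

(** The [minn] reproduces the truncation built into [natop], so that the entries of [r] need no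
    bound. *)
Lemma face_face (K : sset) n (x : K n) m s l r :
  sorted leq s -> size s = m.+1 -> sorted leq r -> size r = l.+1 ->
  face (face x m s) l r = face x l [seq nth 0%N s (minn k m) | k <- r].
Proof.
move=> ss sm sr rl; rewrite /face -act_comp; congr act; apply: simpopP => i.
have mono : {homo (fun k => nth 0%N s (minn k m)) : j k / (j <= k)%N}.
  move=> j k jk; apply: (sorted_leq_nth leq_trans leqnn) => //;
    rewrite ?inE ?sm ?ltnS ?geq_minr //.
  by rewrite leq_min geq_minr andbT (leq_trans (geq_minl _ _)).
rewrite compopE !listopE ?size_map //; last exact: (homo_sorted mono).
by rewrite (nth_map 0%N) ?rl // minnAC minnn.
Qed.

Lemma realizes_map (S : sset) (V W : choiceType) (ok : pred (seq V))
    (ok' : pred (seq W)) (rz : forall m, seq V -> S m) (h : W -> V) :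
  realizes ok rz -> (forall s, ok' s -> ok (map h s)) ->
  (forall s s', subseq s' s -> ok' s -> ok' s') ->
  realizes ok' (fun m s => rz m (map h s)).
Proof.
move=> [_ hr] okh sub; split=> // l m a s s' oks sm sl s's.
apply: hr; rewrite ?size_map ?okh // => x0 i.
have w0 : W by case: (s) sm.
rewrite (nth_map w0) ?sl // (nth_map w0) ?sm ?ltn_ord //.
by rewrite s's.
Qed.

Lemma realizes_prod (K L : sset) (V : choiceType) (ok : pred (seq V))
    (rK : forall m, seq V -> K m) (rL : forall m, seq V -> L m) :
  realizes ok rK -> realizes ok rL ->
  realizes ok (fun m s => (rK m s, rL m s) : sprod K L m).
Proof.
move=> [sub hK] [_ hL]; split=> // l m a s s' oks sm sl s's.
by rewrite [LHS]/= /prod_act /= (hK l m a s s') // (hL l m a s s').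
Qed.

Lemma size_degop (n i : nat) : (i <= n)%N ->
  exists s, [/\ size s = n.+2, sorted leq s, dup s &
    forall (K : sset) (y : K n), act (degop n i) y = face y n.+1 s].
Proof.
move=> ni; exists (iota 0 i ++ [:: i, i & iota i.+1 (n - i)]).
have sz : size (iota 0 i ++ [:: i, i & iota i.+1 (n - i)]) = n.+2.
  by rewrite size_cat /= !size_iota !addnS subnKC.
have srt : sorted leq (iota 0 i ++ [:: i, i & iota i.+1 (n - i)]).
  rewrite (sorted_pairwise leq_trans); rewrite pairwise_cat; apply/and3P; split.
  - apply/allrelP => x y; rewrite mem_iota add0n !inE mem_iota => xi.
    by case/or3P => [/eqP->|/eqP->|/andP[iy _]]; apply: ltnW => //; apply: ltn_trans iy.
  - by rewrite -(sorted_pairwise leq_trans) iota_sorted.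
  - rewrite -(sorted_pairwise leq_trans) /= leqnn /=.
    exact: (iota_sorted i (n - i).+1).
split=> //; first by elim: (iota 0 i) => [|u s]; [apply: dup_cons2 | apply: dup_cons].
move=> K y; rewrite /face; congr act; apply: simpopP => j.
rewrite listopE // (degop_dup (m := n)); rewrite ?size_iota //.
have -> : iota 0 i ++ i :: iota i.+1 (n - i) = iota 0 n.+1.
  by rewrite -[i :: _]/(iota i (n - i).+1) -iotaD -subSn // subnKC // leqW.
rewrite nth_iota ?ltn_ord // add0n (minn_idPl _) //.
by rewrite -ltnS ltn_ord.
Qed.

(** Turns degeneracy into a repeated entry, so that compatibility of a map with normalization can be
    read off from its effect on [dup] lists. *)
Lemma degenerate_face (K : sset) n (x : K n) : degenerate x ->
  exists m s (y : K m), [/\ size s = n.+1, sorted leq s, dup s & x = face y n s].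
Proof.
case: n x => // n x [i [y ->]]; have /size_degop[s [ss so ds E]] : (i <= n)%N.
  by rewrite -ltnS.
by exists n, s, y; split.
Qed.

Lemma lext_dup0 (V B : choiceType) (ok : pred (seq V)) (f : seq V -> {malg B})
    c :
  (forall s, ok s -> dup s -> f s = 0) ->
  allsupp ok c -> allsupp (@dup _) c -> lext f c = 0.
Proof.
by move=> f0 okc dc; apply: (lext_eq0_in (allsuppI okc dc)) => s [/f0]; apply.
Qed.

Section ChainLevel.
Variables (S : sset).

Lemma chain_diff_nch n (x : S n) :
  lext (@chain_diff S) (nch x) = diff_simplex x.
Proof.
apply: (lext_nch (F := @diff_simplex S)) => // {}n {}x.
case/degenerate_face => m [s [y [ss so ds ->]]].
rewrite (diff_simplex_rz (face_realizes y)) //.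
apply: (lext_dup0 (ok := sorted leq)); last exact: bdry_dup.
  exact: (evr_dup (face_realizes y)).
apply: (allsuppW (@bdry_subseq _ _)) => r rs.
exact: (face_realizes y).1 rs so.
Qed.

Lemma chain_diff_evr (V : choiceType) (ok : pred (seq V))
    (rz : forall m, seq V -> S m) s : realizes ok rz -> ok s ->
  lext (@chain_diff S) (evr rz s) = lext (evr rz) (bdry s).
Proof.
case: s => [|v s] hr oks; first by rewrite !lext0.
by rewrite chain_diff_nch (diff_simplex_rz hr oks).
Qed.

End ChainLevel.

Lemma aw_simplex_degenerate (K L : sset) n (xy : sprod K L n) :
  degenerate xy -> aw_simplex xy.1 xy.2 = 0.
Proof.
case/degenerate_face => m [s [y [ss so ds ->]]] /=.
rewrite (aw_simplex_rz (face_realizes y.1) (face_realizes y.2)) //.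
apply: (lext_eq0_in (allsuppI (cop_dup ds) (@cop_subseq _ s))) => t.
case=> [dt [t1 t2]]; case/orP: dt => dt.
  rewrite (evr_dup (face_realizes y.1)) ?ten0l //.
  exact: (face_realizes y.1).1 t1 so.
rewrite [X in ten _ X](evr_dup (face_realizes y.2)) ?ten0r //.
exact: (face_realizes y.2).1 t2 so.
Qed.

Lemma alexander_whitney_nch (K L : sset) n (xy : sprod K L n) :
  lext (@alexander_whitney K L) (nch xy) = aw_simplex xy.1 xy.2.
Proof.
apply: (lext_nch (F := fun n (xy : sprod K L n) => aw_simplex xy.1 xy.2)).
  by move=> b; apply: eq_bigr => i _; rewrite tenE !nchE.
by move=> {}n {}xy; apply: aw_simplex_degenerate.
Qed.

Lemma alexander_whitney_evr (K L : sset) (V : choiceType) (ok : pred (seq V))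
    (rK : forall m, seq V -> K m) (rL : forall m, seq V -> L m) s :
  realizes ok rK -> realizes ok rL -> ok s ->
  lext (@alexander_whitney K L)
    (evr (S := sprod K L) (fun m s => (rK m s, rL m s)) s) =
  lext (fun t => ten (evr rK t.1) (evr rL t.2)) (cop s).
Proof.
case: s => [|v s] hK hL oks; first by rewrite !lext0.
by rewrite alexander_whitney_nch (aw_simplex_rz hK hL oks).
Qed.

Lemma ccop_chainsE (K : sset) (b : chain_basis K) :
  ccop (c := chains K) b =
  aw_simplex (val (tagged b)) (val (tagged b)).
Proof.
rewrite /= lextE /diag nchE.
exact: (@alexander_whitney_nch K K _ (_, _)).
Qed.

Lemma ccop_evr (S : sset) (V : choiceType) (ok : pred (seq V))
    (rz : forall m, seq V -> S m) s : realizes ok rz -> ok s ->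
  lext (@ccop (chains S)) (evr rz s) =
  lext (fun t => ten (evr rz t.1) (evr rz t.2)) (cop s).
Proof.
case: s => [|v s] hr oks; first by rewrite !lext0.
have -> : lext (@ccop (chains S)) (evr rz (v :: s)) =
    aw_simplex (rz (size s) (v :: s)) (rz (size s) (v :: s)).
  apply: (lext_nch (F := fun n (x : S n) => aw_simplex x x)).
    exact: ccop_chainsE.
  move=> n x; case: n x => // n x [i [y ->]].
  apply: (@aw_simplex_degenerate _ _ _ (act (degop n i) y, act (degop n i) y)).
  by exists i, (y, y).
exact: (aw_simplex_rz hr hr oks).
Qed.

(** * Simplices of a product, given by lists of pairs *)

Definition le2 (p q : nat * nat) := (p.1 <= q.1)%N && (p.2 <= q.2)%N.
Definition ok2 : pred (seq (nat * nat)) := sorted le2.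

Lemma le2_trans : transitive le2.
Proof.
move=> y x z /andP[xy1 xy2] /andP[yz1 yz2]; rewrite /le2.
by rewrite (leq_trans xy1 yz1) (leq_trans xy2 yz2).
Qed.

Lemma ok2_unzip1 s : ok2 s -> sorted leq (unzip1 s).
Proof. by rewrite sorted_map; apply: sub_sorted => p q /andP[]. Qed.

Lemma ok2_unzip2 s : ok2 s -> sorted leq (unzip2 s).
Proof. by rewrite sorted_map; apply: sub_sorted => p q /andP[]. Qed.

Section Pairs.
Variables (K L : sset) (p : nat) (x : K p) (q : nat) (y : L q).

Lemma pair1_realizes : realizes ok2 (fun m s => face x m (unzip1 s)).
Proof.
apply: realizes_map (face_realizes x) ok2_unzip1 _ => s s' ss'.
exact: (subseq_sorted le2_trans).
Qed.

Lemma pair2_realizes : realizes ok2 (fun m s => face y m (unzip2 s)).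
Proof.
apply: realizes_map (face_realizes y) ok2_unzip2 _ => s s' ss'.
exact: (subseq_sorted le2_trans).
Qed.

Definition pairface m (s : seq (nat * nat)) : sprod K L m :=
  (face x m (unzip1 s), face y m (unzip2 s)).

Lemma pairface_realizes : realizes ok2 pairface.
Proof. exact: (realizes_prod pair1_realizes pair2_realizes). Qed.

Definition evp : seq (nat * nat) -> {malg chain_basis (sprod K L)} :=
  evr pairface.

End Pairs.

(** A simplex [(x, y)] of the product in its own coordinates: the universal case, to which
    naturality ([evp_face], [ezh_map]) reduces all lists. *)
Definition diagl n : seq (nat * nat) := [seq (i, i) | i <- iota 0 n.+1].

Lemma unzip1_diagl n : unzip1 (diagl n) = iota 0 n.+1.
Proof. by rewrite /unzip1 -map_comp map_id. Qed.

Lemma unzip2_diagl n : unzip2 (diagl n) = iota 0 n.+1.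
Proof. by rewrite /unzip2 -map_comp map_id. Qed.

Lemma path_diagl n : path le2 (0%N, 0%N) (diagl n).
Proof.
rewrite path_map; have : path leq 0 (iota 0 n.+1) by exact: (iota_sorted 0 n.+1).
by apply: sub_path => i j ij; rewrite /= /le2 /= ij.
Qed.

Lemma size_diagl n : size (diagl n) = n.+1.
Proof. by rewrite size_map size_iota. Qed.

Lemma evp_diagl (K L : sset) n (x : K n) (y : L n) :
  evp x y (diagl n) = nch ((x, y) : sprod K L n).
Proof.
rewrite /evp (evrE _ (size_diagl n)) /pairface unzip1_diagl unzip2_diagl.
by rewrite !face_iota.
Qed.

Definition subst2 (s1 s2 : seq nat) (m1 m2 : nat) (p : nat * nat) :=
  (nth 0%N s1 (minn p.1 m1), nth 0%N s2 (minn p.2 m2)).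

Lemma evp_face (K L : sset) p (x : K p) q (y : L q) m1 m2 s1 s2 r :
  sorted leq s1 -> size s1 = m1.+1 -> sorted leq s2 -> size s2 = m2.+1 ->
  ok2 r ->
  evp (face x m1 s1) (face y m2 s2) r =
  evp x y (map (subst2 s1 s2 m1 m2) r).
Proof.
move=> so1 sz1 so2 sz2; case: r => [//|v r] okr.
rewrite /evp (@evrE _ _ _ (size r)) // (@evrE _ _ _ (size r)) ?size_map //.
congr nch; rewrite /pairface !face_face ?size_map ?ok2_unzip1 ?ok2_unzip2 //.
by rewrite /unzip1 /unzip2 -!map_comp.
Qed.

Lemma map_nth_minn (s1 : seq nat) m1 :
  size s1 = m1.+1 ->
  [seq nth 0%N s1 (minn k m1) | k <- iota 0 m1.+1] = s1.
Proof.
move=> sz1; apply: (@eq_from_nth _ 0%N); first by rewrite size_map size_iota.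
move=> i; rewrite size_map size_iota => im.
by rewrite (nth_map 0%N) ?size_iota // nth_iota // add0n (minn_idPl _).
Qed.

(** * The homotopy phi on vertex lists *)

Section Subsets.
Local Open Scope nat_scope.

(** Decides separately whether 0 belongs to the set, that is, in which direction the lattice path
    takes its first step. This is the counterpart of [shufE] for shuffles encoded as subsets. *)
Definition setb n (b : bool) (mu : {set 'I_n}) : {set 'I_n.+1} :=
  [set i | if unlift ord0 i is Some j then j \in mu else b].

Lemma setb_bij n : bijective (fun t : bool * {set 'I_n} => setb t.1 t.2).
Proof.
exists (fun mu : {set 'I_n.+1} =>
    (ord0 \in mu, [set j : 'I_n | lift ord0 j \in mu])) => [[b mu]|mu].
  congr pair; first by rewrite inE unlift_none.
  by apply/setP => j; rewrite !inE liftK.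
by apply/setP => i; rewrite !inE; case: unliftP => [j|] ->; rewrite ?inE.
Qed.

Lemma card_set_sum (T : finType) (P : pred T) : #|[set x | P x]| = \sum_x P x.
Proof. by rewrite -sum1dep_card big_mkcond; apply: eq_bigr => x _; case: (P x). Qed.

Lemma card_sum (T : finType) (A : {set T}) : #|A| = \sum_x (x \in A).
Proof. by rewrite -sum1_card big_mkcond; apply: eq_bigr => x _; case: (x \in A). Qed.

Definition cnt n (mu : {set 'I_n}) (j : nat) := #|[set m in mu | m < j]|.

Lemma cntE n (mu : {set 'I_n}) j : cnt mu j = \sum_m ((m \in mu) && (m < j)).
Proof. exact: card_set_sum. Qed.

Lemma setb0 n b (mu : {set 'I_n}) : (ord0 \in setb b mu) = b.
Proof. by rewrite inE unlift_none. Qed.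

Lemma setbS n b (mu : {set 'I_n}) j : (lift ord0 j \in setb b mu) = (j \in mu).
Proof. by rewrite inE liftK. Qed.

Lemma card_setb n b (mu : {set 'I_n}) : #|setb b mu| = b + #|mu|.
Proof.
rewrite !card_sum big_ord_recl setb0; congr (_ + _).
by apply: eq_bigr => j _; rewrite setbS.
Qed.

Lemma setbC n b (mu : {set 'I_n}) : ~: setb b mu = setb (~~ b) (~: mu).
Proof. by apply/setP => i; rewrite !inE; case: unliftP => [j|]; rewrite ?inE. Qed.

Lemma cnt0 n (mu : {set 'I_n}) : cnt mu 0 = 0.
Proof. by rewrite cntE big1 // => m _; rewrite ltn0 andbF. Qed.

Lemma cnt_setb n b (mu : {set 'I_n}) j : cnt (setb b mu) j.+1 = b + cnt mu j.
Proof.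
rewrite !cntE big_ord_recl setb0 andbT; congr (_ + _).
by apply: eq_bigr => m _; rewrite setbS lift0 ltnS.
Qed.

Lemma shuffle_sgnE n (mu : {set 'I_n}) : shuffle_sgn mu =
  \sum_i \sum_j [&& i \in mu, j \notin mu & j < i].
Proof. by rewrite /shuffle_sgn card_set_sum pair_bigA. Qed.

(** If 0 lies outside the set, it precedes all its elements and adds one inversion for each of
    them. *)
Lemma shuffle_sgn_setb n b (mu : {set 'I_n}) :
  shuffle_sgn (setb b mu) = ~~ b * #|mu| + shuffle_sgn mu.
Proof.
rewrite !shuffle_sgnE big_ord_recl [X in X + _]big1 => [|i _]; last first.
  by rewrite ltn0 !andbF.
rewrite add0n card_sum big_distrr -big_split; apply: eq_bigr => i _ /=.
rewrite big_ord_recl setb0 setbS andbT; congr (_ + _).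
  by rewrite mulnb andbC.
by apply: eq_bigr => j _; rewrite !setbS !lift0 ltnS.
Qed.

Lemma cnt_le n (mu : {set 'I_n}) j : cnt mu j <= #|mu|.
Proof. by apply/subset_leq_card/fintype.subsetP => m; rewrite inE => /andP[]. Qed.

End Subsets.

(** Ties the recursion to the sum over shuffles: [cnt mu j] is the number of steps in the first
    direction before position [j]. The two counts are at most [(size A).-1] and [(size B).-1], so
    the default values are never reached. *)
Lemma shuf_sum (V W : choiceType) (v0 : V) (w0 : W) n (A : seq V) (B : seq W) :
  (0 < size A)%N -> (0 < size B)%N -> (size A + size B = n.+2)%N ->
  shuf A B = \sum_(mu : {set 'I_n} | #|mu| == (size A).-1)
    sgn (shuffle_sgn mu) *: mon [seq (nth v0 A (cnt mu j), nth w0 B (cnt (~: mu) j))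
                                | j <- iota 0 n.+1].
Proof.
elim: n A B => [|n IH] [|a A] [|b B] // _ _ AB.
  have {AB}/eqP : (size A + size B)%N = 0%N by move: AB; rewrite /= addnS => -[].
  rewrite addn_eq0 => /andP[/nilP -> /nilP ->].
  rewrite (big_pred1 set0) => [|mu]; last by rewrite cards_eq0.
  rewrite shuf1 /= !cnt0 /= shuffle_sgnE big1 ?sgn0 ?scale1r // => i.
  by case: i.
have {}AB : (size A + size B)%N = n.+1 by move: AB; rewrite /= addnS => -[].
(* The summands with the first step split off; [c] tells whether it goes in the direction of [A]. *)
pose F (c : bool) (mu : {set 'I_n}) := sgn (~~ c * #|mu| + shuffle_sgn mu) *:
  lcons (a, b) (mon [seq (nth v0 (a :: A) (c + cnt mu j),
    nth w0 (b :: B) (~~ c + cnt (~: mu) j)) | j <- iota 0 n.+1]).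
transitivity (\sum_(c : bool) \sum_(mu : {set 'I_n} | (c + #|mu|)%N == size A) F c mu);
    last first.
  rewrite pair_big_dep [RHS](reindex _ (onW_bij _ (setb_bij n))).
  apply: eq_big => [t|t _]; first by rewrite card_setb.
  rewrite -[iota 0 n.+2]/(0%N :: iota (1 + 0) n.+1) iotaDl map_cons -map_comp.
  rewrite /F shuffle_sgn_setb setbC lconsU !cnt0; congr (_ *: mon (_ :: _)).
  by apply: eq_map => k; rewrite [RHS]/= !cnt_setb.
rewrite big_bool shufE lconsD lconsD lconsZ.
have -> : corner A B = 0.
  by rewrite /corner; case: ifP => // /andP[/nilP A0 /nilP B0]; rewrite A0 B0 in AB.
rewrite lcons0 add0r; congr (_ + _).
  case: (posnP (size A)) => [A0|A0].
    by rewrite (size0nil A0) shuf0l lcons0 big_pred0.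
  rewrite (IH A (b :: B)) //= ?addnS ?AB // /lcons lext_sum -(prednK A0).
  by apply: eq_big => [mu|mu _]; [| rewrite lextZ /F mul0n].
case: (posnP (size B)) => [B0|B0].
  rewrite (size0nil B0) shuf0r lcons0 scaler0 big_pred0 // => mu.
  rewrite add0n; apply/negbTE; rewrite neq_ltn.
  move: AB; rewrite B0 addn0 => ->; rewrite ltnS.
  by have := max_card (mem mu); rewrite card_ord => ->.
rewrite (IH (a :: A) B) //= ?addSn ?AB // /lcons lext_sum scaler_sumr.
apply: eq_bigr => mu /eqP muA.
by rewrite lextZ /F scalerA -sgnD mul1n muA.
Qed.

(** A pair of operators is recovered from its list of values by [listop_op], so combinations of
    operators become combinations of vertex lists without loss. *)
Definition oplist m n (ab : oppair m n) : seq (nat * nat) :=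
  [seq (val ab.1 i : nat, val ab.2 i : nat) | i <- enum 'I_m.+1].

Lemma size_oplist m n (ab : oppair m n) : size (oplist ab) = m.+1.
Proof. by rewrite size_map size_enum_ord. Qed.

Lemma listop_op m n (a : simpop m n) :
  listop m n [seq val a i : nat | i <- enum 'I_m.+1] = a.
Proof.
have nE (i : 'I_m.+1) : nth 0%N [seq val a i : nat | i <- enum 'I_m.+1] i = val a i.
  by rewrite (nth_map ord0) ?size_enum_ord // nth_ord_enum.
apply: simpopP => i; rewrite listopE ?size_map ?size_enum_ord //.
  by rewrite nE (minn_idPl _) // -ltnS.
apply: (sorted_comp (iota_sorted 0 n.+1) (size_iota _ _) _ (a := a)).
  by rewrite size_map size_enum_ord.
- by move=> j; rewrite nE nth_iota // ltn_ord.
- by rewrite -enumT size_enum_ord.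
Qed.

Lemma unzip1_oplist m n (ab : oppair m n) :
  unzip1 (oplist ab) = [seq val ab.1 i : nat | i <- enum 'I_m.+1].
Proof. by rewrite /unzip1 -map_comp. Qed.

Lemma unzip2_oplist m n (ab : oppair m n) :
  unzip2 (oplist ab) = [seq val ab.2 i : nat | i <- enum 'I_m.+1].
Proof. by rewrite /unzip2 -map_comp. Qed.

Lemma evp_oplist (K L : sset) n (x : K n) (y : L n) m (ab : oppair m n) :
  evp x y (oplist ab) = nch ((act ab.1 x, act ab.2 y) : sprod K L m).
Proof.
rewrite /evp (evrE _ (size_oplist ab)) /pairface /face.
by rewrite unzip1_oplist unzip2_oplist !listop_op.
Qed.

Lemma oplist_derop m n (ab : oppair m n) :
  oplist ((derop ab.1, derop ab.2) : oppair m.+1 n.+1) =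
  (0, 0)%N :: [seq (p.1.+1, p.2.+1) | p <- oplist ab].
Proof.
rewrite /oplist enum_ordSl /= !ffunE unlift_none /=; congr (_ :: _).
rewrite -!map_comp; apply: eq_map => i /=.
by rewrite !ffunE liftK !lift0.
Qed.

Lemma oplist_degop m n (ab : oppair m n.+1) :
  oplist ((compop (degop n 0) ab.1, compop (degop n 0) ab.2) : oppair m n) =
  [seq (p.1.-1, p.2.-1) | p <- oplist ab].
Proof.
rewrite /oplist -map_comp; apply: eq_map => i.
have E (a : 'I_n.+2) : nat_of_ord (val (degop n 0) a) = a.-1.
  rewrite natopE /unbump; case: a => -[|a] /= an; first by rewrite min0n.
  by rewrite subn1 (minn_idPl _).
by rewrite -[RHS]/((val ab.1 i : nat).-1, (val ab.2 i : nat).-1) -!E -!compopE.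
Qed.

Lemma oplist_shuffle n i (mu : {set 'I_n}) : (i <= n)%N -> #|mu| = i ->
  oplist ((compop (frontop i n) (shuffleop i mu),
           compop (backop (n - i) n) (shuffleop (n - i) (~: mu))) : oppair n n) =
  [seq (nth 0%N (iota 0 i.+1) (cnt mu j), nth 0%N (iota i (n - i).+1) (cnt (~: mu) j))
      | j <- iota 0 n.+1].
Proof.
move=> ni mui; rewrite /oplist -(val_enum_ord n.+1) -map_comp; apply: eq_map => j.
have muC : #|~: mu| = (n - i)%N.
  by have := cardsC mu; rewrite card_ord mui => /(congr1 (subn^~ i)); rewrite addKn.
have c1 := cnt_le mu j; have c2 := cnt_le (~: mu) j.
rewrite mui in c1; rewrite muC in c2.
rewrite -[RHS]/(nth 0%N (iota 0 i.+1) (cnt mu j), nth 0%N (iota i (n - i).+1) (cnt (~: mu) j)).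
rewrite !nth_iota ?ltnS // add0n; congr pair.
  rewrite compopE natopE natopE (minn_idPl c1) (minn_idPl _) //.
  exact: leq_trans ni.
rewrite compopE natopE natopE (minn_idPl c2) (subKn ni) (minn_idPl _) //.
by rewrite -leq_subRL.
Qed.

Lemma cop_diagl n :
  cop (diagl n) = \sum_(i < n.+1) mon ([seq (k, k) | k <- iota 0 i.+1],
                                       [seq (k, k) | k <- iota i (n - i).+1]).
Proof.
rewrite cop_sum size_diagl; apply: eq_bigr => i _; congr mon.
rewrite /diagl -map_take -map_drop take_iota drop_iota add0n.
have ni : (i <= n)%N by rewrite -ltnS.
by rewrite (minn_idPl _) // subSn.
Qed.

Lemma ez_diagl n :
  lext (fun ab : oppair n n => mon (oplist ab)) (nabla_f_op n) = ez (diagl n).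
Proof.
rewrite /ez [nilp _]/= add0r cop_diagl /nabla_f_op !lext_sum.
apply: eq_bigr => i _; have ni : (i <= n)%N by rewrite -ltnS.
rewrite lextU /shuf2 /unzip1 /unzip2 -!map_comp !map_id.
rewrite (@shuf_sum _ _ 0%N 0%N n) ?size_iota //; last first.
  by rewrite addSn addnS subnKC.
rewrite lext_sum; apply: eq_bigr => mu /eqP mui.
by rewrite monZE lextZ lextU oplist_shuffle.
Qed.

Definition shift2 (p : nat * nat) := (p.1.+1, p.2.+1).
Definition unshift2 (p : nat * nat) := (p.1.-1, p.2.-1).

Lemma diaglS n : diagl n.+1 = (0%N, 0%N) :: map shift2 (diagl n).
Proof.
by rewrite /diagl -[iota 0 n.+2]/(0%N :: iota (1 + 0) n.+1) iotaDl map_cons -!map_comp.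
Qed.

(** The recursions agree except at their start: [phi_op 0] is 0, whereas [ezh] sends a single vertex
    to that vertex repeated. The discrepancy is degenerate, and prepending a vertex keeps it so. *)
Lemma phi_op_ezh n : allsupp (@dup _)
  (lext (fun ab : oppair n.+1 n => mon (oplist ab)) (phi_op n) - ezh (diagl n)).
Proof.
elim: n => [|n IH].
  rewrite lext0 add0r /diagl [map _ _]/= ezh_cons /ez /= /lconsl /lcons !lext0.
  rewrite addr0 add0r subr0 lextU /shuf2 shufE /corner /= shuf0l shuf0r scaler0 !addr0.
  by rewrite /lcons !lextU; apply: allsuppN; apply: allsuppU.
have D m n' (c : {malg oppair m n'}) :
    lext (fun ab : oppair m.+1 n'.+1 => mon (oplist ab)) (derive c) =
    lcons (0%N, 0%N) (lext (fun s => mon (map shift2 s))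
      (lext (fun ab : oppair m n' => mon (oplist ab)) c)).
  rewrite /derive lextE (eq_lext (g := fun ab : oppair m n' =>
    mon ((derop ab.1, derop ab.2) : oppair m.+1 n'.+1))); last by move=> ab; rewrite monE.
  rewrite !lext_map lcons_lext; apply: eq_lext => ab.
  by rewrite oplist_derop lconsU.
rewrite [phi_op _]/= lextB D lextE.
rewrite (eq_lext (g := fun ab : oppair n.+2 n.+2 =>
  mon ((compop (degop n.+1 0) ab.1, compop (degop n.+1 0) ab.2) : oppair n.+2 n.+1)));
  last by move=> ab; rewrite monE.
rewrite lext_map (eq_lext (g := fun ab : oppair n.+2 n.+2 =>
  lext (fun s => mon (map unshift2 s)) (mon (oplist ab)))); last first.
  by move=> ab; rewrite lextU oplist_degop.
rewrite -lext_lext D ez_diagl.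
rewrite lext_lcons !lext_map.
(* The shift in [derive] is undone by the degeneracy s_0, so their composite merely prepends the
   vertex [(0, 0)]. *)
rewrite (eq_lext (g := fun s => lcons (0%N, 0%N) (mon s))); last first.
  move=> s; rewrite lconsU /= -map_comp; congr (mon (_ :: _)).
  by rewrite map_id_in // => -[].
rewrite -lcons_lext lext_id diaglS ezh_cons.
have -> : ezh (map shift2 (diagl n)) = lext (fun s => mon (map shift2 s)) (ezh (diagl n)).
  exact: (@ezh_map _ _ _ _ succn succn).
set X := lcons _ (ez _); set Y := lext _ _; set Z := lext _ _.
have -> : X - lcons (0%N, 0%N) Y - (X - lcons (0%N, 0%N) Z) =
   - lcons (0%N, 0%N) (Y - Z) by rewrite lconsB; module.
apply: allsuppN; rewrite /Y /Z.
rewrite -(lext_map (fun s => mon (map shift2 s)) (@oplist n.+1 n)) -lextB /lcons lext_lext.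
apply: (allsupp_lext IH) => s ds; rewrite lextU; apply: allsuppU.
by apply: dup_cons; apply: dup_map.
Qed.

Lemma oplist_ok2 m n (ab : oppair m n) : ok2 (oplist ab).
Proof.
rewrite /ok2 /oplist sorted_map; apply: sub_sorted (_ : sorted (relpre val leq) _).
  by move=> i j ij; rewrite /le2 /= !simpop_le.
by rewrite -sorted_map val_enum_ord iota_sorted.
Qed.

Lemma allsupp_ok2 c : allsupp (path le2 (0%N, 0%N)) c -> allsupp ok2 c.
Proof. by move=> H; apply: (allsuppW H) => s; apply: path_sorted. Qed.

Lemma path_ok2 s : ok2 s -> path le2 (0%N, 0%N) s.
Proof. by case: s. Qed.

Lemma ezh_ok2 s : ok2 s -> allsupp ok2 (ezh s).
Proof.
move=> oks; apply: allsupp_ok2.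
exact: (ezh_path leqnn leqnn leq_trans leq_trans (path_ok2 oks)).
Qed.

Lemma shuf_ok2 A B : sorted leq A -> sorted leq B -> allsupp ok2 (shuf A B).
Proof.
move=> sA sB; apply: allsupp_ok2.
have path0 C : sorted leq C -> path leq 0 C by case: C.
exact: (shuf_path (u := (0%N, 0%N)) leqnn leqnn (path0 _ sA) (path0 _ sB)).
Qed.

Lemma diagl_ok2 n : ok2 (diagl n).
Proof. exact: path_sorted (path_diagl n). Qed.

Lemma subst2_diagl s1 s2 m : size s1 = m.+1 -> size s2 = m.+1 ->
  map (subst2 s1 s2 m m) (diagl m) = zip s1 s2.
Proof.
move=> sz1 sz2; rewrite -[in RHS](map_nth_minn sz1) -[in RHS](map_nth_minn sz2).
by rewrite zip_map -map_comp.
Qed.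

Section PairLevel.
Variables K L : sset.

Lemma ezh_face p (x : K p) q (y : L q) m s1 s2 :
  sorted leq s1 -> size s1 = m.+1 -> sorted leq s2 -> size s2 = m.+1 ->
  lext (evp (face x m s1) (face y m s2)) (ezh (diagl m)) =
  lext (evp x y) (ezh (zip s1 s2)).
Proof.
move=> so1 sz1 so2 sz2; rewrite -(subst2_diagl sz1 sz2).
rewrite (ezh_map (fun k => nth 0%N s1 (minn k m)) (fun k => nth 0%N s2 (minn k m))).
rewrite lext_map; apply: (eq_lext_in (ezh_ok2 (diagl_ok2 m))) => r okr.
exact: evp_face.
Qed.

Lemma evp_dup0 p (x : K p) q (y : L q) c :
  allsupp ok2 c -> allsupp (@dup _) c -> lext (evp x y) c = 0.
Proof. by apply: lext_dup0; apply: (evr_dup (pairface_realizes x y)). Qed.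

Lemma phi_nch n (xy : sprod K L n) :
  lext (@phi K L) (nch xy) = lext (evp xy.1 xy.2) (ezh (diagl n)).
Proof.
pose F n (xy : sprod K L n) := lext (evp xy.1 xy.2) (ezh (diagl n)).
apply: (lext_nch (F := F)) => [b|{}n {}xy] /=.
  have E := @phi_op_ezh (tag b).
  have O : allsupp ok2 (lext (fun ab => mon (oplist ab)) (phi_op (tag b))
      - ezh (diagl (tag b))).
    apply: allsuppB; last exact: ezh_ok2 (diagl_ok2 _).
    by apply: allsupp_lext_all => ab; apply: allsuppU; apply: oplist_ok2.
  have /eqP := evp_dup0 (val (tagged b)).1 (val (tagged b)).2 O E.
  rewrite lextB subr_eq0 lext_map /F => /eqP <-.
  rewrite /phi lextE; apply: eq_lext => ab.
  by rewrite evp_oplist nchE.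
case/degenerate_face => m [s [z [ss so ds ->]]].
rewrite /F (@ezh_face _ z.1 _ z.2) //.
have -> : zip s s = [seq (k, k) | k <- s].
  by rewrite -[s in zip s _]map_id -[s in zip _ s]map_id zip_map.
apply: evp_dup0; last by apply: ezh_dup; apply: dup_map.
apply: ezh_ok2; rewrite /ok2 sorted_map; apply: sub_sorted so => i j ij.
by rewrite /le2 /= ij.
Qed.

Lemma phi_evp p (x : K p) q (y : L q) s : ok2 s ->
  lext (@phi K L) (evp x y s) = lext (evp x y) (ezh s).
Proof.
case: s => [|v s] oks; first by rewrite !lext0.
rewrite /evp {1}/evr phi_nch ezh_face ?ok2_unzip1 ?ok2_unzip2 ?size_map //.
by rewrite zip_unzip.
Qed.

Lemma chain_diff_evp p (x : K p) q (y : L q) s : ok2 s ->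
  lext (@chain_diff (sprod K L)) (evp x y s) = lext (evp x y) (bdry s).
Proof. exact: (chain_diff_evr (pairface_realizes x y)). Qed.

Lemma ccop_evp p (x : K p) q (y : L q) s : ok2 s ->
  lext (@ccop (chains (sprod K L))) (evp x y s) =
  lext (fun t => ten (evp x y t.1) (evp x y t.2)) (cop s).
Proof. exact: (ccop_evr (pairface_realizes x y)). Qed.

Lemma aw_evp p (x : K p) q (y : L q) s : ok2 s ->
  lext (@alexander_whitney K L) (evp x y s) =
  lext (fun t => ten (evr (face x) t.1) (evr (face y) t.2)) (aws s).
Proof.
move=> oks; rewrite (alexander_whitney_evr (pair1_realizes x) (pair2_realizes y) oks).
rewrite /aws lext_map; apply: eq_lext => -[t1 t2] /=; congr ten.
  by case: t1 => // v t1; rewrite /evr /= size_map.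
by case: t2 => // v t2; rewrite /evr /= size_map.
Qed.

Definition nab_simplex p (x : K p) q (y : L q) :
    {malg chain_basis (sprod K L)} :=
  lext (evp x y) (shuf (iota 0 p.+1) (iota 0 q.+1)).

Definition nab (bb : gtens (chain_basis K) (chain_basis L)) :
    {malg chain_basis (sprod K L)} :=
  nab_simplex (val (tagged bb.1)) (val (tagged bb.2)).

Lemma nab_face p (x : K p) q (y : L q) m1 m2 A B :
  sorted leq A -> size A = m1.+1 -> sorted leq B -> size B = m2.+1 ->
  nab_simplex (face x m1 A) (face y m2 B) = lext (evp x y) (shuf A B).
Proof.
move=> sA zA sB zB.
rewrite -{2}(map_nth_minn zA) -{2}(map_nth_minn zB) shuf_map lext_map.
apply: (eq_lext_in (shuf_ok2 (iota_sorted _ _) (iota_sorted _ _))) => r okr.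
exact: evp_face.
Qed.

Lemma nab_nch p (x : K p) q (y : L q) :
  lext nab (ten (nch x) (nch y)) = nab_simplex x y.
Proof.
have [dx|[x' <-]] := nchP x.
  rewrite nch_degenerate // ten0l lext0.
  have [m [s [z [ss so ds ->]]]] := degenerate_face dx.
  rewrite -[y]face_iota nab_face ?iota_sorted ?size_iota // evp_dup0 //.
    by apply: shuf_ok2 => //; apply: iota_sorted.
  by apply: shuf_dup; rewrite ds.
have [dy|[y' <-]] := nchP y.
  rewrite (nch_degenerate dy) ten0r lext0.
  have [m [s [z [ss so ds ->]]]] := degenerate_face dy.
  rewrite -[val x']face_iota nab_face ?iota_sorted ?size_iota // evp_dup0 //.
    by apply: shuf_ok2 => //; apply: iota_sorted.
  by apply: shuf_dup; rewrite ds orbT.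
by rewrite !nch_mon tenUU lextU.
Qed.

Lemma nab_evr p (x : K p) q (y : L q) A B : sorted leq A -> sorted leq B ->
  lext nab (ten (evr (face x) A) (evr (face y) B)) = lext (evp x y) (shuf A B).
Proof.
case: A => [|a A] sA sB; first by rewrite ten0l shuf0l !lext0.
case: B sB => [|b B] sB; first by rewrite ten0r shuf0r !lext0.
by rewrite nab_nch nab_face.
Qed.

End PairLevel.

(** * Twisting cochains *)

Section Convolution.
Variables (M R : gbasis).
Variables (cop : M -> {malg (M * M)%type}) (dM : M -> {malg M}).
Variables (m : {malg R} -> {malg R} -> {malg R}) (d : {malg R} -> {malg R}).

(** Signs depend on degrees modulo 2 only. A map of degree -1 then takes values of parity
    [1 + gdeg x], which avoids a predecessor that would be wrong in degree 0. *)
Definition parity (n : nat) : {malg R} -> Prop :=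
  allsupp (fun r => sgn (gdeg r) = sgn n).

Hypothesis m_linl : forall v, linear (fun u => m u v).
Hypothesis m_linr : forall u, linear (m u).
Hypothesis m_assoc : forall u v w, m (m u v) w = m u (m v w).
Hypothesis d_lin : linear d.
Hypothesis d_mul : forall n u v, parity n u ->
  d (m u v) = m (d u) v + sgn n *: m u (d v).

Hypothesis cop_deg : forall x,
  allsupp (fun t => (gdeg t.1 + gdeg t.2)%N = gdeg x) (cop x).
Hypothesis cop_assoc : forall x,
  lext (fun t : M * M => lext (fun u : M * M => mon (u.1, u.2, t.2)) (cop t.1))
    (cop x) =
  lext (fun t : M * M => lext (fun u : M * M => mon (t.1, u.1, u.2)) (cop t.2))
    (cop x).
Hypothesis dM_deg : forall x, allsupp (fun y => (gdeg y).+1 = gdeg x) (dM x).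
Hypothesis dM_cop : forall x, lext cop (dM x) =
  lext (fun t : M * M => lext (fun c => mon (c, t.2)) (dM t.1) +
    sgn (gdeg t.1) *: lext (fun c => mon (t.1, c)) (dM t.2)) (cop x).

Definition mflip v u := m u v.

HB.instance Definition _ v :=
  GRing.isLinear.Build int {malg R} {malg R} *:%R (mflip v) (m_linl v).
HB.instance Definition _ u :=
  GRing.isLinear.Build int {malg R} {malg R} *:%R (m u) (m_linr u).
HB.instance Definition _ :=
  GRing.isLinear.Build int {malg R} {malg R} *:%R d d_lin.

Lemma mDl u u' v : m (u + u') v = m u v + m u' v.
Proof. exact: (linearD (mflip v)). Qed.
Lemma mNl u v : m (- u) v = - m u v.
Proof. exact: (linearN (mflip v)). Qed.
Lemma mZl z u v : m (z *: u) v = z *: m u v.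
Proof. exact: (linearZZ (mflip v)). Qed.
Lemma m0l v : m 0 v = 0.
Proof. exact: (linear0 (mflip v)). Qed.
Lemma mDr u v v' : m u (v + v') = m u v + m u v'.
Proof. exact: linearD. Qed.
Lemma mNr u v : m u (- v) = - m u v.
Proof. exact: linearN. Qed.
Lemma mZr z u v : m u (z *: v) = z *: m u v.
Proof. exact: linearZZ. Qed.
Lemma m0r u : m u 0 = 0.
Proof. exact: linear0. Qed.
Lemma m_lextl (T : choiceType) (f : T -> {malg R}) c v :
  m (lext f c) v = lext (fun x => m (f x) v) c.
Proof. exact: (lext_comp (mflip v)). Qed.
Lemma m_lextr (T : choiceType) (f : T -> {malg R}) c v :
  m v (lext f c) = lext (fun x => m v (f x)) c.
Proof. exact: lext_comp. Qed.
Lemma d_lext (T : choiceType) (f : T -> {malg R}) c :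
  d (lext f c) = lext (fun x => d (f x)) c.
Proof. exact: lext_comp. Qed.

Implicit Types a b c : M -> {malg R}.

(* [e] stands for the degree of [b] modulo 2. *)
Definition cup (e : nat) a b (x : M) : {malg R} :=
  lext (fun t : M * M => sgn (e * gdeg t.1) *: m (a t.1) (b t.2)) (cop x).

Lemma eq_cup e a a' b b' x : a =1 a' -> b =1 b' -> cup e a b x = cup e a' b' x.
Proof. by move=> aa' bb'; apply: eq_lext => t; rewrite aa' bb'. Qed.

Lemma cupDl e a a' b x :
  cup e (fun y => a y + a' y) b x = cup e a b x + cup e a' b x.
Proof. by rewrite -lextDf; apply: eq_lext => t; rewrite mDl scalerDr. Qed.

Lemma cupDr e a b b' x :
  cup e a (fun y => b y + b' y) x = cup e a b x + cup e a b' x.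
Proof. by rewrite -lextDf; apply: eq_lext => t; rewrite mDr scalerDr. Qed.

Lemma cupNl e a b x : cup e (fun y => - a y) b x = - cup e a b x.
Proof. by rewrite -lextNf; apply: eq_lext => t; rewrite mNl scalerN. Qed.

Lemma cupNr e a b x : cup e a (fun y => - b y) x = - cup e a b x.
Proof. by rewrite -lextNf; apply: eq_lext => t; rewrite mNr scalerN. Qed.

Lemma cupA e1 e2 a b c x :
  cup e2 (cup e1 a b) c x = cup (e1 + e2) a (cup e2 b c) x.
Proof.
pose h (t : M * M * M) := (sgn ((e1 + e2) * gdeg t.1.1) * sgn (e2 * gdeg t.1.2)) *:
  m (a t.1.1) (m (b t.1.2) (c t.2)).
transitivity (lext h (lext (fun t : M * M =>
    lext (fun u : M * M => mon (u.1, u.2, t.2)) (cop t.1)) (cop x))).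
  rewrite lext_lext; apply: eq_lext => t; rewrite lext_map /cup m_lextl -lextZf.
  apply: (eq_lext_in (@cop_deg t.1)) => u tu; rewrite /h /= mZl scalerA m_assoc.
  congr (_ *: _); rewrite -tu -!sgnD; congr sgn.
  by rewrite mulnDl mulnDr; lia.
rewrite cop_assoc lext_lext; apply: eq_lext => t.
rewrite lext_map /cup m_lextr -lextZf; apply: eq_lext => u.
by rewrite /h /= mZr scalerA.
Qed.

(* The differential of the map [a], whose degree modulo 2 is [p]. *)
Definition der (p : nat) a (x : M) : {malg R} :=
  d (a x) - sgn p *: lext a (dM x).

(** The Leibniz rule for the cup product, solved for [d]; [e.+1] is the parity of [der e b]. *)
Lemma der_cup p e a b x : (forall y, parity (p + gdeg y) (a y)) ->
  d (cup e a b x) = cup e (der p a) b x + sgn p *: cup e.+1 a (der e b) x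
    + sgn (p + e) *: lext (cup e a b) (dM x).
Proof.
move=> pa; rewrite /cup -(lext_lext _ cop) dM_cop lext_lext d_lext.
rewrite -!lextZf -!lextDf; apply: eq_lext => t.
have -> : d (sgn (e * gdeg t.1) *: m (a t.1) (b t.2)) =
    sgn (e * gdeg t.1) *: d (m (a t.1) (b t.2)) by exact: linearZZ.
rewrite (d_mul _ (pa t.1)) lextD lextZ !lext_map.
have -> : lext (fun y => sgn (e * gdeg (y, t.2).1) *: m (a (y, t.2).1) (b (y, t.2).2))
    (dM t.1) = (sgn (e * gdeg t.1) * sgn e) *: m (lext a (dM t.1)) (b t.2).
  rewrite m_lextl -lextZf; apply: (eq_lext_in (@dM_deg t.1)) => y yt /=.
  by rewrite -yt mulnS addnC sgnD -mulrA sgn_sqr mulr1.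
have -> : lext (fun y => sgn (e * gdeg (t.1, y).1) *: m (a (t.1, y).1) (b (t.1, y).2))
    (dM t.2) = sgn (e * gdeg t.1) *: m (a t.1) (lext b (dM t.2)).
  by rewrite m_lextr -lextZf.
rewrite /der mDl mDr mNl mNr mZl mZr mulSn !sgnD.
by case: (sgn_cases p) => ->; case: (sgn_cases e) => ->; module.
Qed.

Hypothesis no1 : forall x : M, gdeg x != 1%N.

(** Makes the recursions through phi well founded. A factor that vanishes in degree 0 takes up at
    least two degrees, as there is no degree 1, and phi has raised the degree by one only; so the
    remaining factor is evaluated strictly below the argument of phi. *)
Lemma cup_eql e a a' b x : (forall y, gdeg y = 0%N -> b y = 0) ->
  (forall y, ((gdeg y).+1 < gdeg x)%N -> a y = a' y) ->
  cup e a b x = cup e a' b x.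
Proof.
move=> b0 aa'; apply: (eq_lext_in (@cop_deg x)) => t tx.
have [t0|t1] := posnP (gdeg t.2); first by rewrite b0 // !m0r.
rewrite aa' // -tx; have := no1 t.2; lia.
Qed.

Lemma cup_eqr e a b b' x : (forall y, gdeg y = 0%N -> a y = 0) ->
  (forall y, ((gdeg y).+1 < gdeg x)%N -> b y = b' y) ->
  cup e a b x = cup e a b' x.
Proof.
move=> a0 bb'; apply: (eq_lext_in (@cop_deg x)) => t tx.
have [t0|t1] := posnP (gdeg t.1); first by rewrite a0 // !m0l.
rewrite bb' // -tx; have := no1 t.1; lia.
Qed.

Lemma cup0l e b x : cup e (fun=> 0) b x = 0.
Proof.
rewrite /cup (eq_lext (g := fun=> 0)) ?lext0f // => t.
by rewrite m0l scaler0.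
Qed.

Lemma cup0r e a x : cup e a (fun=> 0) x = 0.
Proof.
rewrite /cup (eq_lext (g := fun=> 0)) ?lext0f // => t.
by rewrite m0r scaler0.
Qed.

Section Transfer.
Variables (N : gbasis) (copN : N -> {malg (N * N)%type}) (dN : N -> {malg N}).
Variables (phi : M -> {malg M}) (aw : M -> {malg N}) (nab : N -> {malg M}).
Hypothesis phi_deg : forall x, allsupp (fun y => gdeg y = (gdeg x).+1) (phi x).
Hypothesis phi0 : forall x, gdeg x = 0%N -> phi x = 0.
Hypothesis nab_deg : forall u, allsupp (fun y => gdeg y = gdeg u) (nab u).
Hypothesis nab_cop : forall u, lext cop (nab u) =
  lext (fun t : N * N => ten (nab t.1) (nab t.2)) (copN u).
Hypothesis aw_nab : forall u, lext aw (nab u) = mon u.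
Hypothesis phi_nab : forall u, lext phi (nab u) = 0.
Hypothesis phi_homotopy : forall x,
  lext dM (phi x) + lext phi (dM x) = lext nab (aw x) - mon x.
Hypothesis aw_dM : forall x, lext aw (dM x) = lext dN (aw x).

Definition cupN (e : nat) (a b : N -> {malg R}) (u : N) : {malg R} :=
  lext (fun t : N * N => sgn (e * gdeg t.1) *: m (a t.1) (b t.2)) (copN u).

(** Restriction along a degree-preserving map of coalgebras respects cup products; [cup_pullback] is
    another instance. *)
Lemma cup_nab e a b u :
  lext (cup e a b) (nab u) =
  cupN e (fun v => lext a (nab v)) (fun v => lext b (nab v)) u.
Proof.
rewrite /cup -(lext_lext _ cop) nab_cop lext_lext; apply: eq_lext => t.
rewrite lext_ten m_lextl -lextZf; apply: (eq_lext_in (@nab_deg t.1)) => y <-.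
by rewrite m_lextr -lextZf.
Qed.

Lemma eq_cupN e (a a' b b' : N -> {malg R}) u : a =1 a' -> b =1 b' ->
  cupN e a b u = cupN e a' b' u.
Proof. by move=> aa' bb'; apply: eq_lext => t; rewrite aa' bb'. Qed.

(* The error [e = D t - t u t] satisfies [e = (t u e - e u t) phi], so it
   vanishes by induction on the degree. *)
Theorem transfer_twisting (alpha : N -> {malg R}) t :
  (forall u, d (alpha u) + lext alpha (dN u) = cupN 1 alpha alpha u) ->
  (forall x, t x = lext alpha (aw x) - lext (cup 1 t t) (phi x)) ->
  (forall x, parity (1 + gdeg x) (t x)) ->
  (forall x, gdeg x = 0%N -> t x = 0) ->
  (forall u, lext t (nab u) = alpha u) /\
  (forall x, der 1 t x = cup 1 t t x).
Proof.
move=> Dalpha tE tpar t0.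
have tnab u : lext t (nab u) = alpha u.
  transitivity (lext alpha (lext aw (nab u)) - lext (cup 1 t t) (lext phi (nab u))).
    by rewrite !lext_lext -lextBf; apply: eq_lext.
  by rewrite aw_nab phi_nab lext0 subr0 lextU.
split=> // x.
pose E x := der 1 t x - cup 1 t t x.
have tDE y : der 1 t y = E y + cup 1 t t y by rewrite /E addrNK.
have EE y : E y = - lext (fun z => cup 1 E t z - cup 2 t E z) (phi y).
  (* With [der 1 t] written as [E] plus the cup square of [t], the two triple products given by the
     Leibniz rule cancel by associativity. *)
  have D z : d (cup 1 t t z) =
      cup 1 E t z - cup 2 t E z + lext (cup 1 t t) (dM z).
    rewrite (der_cup 1 t z tpar).
    rewrite (eq_cup (a' := fun w => E w + cup 1 t t w) (b' := t) _ _ tDE) //.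
    rewrite [cup 2 t (der 1 t) z](eq_cup (a' := t)
      (b' := fun w => E w + cup 1 t t w) _ _ _ tDE) //.
    by rewrite cupDl cupDr cupA /sgn expr1 /=; module.
  rewrite {1}/E /der tE.
  have -> : d (lext alpha (aw y) - lext (cup 1 t t) (phi y)) =
      lext (fun u => d (alpha u)) (aw y) - lext (fun z => d (cup 1 t t z)) (phi y).
    by rewrite -!d_lext; exact: linearB.
  rewrite (eq_lext _ D) lextDf -lext_lext.
  rewrite (eq_lext (f := fun u => d (alpha u))
    (g := fun u => cupN 1 alpha alpha u - lext alpha (dN u))); last first.
    by move=> u; rewrite -Dalpha addrK.
  rewrite lextBf -(lext_lext alpha dN) -aw_dM.
  have -> : lext t (dM y) = lext alpha (lext aw (dM y)) -
      lext (cup 1 t t) (lext phi (dM y)).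
    by rewrite !lext_lext -lextBf; apply: eq_lext.
  (* On the image of nabla, [t] is [alpha]. The cup square of [alpha] thus becomes that of [t] on
     nabla f, to which the homotopy identity applies. *)
  have -> : lext (cupN 1 alpha alpha) (aw y) =
      lext (cup 1 t t) (lext nab (aw y)).
    rewrite lext_lext; apply: eq_lext => u; rewrite cup_nab.
    by apply: eq_cupN => v; rewrite tnab.
  have -> : lext nab (aw y) = lext dM (phi y) + lext phi (dM y) + mon y.
    by rewrite phi_homotopy addrNK.
  by rewrite !lextD lextU /sgn expr1; module.
suff E0 : E x = 0 by rewrite tDE E0 add0r.
move: {2}(gdeg x).+1 (ltnSn (gdeg x)) => n.
elim: n x => // n IH x; rewrite ltnS => xn; rewrite EE.
apply/eqP; rewrite oppr_eq0; apply/eqP.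
apply: (lext_eq0_in (@phi_deg x)) => y yx.
rewrite (cup_eql 1 (a' := fun=> 0) t0) => [|z zy]; last first.
  by apply: IH; apply: leq_trans xn; rewrite yx ltnS in zy.
rewrite (cup_eqr 2 (b' := fun=> 0) t0) => [|z zy]; last first.
  by apply: IH; apply: leq_trans xn; rewrite yx ltnS in zy.
by rewrite cup0l cup0r subr0.
Qed.

Section Homotopy.
Variables t t' : M -> {malg R}.
Hypothesis t_twist : forall x, der 1 t x = cup 1 t t x.
Hypothesis t'_twist : forall x, der 1 t' x = cup 1 t' t' x.
Hypothesis t_deg : forall x, allsupp (fun r => (gdeg r).+1 = gdeg x) (t x).
Hypothesis t'_deg : forall x, allsupp (fun r => (gdeg r).+1 = gdeg x) (t' x).
Hypothesis tt'_nab : forall u, lext t (nab u) = lext t' (nab u).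

Lemma deg_parity (s : M -> {malg R}) :
  (forall x, allsupp (fun r => (gdeg r).+1 = gdeg x) (s x)) ->
  forall x, parity (1 + gdeg x) (s x).
Proof.
by move=> sd x; apply: (allsuppW (@sd x)) => r <-; rewrite !sgnS opprK.
Qed.

Lemma deg_zero (s : M -> {malg R}) :
  (forall x, allsupp (fun r => (gdeg r).+1 = gdeg x) (s x)) ->
  forall x, gdeg x = 0%N -> s x = 0.
Proof.
by move=> sd x x0; rewrite -(lext_id (s x)); apply: (lext_eq0_in (@sd x)) => r; rewrite x0.
Qed.

Definition homotopy_rhs (H : M -> {malg R}) x :=
  t x - t' x - cup 1 H t' x + cup 0 t H x.

(** The index is fuel: the value at [x] calls the function only in degrees below that of [x], so
    [(gdeg x).+1] rounds suffice. *)
Fixpoint homotopy_rec n : M -> {malg R} :=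
  if n is n'.+1 then fun x => lext (homotopy_rhs (homotopy_rec n')) (phi x)
  else fun=> 0.

Definition homotopy x := homotopy_rec (gdeg x).+1 x.

Lemma homotopy_rec_stable n x : (gdeg x < n)%N -> homotopy_rec n x = homotopy x.
Proof.
suff H k : forall y n1 n2, (gdeg y < k)%N -> (gdeg y < n1)%N -> (gdeg y < n2)%N ->
    homotopy_rec n1 y = homotopy_rec n2 y.
  by move=> xn; apply: (H (gdeg x).+1).
elim: k => // k IH y [//|n1] [//|n2]; rewrite !ltnS => yk yn1 yn2 /=.
apply: (eq_lext_in (@phi_deg y)) => z zy; rewrite /homotopy_rhs.
have K w : ((gdeg w).+1 < gdeg z)%N -> homotopy_rec n1 w = homotopy_rec n2 w.
  rewrite zy ltnS => wy.
  by apply: IH; [exact: leq_trans yk | exact: leq_trans yn1 | exact: leq_trans yn2].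
rewrite (cup_eql 1 (a' := homotopy_rec n2) (deg_zero t'_deg) K).
by rewrite (cup_eqr 0 (b' := homotopy_rec n2) (deg_zero t_deg) K).
Qed.

Lemma homotopyE x : homotopy x = lext (homotopy_rhs homotopy) (phi x).
Proof.
rewrite {1}/homotopy /=; apply: (eq_lext_in (@phi_deg x)) => z zx.
have K w : ((gdeg w).+1 < gdeg z)%N -> homotopy_rec (gdeg x) w = homotopy w.
  by rewrite zx ltnS => wx; apply: homotopy_rec_stable.
rewrite /homotopy_rhs (cup_eql 1 (a' := homotopy) (deg_zero t'_deg) K).
by rewrite (cup_eqr 0 (b' := homotopy) (deg_zero t_deg) K).
Qed.

Lemma homotopy0 x : gdeg x = 0%N -> homotopy x = 0.
Proof. by move=> x0; rewrite homotopyE phi0 // lext0. Qed.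

Hypothesis m_deg : forall k l u v, homog k u -> homog l v -> homog (k + l) (m u v).

Lemma homotopy_deg x : homog (gdeg x) (homotopy x).
Proof.
suff H k : forall x, (gdeg x < k)%N -> homog (gdeg x) (homotopy x).
  exact: (H (gdeg x).+1).
elim: k => // k IH {}x; rewrite ltnS => xk; rewrite homotopyE.
apply: (allsupp_lext (@phi_deg x)) => z zx.
have tz (s : M -> {malg R}) : (forall x, allsupp (fun r => (gdeg r).+1 = gdeg x) (s x)) ->
    homog (gdeg x) (s z).
  by move=> sd; apply: (allsuppW (@sd z)) => r; rewrite zx => -[].
have KH w : ((gdeg w).+1 < gdeg z)%N -> homog (gdeg w) (homotopy w).
  by rewrite zx ltnS => wx; apply: IH; apply: leq_trans xk.
(* The induction hypothesis covers only the degrees that occur in the cup products. Cutting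
   [homotopy] off outside them leaves these products unchanged and gives a map that is homogeneous
   everywhere. *)
pose H' w := if ((gdeg w).+1 < gdeg z)%N then homotopy w else 0.
have HH' w : ((gdeg w).+1 < gdeg z)%N -> homotopy w = H' w by rewrite /H' => ->.
have H'deg w : homog (gdeg w) (H' w).
  by rewrite /H'; case: ifP => [/KH|_] //; apply: allsupp0.
rewrite /homotopy_rhs (cup_eql 1 (deg_zero t'_deg) HH').
rewrite (cup_eqr 0 (deg_zero t_deg) HH').
have sdeg (s : M -> {malg R}) w : (forall x, allsupp (fun r => (gdeg r).+1 = gdeg x) (s x)) ->
    homog (gdeg w).-1 (s w).
  by move=> sd; apply: (allsuppW (@sd w)) => r <-.
apply: allsuppD; first apply: allsuppB; first by apply: allsuppB; apply: tz.
  apply: (allsupp_lext (@cop_deg z)) => u uz; apply: allsuppZ.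
  have [u0|u1] := posnP (gdeg u.2).
    by rewrite (deg_zero t'_deg u0) m0r; apply: allsupp0.
  have -> : gdeg x = (gdeg u.1 + (gdeg u.2).-1)%N.
    by move: uz; rewrite zx -(prednK u1) addnS => -[].
  by apply: m_deg; [exact: H'deg | exact: sdeg].
apply: (allsupp_lext (@cop_deg z)) => u uz; apply: allsuppZ.
have [u0|u1] := posnP (gdeg u.1).
  by rewrite (deg_zero t_deg u0) m0l; apply: allsupp0.
have -> : gdeg x = ((gdeg u.1).-1 + gdeg u.2)%N.
  by move: uz; rewrite zx -(prednK u1) addSn => -[].
by apply: m_deg; [exact: sdeg | exact: H'deg].
Qed.

(* Same mechanism as for [transfer_twisting]: the error [e] satisfies
   [e = - (e u t' + t u e) phi]. *)
Theorem homotopy_eq x : der 0 homotopy x = homotopy_rhs homotopy x.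
Proof.
set H := homotopy; set X := homotopy_rhs H.
have Hpar y : parity (0 + gdeg y) (H y).
  by apply: (allsuppW (@homotopy_deg y)) => r ->.
pose E x := der 0 H x - X x.
have HDE y : der 0 H y = E y + X y by rewrite /E addrNK.
have Hnab u : lext H (nab u) = 0.
  by rewrite (eq_lext _ homotopyE) -lext_lext phi_nab lext0.
(* On the image of nabla [t] and [t'] coincide and [H] vanishes, the latter because phi nabla =
   0. *)
have Xnab u : lext X (nab u) = 0.
  rewrite /X /homotopy_rhs lextDf !lextBf tt'_nab subrr !cup_nab.
  rewrite (@eq_cupN 1 _ (fun=> 0) _ _ u Hnab (frefl _)).
  rewrite (@eq_cupN 0 _ _ _ (fun=> 0) u (frefl _) Hnab).
  rewrite /cupN (eq_lext (g := fun=> 0)) => [|w]; last by rewrite m0l scaler0.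
  rewrite [X in _ + X](eq_lext (g := fun=> 0)) => [|w]; last by rewrite m0r scaler0.
  by rewrite !lext0f subr0 addr0.
(* Insert the twisting equations and [HDE] into the Leibniz rule: all products without a factor [E]
   cancel by associativity. *)
have DX y : d (X y) = - (cup 1 E t' y + cup 1 t E y) - lext X (dM y).
  have dE (s : M -> {malg R}) z : der 1 s z = d (s z) + lext s (dM z).
    by rewrite /der /sgn expr1 scaleN1r opprK.
  have -> : d (X y) = d (t y) - d (t' y) - d (cup 1 H t' y) + d (cup 0 t H y).
    rewrite /X /homotopy_rhs.
    by rewrite (linearD d) !(linearB d).
  rewrite (der_cup 1 t' y Hpar) (der_cup 0 H y (deg_parity t_deg)).
  rewrite (@eq_cup 1 _ _ _ _ y HDE (frefl t')).
  rewrite (@eq_cup 2 _ _ _ _ y (frefl H) t'_twist).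
  rewrite (@eq_cup 0 _ _ _ _ y t_twist (frefl H)).
  rewrite (@eq_cup 1 _ _ _ _ y (frefl t) HDE).
  have -> : d (t y) = cup 1 t t y - lext t (dM y).
    by rewrite -t_twist dE addrK.
  have -> : d (t' y) = cup 1 t' t' y - lext t' (dM y).
    by rewrite -t'_twist dE addrK.
  rewrite cupDl cupDr /X /homotopy_rhs !lextDf !lextNf.
  rewrite !(cupDl, cupDr, cupNl, cupNr).
  rewrite !cupA /sgn !expr1 expr0 /=.
  by module.
have EE y : E y = - lext (fun z => cup 1 E t' z + cup 1 t E z) (phi y).
  rewrite {1}/E /der sgn0 scale1r /H homotopyE -/H -/X d_lext (eq_lext _ DX).
  rewrite lextBf lextNf -lext_lext.
  have -> : lext H (dM y) = lext X (lext phi (dM y)).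
    by rewrite lext_lext; apply: eq_lext => z; apply: homotopyE.
  (* As [X] vanishes on the image of nabla, the homotopy identity determines [X y] from its values
     on d phi and phi d. *)
  have : lext X (lext nab (aw y)) = 0.
    by rewrite lext_lext (eq_lext _ Xnab) lext0f.
  have -> : lext nab (aw y) = lext dM (phi y) + lext phi (dM y) + mon y.
    by rewrite phi_homotopy addrNK.
  rewrite !lextD lextU => /eqP; rewrite addr_eq0 => /eqP K.
  have -> : lext X (lext dM (phi y)) = - X y - lext X (lext phi (dM y)).
    by rewrite -K addrK.
  by module.
suff E0 : E x = 0 by rewrite HDE E0 add0r.
move: {2}(gdeg x).+1 (ltnSn (gdeg x)) => n.
elim: n x => // n IH x; rewrite ltnS => xn; rewrite EE.
apply/eqP; rewrite oppr_eq0; apply/eqP.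
apply: (lext_eq0_in (@phi_deg x)) => y yx.
rewrite (cup_eql 1 (a' := fun=> 0) (deg_zero t'_deg)) => [|z zy]; last first.
  by apply: IH; apply: leq_trans xn; rewrite yx ltnS in zy.
rewrite (cup_eqr 1 (b' := fun=> 0) (deg_zero t_deg)) => [|z zy]; last first.
  by apply: IH; apply: leq_trans xn; rewrite yx ltnS in zy.
by rewrite cup0l cup0r addr0.
Qed.

End Homotopy.
End Transfer.
End Convolution.

(** * Normalized chains *)

Lemma evr_sorted_sub (r s : seq nat) : subseq r s -> sorted leq s -> sorted leq r.
Proof. exact: (subseq_sorted leq_trans). Qed.

Section ChainCoalgebra.
Variable S : sset.
Local Notation C := (chains S).

(** Each basis simplex is its own face along [iota]. The structure maps thus become evaluations of
    list operations, and the coalgebra laws are transported from lists. *)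
Lemma evr_iota (b : chain_basis S) :
  evr (face (val (tagged b))) (iota 0 (tag b).+1) = mon b.
Proof. by rewrite (evrE _ (size_iota _ _)) face_iota nch_basis. Qed.

Lemma cdiff_iota (b : C) : cdiff b =
  lext (evr (face (val (tagged b)))) (bdry (iota 0 (tag b).+1)).
Proof.
rewrite -(chain_diff_evr (face_realizes _) (iota_sorted _ _)) evr_iota.
by rewrite lextU.
Qed.

Lemma ccop_iota (b : C) : ccop b =
  lext (fun t => ten (evr (face (val (tagged b))) t.1)
                     (evr (face (val (tagged b))) t.2)) (cop (iota 0 (tag b).+1)).
Proof.
rewrite -(ccop_evr (face_realizes _) (iota_sorted _ _)) evr_iota.
by rewrite lextU.
Qed.

Lemma ccop_deg (x : C) :
  allsupp (fun t => (gdeg t.1 + gdeg t.2)%N = gdeg x) (ccop x).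
Proof.
rewrite ccop_iota; apply: (allsupp_lext (@cop_size _ _)) => t.
rewrite size_iota => -[t1 [t2 tt]].
apply: (allsuppW (allsupp_ten (@homog_evr _ _ _ t.1) (@homog_evr _ _ _ t.2))).
move=> u [-> ->]; move: tt; rewrite -(prednK t1) -(prednK t2) addSn addnS.
by case.
Qed.

Lemma cdiff_deg (x : C) : allsupp (fun y => (gdeg y).+1 = gdeg x) (cdiff x).
Proof.
rewrite cdiff_iota; apply: (allsupp_lext (@bdry_size _ _)) => r.
rewrite size_iota => -[rx].
case: r rx => [|v r] rx; first exact: allsupp0.
by apply: (allsuppW (@homog_evr _ _ _ (v :: r))) => y ->.
Qed.

Lemma lext_ten_assocl (A : choiceType) (f : A -> {malg (A * A)%type}) c c' :
  lext (fun t : A * A => lext (fun u : A * A => mon (u.1, u.2, t.2)) (f t.1))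
    (ten c c') = ten (lext f c) c'.
Proof.
rewrite lext_ten ten_lextl; apply: eq_lext => a.
rewrite ten_lextC; apply: eq_lext => b; apply: eq_lext => u.
by rewrite -surjective_pairing.
Qed.

Lemma lext_ten_assocr (A : choiceType) (c c1 c2 : {malg A}) :
  lext (fun a : A => lext (fun u : A * A => mon (a, u.1, u.2)) (ten c1 c2)) c =
  ten (ten c c1) c2.
Proof.
rewrite [RHS]ten_lextE lext_ten; apply: eq_lext => a.
by rewrite lext_ten.
Qed.

Lemma ccopA (x : C) :
  lext (fun t : C * C => lext (fun u : C * C => mon (u.1, u.2, t.2)) (ccop t.1))
    (ccop x) =
  lext (fun t : C * C => lext (fun u : C * C => mon (t.1, u.1, u.2)) (ccop t.2))
    (ccop x).
Proof.
set r := face (val (tagged x)); set l := iota 0 (tag x).+1.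
have sl : sorted leq l by apply: iota_sorted.
have rP := face_realizes (val (tagged x)).
pose tri (t : seq nat * seq nat * seq nat) :=
  ten (ten (evr r t.1.1) (evr r t.1.2)) (evr r t.2).
rewrite ccop_iota.
rewrite -/r -/l.
rewrite [LHS]lext_lext [RHS]lext_lext.
transitivity (lext tri (lext (@cop_l _) (cop l))).
  rewrite lext_lext; apply: (eq_lext_in (@cop_subseq _ l)) => t [t1 t2].
  rewrite (lext_ten_assocl (@ccop C)) (ccop_evr rP (evr_sorted_sub t1 sl)).
  by rewrite lext_map ten_lextl.
rewrite copA lext_lext; apply: (eq_lext_in (@cop_subseq _ l)) => t [t1 t2].
rewrite lext_map lext_ten.
transitivity (lext (fun a : C => lext (fun u : C * C => mon (a, u.1, u.2))
   (lext (@ccop C) (evr r t.2))) (evr r t.1)).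
  rewrite (ccop_evr rP (evr_sorted_sub t2 sl)).
  rewrite [RHS](eq_lext (g := fun a => lext (fun s : seq nat * seq nat =>
    lext (fun u : C * C => mon (a, u.1, u.2)) (ten (evr r s.1) (evr r s.2)))
    (cop t.2))) => [|a]; last by rewrite lext_lext.
  rewrite lext_exchange; apply: eq_lext => s.
  by rewrite (lext_ten_assocr (evr r t.1)).
by apply: eq_lext => a; rewrite lext_lext.
Qed.

Lemma cdiff_cop (x : C) : lext (@ccop C) (cdiff x) =
  lext (fun t : C * C => lext (fun c => mon (c, t.2)) (cdiff t.1) +
    sgn (gdeg t.1) *: lext (fun c => mon (t.1, c)) (cdiff t.2)) (ccop x).
Proof.
set r := face (val (tagged x)); set l := iota 0 (tag x).+1.
have sl : sorted leq l by apply: iota_sorted.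
have rP := face_realizes (val (tagged x)).
pose E (t : seq nat * seq nat) := ten (evr r t.1) (evr r t.2).
rewrite cdiff_iota ccop_iota -/r -/l -/E !lext_lext.
transitivity (lext E (lext (@bdry2 _) (cop l))).
  rewrite lext_bdry2_cop (_ : nilp l = false); last by [].
  cbv iota; rewrite [RHS]lextD.
  rewrite [lext E (mon _ + _)]lextD [lext E (_ *: _)]lextZ !lextU.
  (* Both augmentation terms contain an empty list, which evaluates to 0. *)
  rewrite /E ten0l ten0r scaler0 !addr0 lext_lext.
  apply: (eq_lext_in (@bdry_subseq _ l)) => s sl'.
  exact: (ccop_evr rP (evr_sorted_sub sl' sl)).
rewrite lext_lext; apply: (eq_lext_in (@cop_subseq _ l)) => t [t1 t2].
rewrite /bdry2 lextD lextZ !lext_map /E lext_ten.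
rewrite (eq_lext_in (@homog_evr _ _ _ t.1) (g := fun a =>
  lext (fun b => lext (fun c => mon (c, b)) (@cdiff C a)) (evr r t.2) +
  sgn (size t.1).-1 *: lext (fun b => lext (fun c => mon (a, c)) (@cdiff C b))
    (evr r t.2))); last by move=> a <-; rewrite lextDf lextZf.
rewrite lextDf lextZf; congr (_ + _ *: _).
  rewrite -[LHS]/(lext (fun s => ten (evr r s) (evr r t.2)) (bdry t.1)).
  rewrite -ten_lextl -(chain_diff_evr rP (evr_sorted_sub t1 sl)) ten_lextl.
  by apply: eq_lext => a; rewrite ten_lextC.
rewrite -[LHS]/(lext (fun s => ten (evr r t.1) (evr r s)) (bdry t.2)).
rewrite -ten_lextr -(chain_diff_evr rP (evr_sorted_sub t2 sl)) ten_lextE.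
by apply: eq_lext => a; rewrite lext_lext.
Qed.

(** The counit takes the value 1 on every vertex; in the list calculus it detects lists of length
    one. *)
Lemma counit_evr (r : forall m, seq nat -> S m) (B : choiceType)
    (z : {malg B}) s : s != [::] ->
  lext (fun a => if gdeg a == 0%N then z else 0) (evr r s) =
  if (size s == 1)%N then z else 0.
Proof.
case: s => [//|v s] _; case: s => [|w s].
  have [//|[y yE]] := nchP (r 0%N [:: v]).
  by rewrite /evr -yE nch_mon lextU.
by apply: (lext_eq0_in (@homog_evr _ _ r [:: v, w & s])) => a ->.
Qed.

Lemma ccop_counitl (x : C) :
  lext (fun t : C * C => if gdeg t.1 == 0%N then mon t.2 else 0) (ccop x) = mon x.
Proof.
rewrite ccop_iota lext_lext -[RHS]evr_iota.
set r := face _; set l := iota _ _.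
transitivity (lext (evr r) (lext (fun t : seq nat * seq nat =>
  if (size t.1 == 1)%N then mon t.2 else 0) (cop l))).
  rewrite lext_lext; apply: (eq_lext_in (@cop_size _ l)) => -[t1 t2] [t1P _].
  rewrite lext_tenC; transitivity (lext (fun b =>
      if (size t1 == 1)%N then mon b else 0) (evr r t2)).
    by apply: eq_lext => b; apply: (@counit_evr r _ (mon b) t1); case: (t1) t1P.
  rewrite [(_, _).1]/=; case: ifP => _; first by rewrite lext_id lextU.
  by rewrite lext0f lext0.
rewrite (_ : lext _ (cop l) = mon l) ?lextU // [cop l]/= lextD lextU lext_lconsl.
rewrite (lext_eq0_in (@cop_size _ _)) ?addr0 // => t [t1 _].
by rewrite /= eqSS (gtn_eqF t1).
Qed.

Lemma ccop_counitr (x : C) :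
  lext (fun t : C * C => if gdeg t.2 == 0%N then mon t.1 else 0) (ccop x) = mon x.
Proof.
rewrite ccop_iota lext_lext -[RHS]evr_iota.
set r := face _; set l := iota _ _.
transitivity (lext (evr r) (lext (fun t : seq nat * seq nat =>
  if (size t.2 == 1)%N then mon t.1 else 0) (cop l))).
  rewrite lext_lext; apply: (eq_lext_in (@cop_size _ l)) => -[t1 t2] [_ [t2P _]].
  rewrite lext_ten; transitivity (lext (fun a =>
      if (size t2 == 1)%N then mon a else 0) (evr r t1)).
    by apply: eq_lext => a; apply: (@counit_evr r _ (mon a) t2); case: (t2) t2P.
  rewrite [(_, _).2]/=; case: ifP => _; first by rewrite lext_id lextU.
  by rewrite lext0f lext0.
suff E (V : choiceType) (v : V) s : lext (fun t : seq V * seq V =>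
    if (size t.2 == 1)%N then mon t.1 else 0) (cop (v :: s)) = mon (v :: s).
  by rewrite (E _ 0%N (iota 1 (tag x))) lextU.
elim: s v => [|w s IH] v.
  by rewrite /= /lconsl lext0 addr0 lextU.
rewrite [cop _]/= -[_ + lconsl w _]/(cop (w :: s)) lextD lextU add0r lext_lconsl.
rewrite -lconsU -IH lcons_lext; apply: eq_lext => t.
by case: ifP => _; rewrite ?lcons0 ?lconsU.
Qed.

End ChainCoalgebra.

(** * Chain maps induced by simplicial maps *)

Section Pushforward.
Variables (S S' : sset) (g : forall n, S n -> S' n).
Hypothesis g_act : forall m n (a : simpop m n) (x : S n), g (act a x) = act a (g x).

Definition push (b : chain_basis S) : {malg chain_basis S'} :=
  nch (g (val (tagged b))).

Lemma push_nch n (x : S n) : lext push (nch x) = nch (g x).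
Proof.
apply: (lext_nch (F := fun n x => nch (g x))) => // {}n {}x.
case: n x => // n x [i [y ->]]; rewrite g_act; apply: nch_degenerate.
by exists i, (g y).
Qed.

Lemma push_evr (V : choiceType) (rz : forall m, seq V -> S m) s :
  lext push (evr rz s) = evr (fun m s => g (rz m s)) s.
Proof. by case: s => [|v s]; rewrite ?lext0 // push_nch. Qed.

Lemma push_realizes (V : choiceType) (ok : pred (seq V))
    (rz : forall m, seq V -> S m) :
  realizes ok rz -> realizes ok (fun m s => g (rz m s)).
Proof.
move=> [h1 h2]; split=> // l m a s s' oks sm sl s's.
by rewrite -g_act (h2 l m a s s').
Qed.

Let rb (b : chain_basis S) := face (val (tagged b)).

Lemma push_iota b :
  push b = evr (fun m s => g (rb b m s)) (iota 0 (tag b).+1).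
Proof. by rewrite -push_evr evr_iota lextU. Qed.

Lemma push_deg b : homog (gdeg b) (push b).
Proof. exact: homog_nch. Qed.

Lemma push_cdiff (b : chains S) :
  lext (@cdiff (chains S')) (push b) = lext push (cdiff b).
Proof.
rewrite push_iota cdiff_iota lext_lext.
have hr := push_realizes (face_realizes (val (tagged b))).
rewrite (chain_diff_evr hr (iota_sorted _ _)).
by apply: eq_lext => s; rewrite push_evr.
Qed.

Lemma push_ccop (b : chains S) :
  lext (@ccop (chains S')) (push b) =
  lext (fun t => ten (push t.1) (push t.2)) (ccop b).
Proof.
rewrite push_iota ccop_iota lext_lext.
have hr := push_realizes (face_realizes (val (tagged b))).
rewrite (ccop_evr hr (iota_sorted _ _)).
by apply: eq_lext => s; rewrite -ten_lext !push_evr.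
Qed.

End Pushforward.

Lemma diag_push (K : sset) (b : chain_basis K) :
  diag b = push (S' := sprod K K) (fun n x => (x, x)) b.
Proof. by rewrite /diag nchE. Qed.

Lemma ten_middle (A A' B B' C C' : choiceType) (f : A * B -> {malg C})
    (f' : A' * B' -> {malg C'}) c1 c2 c3 c4 :
  lext (fun t : (A * A') * (B * B') => ten (f (t.1.1, t.2.1)) (f' (t.1.2, t.2.2)))
    (ten (ten c1 c2) (ten c3 c4)) =
  ten (lext f (ten c1 c3)) (lext f' (ten c2 c4)).
Proof.
rewrite !lext_ten ten_lextl; apply: eq_lext => a1.
rewrite ten_lextl.
rewrite [RHS](eq_lext (g := fun b1 => lext (fun a2 => lext (fun b2 =>
  ten (f (a1, b1)) (f' (a2, b2))) c4) c2)); last first.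
  move=> b1; cbv beta; rewrite ten_lextr; apply: eq_lext => a2.
  by rewrite ten_lextr.
rewrite [RHS]lext_exchange; apply: eq_lext => a2.
by rewrite lext_ten.
Qed.

(** * The Eilenberg-Zilber identities on normalized chains *)

Section PairFacts.
Variables K L : sset.
Local Notation M := (chains (sprod K L)).
Local Notation N := (coalg_tens (chains K) (chains L)).

Lemma ccop_tensE (u : N) : ccop u =
  lext (fun t : (chains K * chains K) * (chains L * chains L) =>
    sgn (gdeg t.1.2 * gdeg t.2.1) *: mon ((t.1.1, t.2.1), (t.1.2, t.2.2)))
    (ten (ccop u.1) (ccop u.2)).
Proof. by rewrite /= tenE lextE; apply: eq_lext => t; rewrite monZE. Qed.

Lemma cdiff_tensE (u : N) : cdiff u =
  ten (cdiff u.1) (mon u.2) + sgn (gdeg u.1) *: ten (mon u.1) (cdiff u.2).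
Proof.
by rewrite /= /tens_diff /tensmap mul0n scale1r mul1n !tenE !monE.
Qed.

Lemma evp_iota (b : M) :
  evp (val (tagged b)).1 (val (tagged b)).2 (diagl (tag b)) = mon b.
Proof. by rewrite evp_diagl -surjective_pairing nch_basis. Qed.

Lemma phi_diagl (b : M) :
  phi b = lext (evp (val (tagged b)).1 (val (tagged b)).2) (ezh (diagl (tag b))).
Proof. by rewrite -(phi_evp _ _ (diagl_ok2 _)) evp_iota lextU. Qed.

Lemma cdiff_diagl (b : M) : cdiff b =
  lext (evp (val (tagged b)).1 (val (tagged b)).2) (bdry (diagl (tag b))).
Proof. by rewrite -(chain_diff_evp _ _ (diagl_ok2 _)) evp_iota lextU. Qed.

Lemma aw_diagl (b : M) : alexander_whitney b =
  lext (fun t => ten (evr (face (val (tagged b)).1) t.1)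
                     (evr (face (val (tagged b)).2) t.2)) (aws (diagl (tag b))).
Proof. by rewrite -(aw_evp _ _ (diagl_ok2 _)) evp_iota lextU. Qed.

Lemma homog_evp p (x : K p) q (y : L q) s :
  allsupp (fun b : M => gdeg b = (size s).-1) (evp x y s).
Proof. exact: homog_evr. Qed.

Lemma phi_deg (b : M) : allsupp (fun c : M => gdeg c = (gdeg b).+1) (phi b).
Proof.
rewrite phi_diagl; apply: (allsupp_lext (@ezh_size _ _ _)) => s.
rewrite size_diagl => sb; apply: (allsuppW (@homog_evp _ _ _ _ s)) => c ->.
by rewrite sb.
Qed.

Lemma phi_deg0 (b : M) : gdeg b = 0%N -> phi b = 0.
Proof.
by move=> b0; rewrite /phi; move: (tagged b); rewrite [tag b]b0 => y; rewrite lextE lext0.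
Qed.

Lemma nab_deg (u : N) : allsupp (fun c : M => gdeg c = gdeg u) (nab u).
Proof.
apply: (allsupp_lext (@shuf_size _ _ _ _)) => s; rewrite !size_iota addSn addnS.
by move=> -[ss]; apply: (allsuppW (@homog_evp _ _ _ _ s)) => c ->; rewrite ss.
Qed.

Lemma phi_nab (u : N) : lext (@phi K L) (nab u) = 0.
Proof.
rewrite lext_lext.
apply: (lext_eq0_in (allsuppI (shuf_ok2 (iota_sorted _ _) (iota_sorted _ _))
  (@shuf_lattice _ _ _ _))) => s [oks ls].
by rewrite phi_evp // evp_dup0 //; [apply: ezh_ok2 | apply: ezh_lattice].
Qed.

Lemma bdry_ok2 s : ok2 s -> allsupp ok2 (bdry s).
Proof.
move=> oks; apply: (allsuppW (@bdry_subseq _ s)) => r rs.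
exact: (subseq_sorted le2_trans) rs oks.
Qed.

Lemma cop_ok2 s : ok2 s -> allsupp (fun t => ok2 t.1 /\ ok2 t.2) (cop s).
Proof.
move=> oks; apply: (allsuppW (@cop_subseq _ s)) => t [t1 t2].
by split; apply: (subseq_sorted le2_trans) oks.
Qed.

Lemma phi_homotopy (b : M) :
  lext (@cdiff M) (phi b) + lext (@phi K L) (cdiff b) =
  lext (@nab K L) (alexander_whitney b) - mon b.
Proof.
set x := (val (tagged b)).1; set y := (val (tagged b)).2.
have ok := diagl_ok2 (tag b).
rewrite phi_diagl cdiff_diagl aw_diagl -[mon b]evp_iota -/x -/y !lext_lext.
rewrite (eq_lext_in (ezh_ok2 ok) (g := fun s => lext (evp x y) (bdry s))); last first.
  by move=> s oks; apply: chain_diff_evp.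
rewrite (eq_lext_in (bdry_ok2 ok) (g := fun s => lext (evp x y) (ezh s))); last first.
  by move=> s oks; apply: phi_evp.
rewrite -!(lext_lext (evp x y)) -lextD bdry_ezh lextB lextU; congr (_ - _).
rewrite /ez [nilp _]/= add0r lext_lext.
apply: (eq_lext_in (cop_ok2 ok)) => t [t1 t2].
by rewrite /shuf2 lextU nab_evr ?ok2_unzip1 ?ok2_unzip2.
Qed.

Lemma aw_nab (u : N) : lext (@alexander_whitney K L) (nab u) = mon u.
Proof.
set x := val (tagged u.1); set y := val (tagged u.2).
have sA := iota_sorted 0 (tag u.1).+1; have sB := iota_sorted 0 (tag u.2).+1.
rewrite /nab /nab_simplex lext_lext.
rewrite (eq_lext_in (shuf_ok2 sA sB) (g := fun s => lext (fun t =>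
   ten (evr (face x) t.1) (evr (face y) t.2)) (aws s))); last first.
  by move=> s oks; apply: aw_evp.
rewrite -lext_lext.
set A := iota 0 (tag u.1).+1; set B := iota 0 (tag u.2).+1.
have D := @aws_shuf _ _ A B isT isT.
(* A repeated entry gives a degenerate simplex only for a sorted list, so sortedness of the error
   must be tracked next to [D]. *)
have O : allsupp (fun t => sorted leq t.1 /\ sorted leq t.2)
    (lext (@aws _ _) (shuf A B) - mon (A, B)).
  apply: allsuppB; last by apply: allsuppU.
  apply: (allsupp_lext (shuf_ok2 sA sB)) => s oks.
  apply: (allsupp_lext (cop_ok2 oks)) => t [t1 t2]; apply: allsuppU.
  by split; [apply: ok2_unzip1 | apply: ok2_unzip2].
have : lext (fun t => ten (evr (face x) t.1) (evr (face y) t.2))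
    (lext (@aws _ _) (shuf A B) - mon (A, B)) = 0.
  apply: (lext_eq0_in (allsuppI O D)) => t [[t1 t2]] /orP[dt|dt].
    by rewrite (evr_dup (face_realizes x) t1 dt) ten0l.
  by rewrite [X in ten _ X](evr_dup (face_realizes y) t2 dt) ten0r.
rewrite lextB lextU => /eqP; rewrite subr_eq0 => /eqP ->.
by rewrite !evr_iota tenUU -surjective_pairing.
Qed.

Lemma nab_cop (u : N) : lext (@ccop M) (nab u) =
  lext (fun t : N * N => ten (nab t.1) (nab t.2)) (ccop u).
Proof.
set x := val (tagged u.1); set y := val (tagged u.2).
have sA := iota_sorted 0 (tag u.1).+1; have sB := iota_sorted 0 (tag u.2).+1.
rewrite /nab /nab_simplex lext_lext.
rewrite (eq_lext_in (shuf_ok2 sA sB) (g := fun s => lext (fun t =>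
   ten (evp x y t.1) (evp x y t.2)) (cop s))); last first.
  by move=> s oks; apply: ccop_evp.
rewrite -lext_lext cop_shuf lext_lext ccop_tensE lext_lext.
rewrite !ccop_iota -/x -/y ten_lext lext_lext.
set A := iota 0 (tag u.1).+1; set B := iota 0 (tag u.2).+1.
apply: (eq_lext_in (allsupp_ten (allsuppI (@cop_size _ A) (@cop_subseq _ A))
  (allsuppI (@cop_size _ B) (@cop_subseq _ B)))).
move=> [[A1 A2] [B1 B2]] [[[_ [A2P _]] [A1s A2s]] [[B1P _] [B1s B2s]]].
rewrite /cop_shuf2 lextZ -ten_lext.
rewrite -!nab_evr; try exact: (subseq_sorted leq_trans _ sA);
  try exact: (subseq_sorted leq_trans _ sB).
rewrite -ten_middle -lextZf.
have H := allsupp_ten (allsupp_ten (@homog_evr _ _ (face x) A1) (@homog_evr _ _ (face x) A2))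
  (allsupp_ten (@homog_evr _ _ (face y) B1) (@homog_evr _ _ (face y) B2)).
apply: (eq_lext_in H) => -[[a1 a2] [b1 b2]] [[_ a2E] [b1E _]].
by rewrite lextZ lextU -a2E -b1E.
Qed.

Lemma lext_cdiff_ten n (c : {malg chains K}) (c' : {malg chains L}) :
  homog n c -> lext (@cdiff N) (ten c c') =
  ten (lext (@cdiff (chains K)) c) c' + sgn n *: ten c (lext (@cdiff (chains L)) c').
Proof.
move=> hc; rewrite lext_ten ten_lextl.
rewrite [X in _ + _ *: X]ten_lextE -lextZf -lextDf.
apply: (eq_lext_in hc) => a an.
transitivity (lext (fun b => ten (cdiff a) (mon b) +
    sgn n *: ten (mon a) (@cdiff (chains L) b)) c').
  by apply: eq_lext => b; rewrite cdiff_tensE an.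
rewrite lextDf lextZf -!ten_lextr lext_id; congr (_ + _ *: _).
by rewrite ten_lextE lextU.
Qed.

Lemma aw_cdiff (b : M) : lext (@alexander_whitney K L) (cdiff b) =
  lext (@cdiff N) (alexander_whitney b).
Proof.
set x := (val (tagged b)).1; set y := (val (tagged b)).2.
have ok := diagl_ok2 (tag b).
pose E (t : seq nat * seq nat) := ten (evr (face x) t.1) (evr (face y) t.2).
pose EU (t : seq (nat * nat) * seq (nat * nat)) := E (unzip1 t.1, unzip2 t.2).
transitivity (lext EU (lext (@bdry2 _) (cop (diagl (tag b))))).
  rewrite lext_bdry2_cop (_ : nilp (diagl (tag b)) = false); last by [].
  rewrite [RHS]lextD [lext EU (mon _ + _)]lextD [lext EU (_ *: _)]lextZ !lextU.
  rewrite {2 3}/EU /E [X in ten X _]/= ten0l [X in sgn _ *: ten _ X]/= ten0r.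
  rewrite scaler0 !addr0 cdiff_diagl -/x -/y [LHS]lext_lext [RHS]lext_lext.
  apply: (eq_lext_in (bdry_ok2 ok)) => s oks.
  by rewrite aw_evp // /aws lext_map.
rewrite aw_diagl -/x -/y [LHS]lext_lext [RHS]lext_lext /aws lext_map.
apply: (eq_lext_in (cop_ok2 ok)) => t [t1 t2].
rewrite (lext_cdiff_ten _ (@homog_evr _ _ (face x) (unzip1 t.1))) size_map.
rewrite (chain_diff_evr (face_realizes x) (ok2_unzip1 t1)).
rewrite (chain_diff_evr (face_realizes y) (ok2_unzip2 t2)).
rewrite /bdry2 [LHS]lextD lextZ !lext_map !bdry_map !lext_map /EU /E.
by rewrite ten_lextl ten_lextr.
Qed.

Lemma aw_deg (b : M) :
  allsupp (fun u : N => gdeg u = gdeg b) (alexander_whitney b).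
Proof.
rewrite aw_diagl /aws lext_map; apply: (allsupp_lext (@cop_size _ _)) => t.
rewrite size_diagl => -[t1 [t2 tt]].
apply: (allsuppW (allsupp_ten (@homog_evr _ _ (face _) (unzip1 t.1))
  (@homog_evr _ _ (face _) (unzip2 t.2)))) => u [u1 u2].
rewrite -[gdeg _]/(gdeg u.1 + gdeg u.2)%N u1 u2 !size_map; move: tt.
rewrite -(prednK t1) -(prednK t2).
by rewrite addSn addnS => -[].
Qed.

End PairFacts.

(** * Exchange of the factors of a product *)

Section Swap.
Variables K L : sset.

Definition swap_simplex n (xy : sprod K L n) : sprod L K n := (xy.2, xy.1).

Definition swap := push swap_simplex.

Lemma swap_evp p (x : K p) q (y : L q) s :
  lext swap (evp x y s) = evp y x [seq (p.2, p.1) | p <- s].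
Proof.
rewrite push_evr // /evp; case: s => [//|v s].
rewrite (@evrE _ _ _ (size s)) // (@evrE _ _ _ (size s)) ?size_map //; congr nch.
by rewrite /swap_simplex /pairface /= /unzip1 /unzip2 -!map_comp.
Qed.

Lemma swap_nab (u : gtens (chain_basis K) (chain_basis L)) :
  lext swap (nab u) = sgn (gdeg u.1 * gdeg u.2) *: nab (u.2, u.1).
Proof.
rewrite /nab /nab_simplex lext_lext.
transitivity (lext (evp (val (tagged u.2)) (val (tagged u.1)))
  (lext (fun r => mon [seq (p.2, p.1) | p <- r])
    (shuf (iota 0 (tag u.1).+1) (iota 0 (tag u.2).+1)))).
  by rewrite lext_map; apply: eq_lext => s; apply: swap_evp.
by rewrite shuf_swap !size_iota lextZ.
Qed.

End Swap.

Lemma swap_diag (K : sset) (b : chain_basis K) :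
  lext (@swap K K) (diag b) = diag b.
Proof. by rewrite diag_push push_nch. Qed.

Lemma gdeg_neq1 (K : sset) (hK : one_reduced K) (b : chain_basis K) :
  gdeg b != 1%N.
Proof.
case: hK => v [v1 v2]; case: b => -[|[|n]] [x xP] //=.
move/negP: xP; case; apply/asboolP; exists ord0, v; exact: v2.
Qed.

Lemma one_reduced_prod (K L : sset) :
  one_reduced K -> one_reduced L -> one_reduced (sprod K L).
Proof.
move=> [v [v1 v2]] [w [w1 w2]]; exists (v, w); split=> -[x y].
  by rewrite (v1 x) (w1 y).
by rewrite (v2 x) (w2 y).
Qed.

(** * Chain algebras *)

HB.lock Definition mulm (R : dga) (x y : {malg R}) : {malg R} := Defs.mul x y.
HB.lock Definition diffm (R : dga) (x : {malg R}) : {malg R} := Defs.diff x.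

Lemma mulmE (R : dga) (x y : {malg R}) : Defs.mul x y = mulm x y.
Proof. by rewrite mulm.unlock. Qed.

Lemma diffmE (R : dga) (x : {malg R}) : Defs.diff x = diffm x.
Proof. by rewrite diffm.unlock. Qed.

Section Multiplication.
Variable R : dga.
Implicit Types x y z : {malg R}.

Lemma mulm_lext x y : mulm x y = lext (fun ab : R * R => amul ab.1 ab.2) (ten x y).
Proof. by rewrite -mulmE /Defs.mul lextE tenE. Qed.

Lemma diffm_lext x : diffm x = lext adiff x.
Proof. by rewrite -diffmE /Defs.diff lextE. Qed.

Lemma mulm_linl y : linear (fun x => mulm x y).
Proof. by move=> a u v; rewrite !mulm_lext tenDl tenZl lextD lextZ. Qed.

Lemma mulm_linr x : linear (mulm x).
Proof. by move=> a u v; rewrite !mulm_lext tenDr tenZr lextD lextZ. Qed.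

Lemma diffm_lin : linear (@diffm R).
Proof. by move=> a u v; rewrite !diffm_lext lextD lextZ. Qed.

Lemma mulmUU (a b : R) : mulm (mon a) (mon b) = amul a b.
Proof. by rewrite mulm_lext tenUU lextU. Qed.

Lemma mulm_lextl (T : choiceType) (f : T -> {malg R}) c y :
  mulm (lext f c) y = lext (fun t => mulm (f t) y) c.
Proof. by rewrite mulm_lext ten_lextl lext_lext; apply: eq_lext => t; rewrite mulm_lext. Qed.

Lemma mulm_lextr (T : choiceType) (f : T -> {malg R}) c x :
  mulm x (lext f c) = lext (fun t => mulm x (f t)) c.
Proof. by rewrite mulm_lext ten_lextr lext_lext; apply: eq_lext => t; rewrite mulm_lext. Qed.

Lemma diffmU (a : R) : diffm (mon a) = adiff a.
Proof. by rewrite diffm_lext lextU. Qed.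

Lemma mulmDl x x' y : mulm (x + x') y = mulm x y + mulm x' y.
Proof. by rewrite !mulm_lext tenDl lextD. Qed.
Lemma mulmDr x y y' : mulm x (y + y') = mulm x y + mulm x y'.
Proof. by rewrite !mulm_lext tenDr lextD. Qed.
Lemma mulmZl a x y : mulm (a *: x) y = a *: mulm x y.
Proof. by rewrite !mulm_lext tenZl lextZ. Qed.
Lemma mulmZr a x y : mulm x (a *: y) = a *: mulm x y.
Proof. by rewrite !mulm_lext tenZr lextZ. Qed.
Lemma mulmNl x y : mulm (- x) y = - mulm x y.
Proof. by rewrite !mulm_lext tenNl lextN. Qed.
Lemma mulmNr x y : mulm x (- y) = - mulm x y.
Proof. by rewrite !mulm_lext tenNr lextN. Qed.
Lemma mulm0l y : mulm 0 y = 0.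
Proof. by rewrite mulm_lext ten0l lext0. Qed.
Lemma mulm0r x : mulm x 0 = 0.
Proof. by rewrite mulm_lext ten0r lext0. Qed.
Lemma diffmD x y : diffm (x + y) = diffm x + diffm y.
Proof. by rewrite !diffm_lext lextD. Qed.
Lemma diffmZ a x : diffm (a *: x) = a *: diffm x.
Proof. by rewrite !diffm_lext lextZ. Qed.

End Multiplication.

(** A [dga] carries operations only. These laws supply what the convolution arguments and the
    extension over words require of the target algebra. *)
Record dga_laws (R : dga) : Prop := DgaLaws {
  dga_mulA : forall x y z : {malg R}, mulm (mulm x y) z = mulm x (mulm y z);
  dga_mul1l : forall x : {malg R}, mulm (aone R) x = x;
  dga_mul1r : forall x : {malg R}, mulm x (aone R) = x;
  aone_deg : homog 0 (aone R);
  diffm1 : diffm (aone R) = 0;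
  amul_deg : forall a b : R, homog (gdeg a + gdeg b) (amul a b);
  adiff_deg : forall a : R, allsupp (fun b => (gdeg b).+1 = gdeg a) (adiff a);
  diffm_mul : forall n (x y : {malg R}), parity n x ->
    diffm (mulm x y) = mulm (diffm x) y + sgn n *: mulm x (diffm y) }.

Lemma dga_laws_basis (R : dga) :
  (forall a b c : R, mulm (mulm (mon a) (mon b)) (mon c) =
                     mulm (mon a) (mulm (mon b) (mon c))) ->
  (forall a : R, mulm (aone R) (mon a) = mon a) ->
  (forall a : R, mulm (mon a) (aone R) = mon a) ->
  homog 0 (aone R) -> diffm (aone R) = 0 ->
  (forall a b : R, homog (gdeg a + gdeg b) (amul a b)) ->
  (forall a : R, allsupp (fun b => (gdeg b).+1 = gdeg a) (adiff a)) ->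
  (forall a b : R, diffm (mulm (mon a) (mon b)) =
    mulm (adiff a) (mon b) + sgn (gdeg a) *: mulm (mon a) (adiff b)) ->
  dga_laws R.
Proof.
move=> A l1 r1 d1 D1 md dd L.
have ml (x y : {malg R}) : mulm x y = lext (fun t => mulm (mon t) y) x.
  by rewrite -mulm_lextl lext_id.
have mr (x y : {malg R}) : mulm x y = lext (fun t => mulm x (mon t)) y.
  by rewrite -mulm_lextr lext_id.
split=> //.
- move=> x y z; rewrite [in LHS](ml x y) mulm_lextl [RHS]ml; apply: eq_lext => a.
  rewrite [in LHS](mr _ y) mulm_lextl [in RHS](ml y z) mulm_lextr.
  apply: eq_lext => b; rewrite [LHS]mr [in RHS](mr _ z) mulm_lextr.
  by apply: eq_lext => c; apply: A.
- by move=> x; rewrite mr -[RHS]lext_id; apply: eq_lext.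
- by move=> x; rewrite ml -[RHS]lext_id; apply: eq_lext.
move=> n x y nx.
have E (a : R) : diffm (mulm (mon a) y) =
    mulm (adiff a) y + sgn (gdeg a) *: mulm (mon a) (diffm y).
  rewrite (mr (mon a) y) (mr (adiff a) y) !diffm_lext mulm_lextr lext_lext.
  rewrite -lextZf -lextDf; apply: eq_lext => b.
  by rewrite -diffm_lext L.
rewrite (ml x y) (ml x (diffm y)) -lextZf.
have -> : mulm (diffm x) y = lext (fun a => mulm (adiff a) y) x.
  by rewrite diffm_lext mulm_lextl.
rewrite -lextDf diffm_lext lext_lext; apply: (eq_lext_in nx) => a an.
by rewrite -diffm_lext E an.
Qed.

Lemma sgnM_eq a b p q : sgn a = sgn p -> sgn b = sgn q -> sgn (a * b) = sgn (p * q).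
Proof.
rewrite /sgn => ap bq; rewrite exprM ap -exprM mulnC exprM bq -exprM.
by rewrite mulnC.
Qed.

Lemma parityU (B : gbasis) (b : B) : parity (gdeg b) (mon b).
Proof. exact: allsuppU. Qed.
Arguments parityU {B} b.

Lemma homog_parity (B : gbasis) n (c : {malg B}) : homog n c -> parity n c.
Proof. by move=> H; apply: (allsuppW H) => b ->. Qed.

Lemma pred_parity (B : gbasis) n (c : {malg B}) :
  allsupp (fun b => (gdeg b).+1 = n) c -> parity n.+1 c.
Proof. by move=> H; apply: (allsuppW H) => b <-; rewrite !sgnS opprK. Qed.

Lemma mulm_homog (R : dga) (h : dga_laws R) k l (x y : {malg R}) :
  homog k x -> homog l y -> homog (k + l) (mulm x y).
Proof.
move=> hx hy; rewrite mulm_lext; apply: (allsupp_lext (allsupp_ten hx hy)).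
by move=> ab [<- <-]; apply: (amul_deg h).
Qed.

Lemma mulm_parity (R : dga) (h : dga_laws R) k l (x y : {malg R}) :
  parity k x -> parity l y -> parity (k + l) (mulm x y).
Proof.
move=> hx hy; rewrite mulm_lext; apply: (allsupp_lext (allsupp_ten hx hy)).
move=> ab [ka lb]; apply: (allsuppW (@amul_deg _ h ab.1 ab.2)) => c ->.
by rewrite !sgnD ka lb.
Qed.

Section TensorProduct.
Variables A B : dga.
Hypotheses (hA : dga_laws A) (hB : dga_laws B).
Local Notation T := (dga_tens A B).

Lemma mulm_ten p q (a : {malg A}) (b : {malg B}) (c : {malg A}) (e : {malg B}) :
  parity p b -> parity q c ->
  mulm (R := T) (ten a b) (ten c e) = sgn (p * q) *: ten (mulm a c) (mulm b e).
Proof.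
move=> pb qc; rewrite !mulm_lext.
rewrite -(ten_middle (fun ab : A * A => amul ab.1 ab.2)
  (fun ab : B * B => amul ab.1 ab.2)) -lextZf.
have H := allsupp_ten
  (allsupp_ten (Q := fun=> True) (c := a) (fun _ _ => I) pb)
  (allsupp_ten qc (R := fun=> True) (c' := e) (fun _ _ => I)).
apply: (eq_lext_in H) => t [[_ t1] [t2 _]].
by rewrite /= tenE (sgnM_eq t1 t2).
Qed.

Lemma diffm_ten n (a : {malg A}) (b : {malg B}) : parity n a ->
  diffm (R := T) (ten a b) = ten (diffm a) b + sgn n *: ten a (diffm b).
Proof.
move=> na; rewrite !diffm_lext lext_ten.
rewrite (eq_lext_in na (g := fun x => lext (fun y => ten (adiff x) (mon y)) b +
    sgn n *: lext (fun y => ten (mon x) (adiff y)) b)); last first.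
  move=> x nx; rewrite -lextZf -lextDf; apply: eq_lext => y.
  by rewrite /= /tens_diff /tensmap mul0n scale1r mul1n /= nx !tenE !monE.
rewrite lextDf lextZf ten_lextl; congr (_ + _ *: _).
  by apply: eq_lext => x; rewrite -ten_lextr lext_id.
by rewrite [RHS]ten_lextE; apply: eq_lext => x; rewrite -ten_lextr ten_lextE lextU.
Qed.

Lemma tens_laws : dga_laws T.
Proof.
have oneE : aone T = ten (aone A) (aone B) by rewrite -tenE.
have p1A := homog_parity (aone_deg hA).
have p1B := homog_parity (aone_deg hB).
have mT (t : T) : mon t = ten (mon t.1) (mon t.2).
  by rewrite tenUU -surjective_pairing.
apply: dga_laws_basis.
- move=> t u v; rewrite !mT.
  rewrite (mulm_ten _ _ (parityU t.2) (parityU u.1)) mulmZl.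
  rewrite (mulm_ten _ _ (mulm_parity hB (parityU t.2) (parityU u.2)) (parityU v.1)).
  rewrite (mulm_ten _ _ (parityU u.2) (parityU v.1)) mulmZr.
  rewrite (mulm_ten _ _ (parityU t.2) (mulm_parity hA (parityU u.1) (parityU v.1))).
  rewrite (dga_mulA hA) (dga_mulA hB) !scalerA -!sgnD; congr (sgn _ *: _).
  by rewrite mulnDl mulnDr; lia.
- move=> t; rewrite mT oneE (mulm_ten _ _ p1B (parityU t.1)) mul0n sgn0 scale1r.
  by rewrite (dga_mul1l hA) (dga_mul1l hB).
- move=> t; rewrite mT oneE (mulm_ten _ _ (parityU t.2) p1A) muln0 sgn0 scale1r.
  by rewrite (dga_mul1r hA) (dga_mul1r hB).
- rewrite oneE; apply: (allsuppW (allsupp_ten (aone_deg hA) (aone_deg hB))).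
  by move=> t [t1 t2]; rewrite -[gdeg _]/(gdeg t.1 + gdeg t.2)%N t1 t2.
- rewrite oneE (diffm_ten _ p1A) (diffm1 hA) (diffm1 hB) ten0l ten0r.
  by rewrite scaler0 addr0.
- move=> a b; rewrite /= tenE; apply: allsuppZ.
  apply: (allsuppW (allsupp_ten (@amul_deg _ hA a.1 b.1) (@amul_deg _ hB a.2 b.2))).
  move=> t [t1 t2]; rewrite -[gdeg _]/(gdeg t.1 + gdeg t.2)%N t1 t2.
  by rewrite /=; lia.
- move=> a; rewrite /= /tens_diff /tensmap mul0n scale1r !tenE !monE.
  apply: allsuppD; last apply: allsuppZ.
    apply: (allsuppW (allsupp_ten (@adiff_deg _ hA a.1)
      (allsuppU (Q := fun b => gdeg b = gdeg a.2) (erefl _)))).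
    by move=> v [<- <-].
  apply: (allsuppW (allsupp_ten
    (allsuppU (Q := fun b => gdeg b = gdeg a.1) (erefl _)) (@adiff_deg _ hB a.2))).
  by move=> v [<- <-]; rewrite addnS.
move=> t u; rewrite -!diffmU !mT -[gdeg t]/(gdeg t.1 + gdeg t.2)%N.
rewrite (mulm_ten _ _ (parityU t.2) (parityU u.1)) diffmZ.
rewrite (diffm_ten _ (mulm_parity hA (parityU t.1) (parityU u.1))).
rewrite !(diffm_ten _ (parityU _)) !diffmU mulmDl mulmDr mulmZl mulmZr.
rewrite (mulm_ten _ _ (parityU t.2) (parityU u.1)).
rewrite (mulm_ten _ _ (pred_parity (@adiff_deg _ hB t.2)) (parityU u.1)).
rewrite (mulm_ten _ _ (parityU t.2) (pred_parity (@adiff_deg _ hA u.1))).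
rewrite (mulm_ten _ _ (parityU t.2) (parityU u.1)).
rewrite (diffm_mul hA _ (parityU t.1)) (diffm_mul hB _ (parityU t.2)) !diffmU.
rewrite !(tenDl, tenDr, tenZl, tenZr) mulSn mulnS !sgnD.
case: (sgn_cases (gdeg t.1)) => ->; case: (sgn_cases (gdeg t.2)) => ->;
  case: (sgn_cases (gdeg u.1)) => ->; module.
Qed.

End TensorProduct.

Section Switch.
Variable A : dga.
Hypothesis hA : dga_laws A.
Local Notation T := (dga_tens A A).

Definition sw (c : {malg T}) : {malg T} :=
  lext (fun t : A * A => sgn (gdeg t.1 * gdeg t.2) *: mon (t.2, t.1)) c.

Lemma switchE (c : {malg T}) : switch c = sw c.
Proof. by rewrite /switch lextE; apply: eq_lext => t; rewrite monZE. Qed.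

Lemma sw_ten p q (a b : {malg A}) : parity p a -> parity q b ->
  sw (ten a b) = sgn (p * q) *: ten b a.
Proof.
move=> pa qb; rewrite [ten b a]ten_lextC -lextZf /sw lext_ten.
apply: (eq_lext_in pa) => x xp; rewrite -lextZf.
apply: (eq_lext_in qb) => y yq.
by rewrite /= (sgnM_eq xp yq).
Qed.

Lemma swD x y : sw (x + y) = sw x + sw y.
Proof. exact: lextD. Qed.

Lemma swZ z x : sw (z *: x) = z *: sw x.
Proof. exact: lextZ. Qed.

Lemma sw_lext (B : choiceType) (f : B -> {malg T}) c :
  sw (lext f c) = lext (fun b => sw (f b)) c.
Proof. exact: lext_lext. Qed.

Lemma sw_mul x y : sw (mulm x y) = mulm (sw x) (sw y).
Proof.
have mT (t : T) : mon t = ten (mon t.1) (mon t.2).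
  by rewrite tenUU -surjective_pairing.
rewrite -[x]lext_id -[y]lext_id mulm_lextl !sw_lext mulm_lextl.
apply: eq_lext => t; rewrite !mulm_lextr sw_lext; apply: eq_lext => u.
rewrite !mT (mulm_ten _ _ (parityU t.2) (parityU u.1)).
rewrite swZ.
rewrite (sw_ten (mulm_parity hA (parityU t.1) (parityU u.1))
  (mulm_parity hA (parityU t.2) (parityU u.2))).
rewrite (sw_ten (parityU t.1) (parityU t.2)) (sw_ten (parityU u.1) (parityU u.2)).
rewrite mulmZl mulmZr (mulm_ten _ _ (parityU t.1) (parityU u.2)).
rewrite !scalerA -!sgnD !sgn_odd; congr (_ ^+ _ *: _).
by rewrite !(oddD, oddM); do 4!case: odd.
Qed.

Lemma sw_diff x : sw (diffm x) = diffm (sw x).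
Proof.
have mT (t : T) : mon t = ten (mon t.1) (mon t.2).
  by rewrite tenUU -surjective_pairing.
rewrite -[x]lext_id [diffm (lext _ _)]diffm_lext lext_lext !sw_lext diffm_lext lext_lext.
apply: eq_lext => t; rewrite lextU -diffm_lext -diffmU !mT.
rewrite (diffm_ten _ (parityU t.1)) !diffmU (sw_ten (parityU t.1) (parityU t.2)).
rewrite diffmZ (diffm_ten _ (parityU t.2)) !diffmU.
rewrite swD swZ.
rewrite (sw_ten (pred_parity (@adiff_deg _ hA t.1)) (parityU t.2)).
rewrite (sw_ten (parityU t.1) (pred_parity (@adiff_deg _ hA t.2))).
rewrite mulSn mulnS !sgnD.
by case: (sgn_cases (gdeg t.1)) => ->; case: (sgn_cases (gdeg t.2)) => ->; module.
Qed.

Lemma sw_deg n x : homog n x -> homog n (sw x).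
Proof.
move=> hx; apply: (allsupp_lext hx) => t <-; apply: allsuppZ; apply: allsuppU.
by rewrite -[LHS]/(gdeg t.2 + gdeg t.1)%N addnC.
Qed.

End Switch.

(** * The cobar construction *)

Section CobarLaws.
Variable C : coalg.
Hypothesis cop_deg : forall x : C,
  allsupp (fun t => (gdeg t.1 + gdeg t.2)%N = gdeg x) (ccop x).
Hypothesis diff_deg : forall x : C,
  allsupp (fun y => (gdeg y).+1 = gdeg x) (cdiff x).
Local Notation O := (cobar C).

Lemma cobar_mulUU (u v : O) : mulm (mon u) (mon v) = mon (u ++ v : O).
Proof. by rewrite mulmUU /= monE. Qed.

Lemma cobar_oneE : aone O = mon ([::] : O).
Proof. by rewrite /= monE. Qed.

Lemma desusp_cons (x : C) w : desusp (x :: w) =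
  if insub x is Some g then
    sgn (size w * gdeg x) *: mulm (mon ([:: g] : O)) (desusp w) else 0.
Proof.
rewrite /=; case: insub => [g|] //; congr (_ *: _); rewrite lextE.
rewrite -[in RHS](lext_id (desusp w)) mulm_lextr; apply: eq_lext => v.
by rewrite cobar_mulUU monE.
Qed.

Lemma desusp_nil : desusp ([::] : seq C) = aone O.
Proof. by []. Qed.

Lemma cobar_assoc (x y z : {malg O}) : mulm (mulm x y) z = mulm x (mulm y z).
Proof.
rewrite -[x]lext_id !mulm_lextl; apply: eq_lext => u {x}.
rewrite -[y]lext_id mulm_lextl !mulm_lextr mulm_lextl; apply: eq_lext => v {y}.
rewrite -[z]lext_id !mulm_lextr; apply: eq_lext => w.
by rewrite !cobar_mulUU catA.
Qed.

Lemma cobar_mul1 (x : {malg O}) : mulm (aone O) x = x.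
Proof.
rewrite -{1}[x]lext_id mulm_lextr -[RHS]lext_id; apply: eq_lext => u.
by rewrite cobar_oneE cobar_mulUU.
Qed.

(** Sign for moving the [size w2] desuspensions of the second word past the letters of the first. *)
Lemma desusp_cat (w1 w2 : seq C) : desusp (w1 ++ w2) =
  sgn (size w2 * sumn (map gdeg w1)) *: mulm (R := O) (desusp w1) (desusp w2).
Proof.
elim: w1 => [|x w1 IH].
  by rewrite desusp_nil cobar_mul1 [sumn _]/= muln0 sgn0 scale1r.
rewrite cat_cons !desusp_cons; case: insub => [g|]; last by rewrite mulm0l scaler0.
rewrite IH mulmZr mulmZl cobar_assoc !scalerA -!sgnD; congr (sgn _ *: _).
by rewrite size_cat /=; lia.
Qed.

Definition desusp1 (y : C) : {malg O} := desusp [:: y].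

Lemma desusp1E (y : C) :
  desusp1 y = if insub y is Some g then mon ([:: g] : O) else 0.
Proof.
rewrite /desusp1 desusp_cons mul0n sgn0; case: insub => [g|] //.
by rewrite scale1r desusp_nil cobar_oneE cobar_mulUU.
Qed.

Lemma desusp2E (y z : C) :
  desusp [:: y; z] = sgn (gdeg y) *: mulm (desusp1 y) (desusp1 z).
Proof. by rewrite -cat1s desusp_cat /= mul1n addn0. Qed.

Lemma desusp1_val (g : cobar_gen C) : desusp1 (val g) = mon ([:: g] : O).
Proof. by rewrite desusp1E valK. Qed.

Lemma desusp1_deg (y : C) : allsupp (fun u : O => (gdeg u).+1 = gdeg y) (desusp1 y).
Proof.
rewrite desusp1E; case: insubP => [g gP <-|_]; last exact: allsupp0.
by apply: allsuppU; rewrite /= big_seq1 /gen_deg (prednK (valP g)).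
Qed.

Lemma cobar_diff_genE (x : cobar_gen C) : cobar_diff_gen x =
  - lext desusp1 (cdiff (val x)) +
  lext (fun t : C * C => sgn (gdeg t.1) *: mulm (desusp1 t.1) (desusp1 t.2))
    (ccop (val x)).
Proof.
rewrite /cobar_diff_gen !lextE; congr (_ + _).
by apply: eq_lext => t; rewrite desusp2E.
Qed.

Lemma cobar_amul_deg (a b : O) : homog (gdeg a + gdeg b) (amul a b).
Proof. by rewrite -mulmUU cobar_mulUU; apply: allsuppU; rewrite /= big_cat. Qed.

Lemma cobar_diff_gen_deg (x : cobar_gen C) :
  allsupp (fun u : O => (gdeg u).+1 = gen_deg x) (cobar_diff_gen x).
Proof.
rewrite cobar_diff_genE; apply: allsuppD.
  apply: allsuppN; apply: (allsupp_lext (@diff_deg (val x))) => y yx.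
  by apply: (allsuppW (@desusp1_deg y)) => u uy; rewrite /gen_deg -yx -uy.
apply: (allsupp_lext (@cop_deg (val x))) => t tx; apply: allsuppZ.
rewrite mulm_lext.
apply: (allsupp_lext (allsupp_ten (@desusp1_deg t.1) (@desusp1_deg t.2))).
move=> ab [a1 b1]; apply: (allsuppW (@cobar_amul_deg ab.1 ab.2)) => u ->.
by rewrite /gen_deg -tx -a1 -b1 addSn addnS.
Qed.

Lemma cobar_diff_cons g (w : O) : cobar_diff (g :: w) =
  mulm (R := O) (cobar_diff_gen g) (mon w) +
  sgn (gen_deg g) *: mulm (R := O) (mon [:: g]) (cobar_diff w).
Proof.
rewrite /= !lextE; congr (_ + _ *: _).
  rewrite -[in RHS](lext_id (cobar_diff_gen g)) mulm_lextl.
  by apply: eq_lext => u; rewrite cobar_mulUU monE.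
rewrite -[in RHS](lext_id (cobar_diff w)) mulm_lextr.
by apply: eq_lext => u; rewrite cobar_mulUU monE.
Qed.

Lemma cobar_laws : dga_laws O.
Proof.
apply: dga_laws_basis.
- by move=> a b c; apply: cobar_assoc.
- by move=> a; apply: cobar_mul1.
- by move=> a; rewrite cobar_oneE cobar_mulUU cats0.
- by rewrite cobar_oneE; apply: allsuppU; rewrite /= big_nil.
- by rewrite cobar_oneE diffmU.
- exact: cobar_amul_deg.
- elim=> [|g w IH]; first exact: allsupp0.
  rewrite -[adiff _]/(cobar_diff (g :: w)) cobar_diff_cons.
  have gw : gdeg (g :: w : O) = (gen_deg g + gdeg (w : O))%N.
    by rewrite /= big_cons.
  rewrite gw; apply: allsuppD; last apply: allsuppZ; rewrite mulm_lext.
    apply: (allsupp_lext (allsupp_ten (@cobar_diff_gen_deg g)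
      (allsuppU (Q := fun b : O => gdeg b = gdeg (w : O)) (erefl _)))).
    move=> ab [a1 b1]; apply: (allsuppW (@cobar_amul_deg ab.1 ab.2)) => u ->.
    by rewrite -a1 b1.
  apply: (allsupp_lext (allsupp_ten (allsuppU (Q := fun b : O => gdeg b = gen_deg g)
    (a := [:: g]) _) IH)); first by rewrite /= big_seq1.
  move=> ab [a1 b1]; apply: (allsuppW (@cobar_amul_deg ab.1 ab.2)) => u ->.
  by rewrite a1 -b1 addnS.
move=> a b; rewrite cobar_mulUU diffmU.
elim: a => [|g w IH].
  rewrite -cobar_oneE cobar_mul1 -[adiff ([::] : O)]/(0 : {malg O}) mulm0l add0r.
  by rewrite /= big_nil sgn0 scale1r.
rewrite -[adiff ((g :: w) ++ b : O)]/(cobar_diff (g :: (w ++ b))).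
rewrite -[adiff (g :: w : O)]/(cobar_diff (g :: w)) !cobar_diff_cons.
rewrite -[cobar_diff (w ++ b)]/(adiff (w ++ b : O)) -[cobar_diff w]/(adiff (w : O)).
rewrite IH -!cobar_mulUU.
rewrite mulmDl mulmZl mulmDr mulmZr !cobar_assoc.
rewrite -[g :: w]/([:: g] ++ w) -cobar_mulUU !cobar_assoc.
have -> : gdeg ([:: g] ++ w : O) = (gen_deg g + gdeg (w : O))%N.
  by rewrite /= big_cons.
by rewrite sgnD; module.
Qed.

End CobarLaws.

(** * Extension of twisting cochains and homotopies to the cobar construction *)

Section AlgebraExtension.
Variables (C : coalg) (R : dga) (hR : dga_laws R).
Hypothesis cop_deg : forall x : C,
  allsupp (fun t => (gdeg t.1 + gdeg t.2)%N = gdeg x) (ccop x).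
Hypothesis diff_deg : forall x : C,
  allsupp (fun y => (gdeg y).+1 = gdeg x) (cdiff x).
Local Notation O := (cobar C).
Let hO : dga_laws O := cobar_laws cop_deg diff_deg.

Section Words.
Variable f : cobar_gen C -> {malg R}.

Lemma alg_extE : alg_ext f = lext (alg_ext_word f).
Proof. by rewrite /alg_ext lextE. Qed.

Lemma alg_extU (w : O) : alg_ext f (mon w) = alg_ext_word f w.
Proof. by rewrite alg_extE lextU. Qed.

Lemma alg_ext_word_cons g w :
  alg_ext_word f (g :: w) = mulm (f g) (alg_ext_word f w).
Proof. by rewrite /= mulmE. Qed.

Lemma alg_ext_word_cat (u v : O) : alg_ext_word f (u ++ v) =
  mulm (alg_ext_word f u) (alg_ext_word f v).
Proof.
elim: u => [|g u IH]; first by rewrite /= (dga_mul1l hR).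
by rewrite cat_cons !alg_ext_word_cons IH (dga_mulA hR).
Qed.

Lemma alg_ext_mul x y : alg_ext f (mulm x y) = mulm (alg_ext f x) (alg_ext f y).
Proof.
rewrite -[x]lext_id -[y]lext_id alg_extE mulm_lextl !lext_lext mulm_lextl.
apply: eq_lext => u; rewrite !mulm_lextr lext_lext; apply: eq_lext => v.
by rewrite cobar_mulUU !lextU alg_ext_word_cat.
Qed.

Lemma alg_ext_one : alg_ext f (aone O) = aone R.
Proof. by rewrite cobar_oneE alg_extU. Qed.

End Words.

Section TwistingMap.
Variable t : C -> {malg R}.
Hypothesis t_deg : forall x, allsupp (fun r => (gdeg r).+1 = gdeg x) (t x).

Definition twist_ext : {malg O} -> {malg R} := alg_ext (fun g => t (val g)).

Lemma twist_extE : twist_ext = lext (alg_ext_word (fun g => t (val g))).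
Proof. exact: alg_extE. Qed.

Lemma twist_extU (w : O) : twist_ext (mon w) = alg_ext_word (fun g => t (val g)) w.
Proof. exact: alg_extU. Qed.

Lemma twist_extD x y : twist_ext (x + y) = twist_ext x + twist_ext y.
Proof. by rewrite twist_extE lextD. Qed.

Lemma twist_extN x : twist_ext (- x) = - twist_ext x.
Proof. by rewrite twist_extE lextN. Qed.

Lemma twist_extZ z x : twist_ext (z *: x) = z *: twist_ext x.
Proof. by rewrite twist_extE lextZ. Qed.

Lemma twist_ext_lext (T : choiceType) (f : T -> {malg O}) c :
  twist_ext (lext f c) = lext (fun x => twist_ext (f x)) c.
Proof. by rewrite twist_extE lext_lext. Qed.

Lemma twist_ext_mul x y : twist_ext (mulm x y) = mulm (twist_ext x) (twist_ext y).
Proof. exact: alg_ext_mul. Qed.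

(** In degree 0 the left side is 0 by definition, and the degree condition forces [t] to vanish
    there as well. *)
Lemma twist_ext_desusp1 y : twist_ext (desusp1 y) = t y.
Proof.
rewrite desusp1E; case: insubP => [g _ <-|y0].
  by rewrite /twist_ext alg_extU alg_ext_word_cons (dga_mul1r hR).
rewrite twist_extE lext0 (deg_zero t_deg) //.
by move: y0; rewrite -leqNgt leqn0 => /eqP.
Qed.

Lemma twist_ext_gen x : twist_ext (cobar_diff_gen x) =
  - lext t (cdiff (val x)) + cup (@ccop C) (@mulm R) 1 t t (val x).
Proof.
rewrite cobar_diff_genE twist_extD twist_extN !twist_ext_lext.
congr (- _ + _); apply: eq_lext => u; first exact: twist_ext_desusp1.
by rewrite mul1n twist_extZ twist_ext_mul !twist_ext_desusp1.
Qed.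

Lemma twist_ext_word_deg (w : O) :
  homog (gdeg w) (alg_ext_word (fun g => t (val g)) w).
Proof.
elim: w => [|g w IH]; first by rewrite /= big_nil; apply: (aone_deg hR).
rewrite alg_ext_word_cons -[gdeg _]/(\sum_(x <- g :: w) gen_deg x)%N big_cons.
apply: (mulm_homog hR) IH.
by apply: (allsuppW (@t_deg (val g))) => r rE; rewrite /gen_deg -rE.
Qed.

Lemma twist_ext_deg n x : homog n x -> homog n (twist_ext x).
Proof.
rewrite twist_extE => hx; apply: (allsupp_lext hx) => w <-.
exact: twist_ext_word_deg.
Qed.

Hypothesis t_twist : forall x,
  der (@cdiff C) (@diffm R) 1 t x = cup (@ccop C) (@mulm R) 1 t t x.

(** On a generator this is the twisting equation, by [twist_ext_gen]. The Leibniz rules on both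
    sides carry it over to words. *)
Lemma twist_ext_diff x : twist_ext (diffm x) = diffm (twist_ext x).
Proof.
rewrite -[x]lext_id [diffm (lext _ _)]diffm_lext lext_lext !twist_ext_lext.
rewrite diffm_lext lext_lext; apply: eq_lext => w.
rewrite lextU -diffm_lext /twist_ext alg_extU -/twist_ext.
rewrite -[adiff w]/(cobar_diff w).
elim: w => [|g w IH]; first by rewrite twist_extE lext0 (diffm1 hR).
rewrite cobar_diff_cons alg_ext_word_cons (diffm_mul hR _
  (@deg_parity C R t t_deg (val g))).
rewrite twist_extD twist_extZ !twist_ext_mul IH twist_ext_gen -t_twist.
rewrite /twist_ext !alg_extU alg_ext_word_cons (dga_mul1r hR).
have -> : sgn (gen_deg g) = sgn (1 + gdeg (val g)).
  by rewrite -[in RHS](prednK (valP g)) !sgnS opprK.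
congr (mulm _ _ + _ *: _).
by rewrite /der /sgn expr1; module.
Qed.

Lemma twist_ext_chain_map : chain_algebra_map twist_ext.
Proof.
split.
- by rewrite twist_extE; apply: lext_is_linear.
- exact: twist_ext_deg.
- exact: alg_ext_one.
- by move=> x y; rewrite !mulmE; apply: alg_ext_mul.
- by move=> x; rewrite !diffmE; apply: twist_ext_diff.
Qed.

End TwistingMap.

Section DerivationHomotopy.
Variables t t' H : C -> {malg R}.
Hypothesis t_deg : forall x, allsupp (fun r => (gdeg r).+1 = gdeg x) (t x).
Hypothesis t'_deg : forall x, allsupp (fun r => (gdeg r).+1 = gdeg x) (t' x).
Hypothesis t_twist : forall x,
  der (@cdiff C) (@diffm R) 1 t x = cup (@ccop C) (@mulm R) 1 t t x.
Hypothesis t'_twist : forall x,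
  der (@cdiff C) (@diffm R) 1 t' x = cup (@ccop C) (@mulm R) 1 t' t' x.
Hypothesis H_deg : forall x, homog (gdeg x) (H x).
Hypothesis H0 : forall x, gdeg x = 0%N -> H x = 0.
Hypothesis H_eq : forall x, der (@cdiff C) (@diffm R) 0 H x =
  homotopy_rhs (@ccop C) (@mulm R) t t' H x.

Local Notation F := (alg_ext_word (fun g => t (val g))).
Local Notation G := (alg_ext_word (fun g => t' (val g))).

(** The derivation law forces this value on words from the values [H] on generators; the sign comes
    from passing the degree +1 map over the first letter. *)
Fixpoint der_word (w : O) : {malg R} :=
  if w is g :: w' then
    mulm (H (val g)) (G w') + sgn (gen_deg g) *: mulm (t (val g)) (der_word w')
  else 0.

Lemma der_word_cons g w : der_word (g :: w) =
  mulm (H (val g)) (G w) + sgn (gen_deg g) *: mulm (t (val g)) (der_word w).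
Proof. by []. Qed.

Definition der_ext : {malg O} -> {malg R} := lext der_word.

Lemma der_extD x y : der_ext (x + y) = der_ext x + der_ext y.
Proof. exact: lextD. Qed.

Lemma der_extZ z x : der_ext (z *: x) = z *: der_ext x.
Proof. exact: lextZ. Qed.

Lemma der_ext_lext (T : choiceType) (f : T -> {malg O}) c :
  der_ext (lext f c) = lext (fun x => der_ext (f x)) c.
Proof. exact: lext_lext. Qed.

Lemma der_extU (w : O) : der_ext (mon w) = der_word w.
Proof. exact: lextU. Qed.

Lemma der_word_cat (u v : O) : der_word (u ++ v) =
  mulm (der_word u) (G v) + sgn (gdeg u) *: mulm (F u) (der_word v).
Proof.
elim: u => [|g u IH].
  by rewrite /= mulm0l add0r big_nil sgn0 scale1r (dga_mul1l hR).
have -> : gdeg (g :: u : O) = (gen_deg g + gdeg (u : O))%N by rewrite /= big_cons.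
rewrite cat_cons !der_word_cons IH alg_ext_word_cat alg_ext_word_cons sgnD.
rewrite [in LHS]mulmDr [in LHS]mulmZr -![in LHS](dga_mulA hR).
by rewrite [in RHS]mulmDl [in RHS]mulmZl; module.
Qed.

Lemma der_ext_mul n x y : parity n x -> der_ext (mulm x y) =
  mulm (der_ext x) (twist_ext t' y) + sgn n *: mulm (twist_ext t x) (der_ext y).
Proof.
move=> hx; rewrite -[x]lext_id mulm_lextl !der_ext_lext twist_ext_lext !mulm_lextl.
rewrite -lextZf -lextDf; apply: (eq_lext_in hx) => u un {x hx}.
rewrite -[y]lext_id mulm_lextr !der_ext_lext twist_ext_lext !mulm_lextr.
rewrite -lextZf -lextDf; apply: eq_lext => v.
by rewrite cobar_mulUU !der_extU !twist_extU der_word_cat un.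
Qed.

Lemma der_word_deg (w : O) : homog (gdeg w).+1 (der_word w).
Proof.
elim: w => [|g w IH]; first exact: allsupp0.
rewrite -[gdeg _]/(\sum_(x <- g :: w) gen_deg x)%N big_cons /=.
apply: allsuppD; last apply: allsuppZ.
  rewrite -addSn /gen_deg (prednK (valP g)).
  by apply: (mulm_homog hR (H_deg (x := val g))); apply: twist_ext_word_deg.
rewrite -addnS; apply: (mulm_homog hR) IH.
by apply: (allsuppW (@t_deg (val g))) => r rE; rewrite /gen_deg -rE.
Qed.

Lemma der_ext_desusp1 y : der_ext (desusp1 y) = H y.
Proof.
rewrite desusp1E; case: insubP => [g _ <-|y0].
  by rewrite /der_ext lextU /= (dga_mul1r hR) mulm0r scaler0 addr0.
by rewrite /der_ext lext0 H0 //; move: y0; rewrite -leqNgt leqn0 => /eqP.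
Qed.

(** The origin of the two cup products in [homotopy_rhs]: they compensate the quadratic part of the
    cobar differential under a derivation. *)
Lemma der_ext_gen x : der_ext (cobar_diff_gen x) = - lext H (cdiff (val x)) +
  cup (@ccop C) (@mulm R) 1 H t' (val x) - cup (@ccop C) (@mulm R) 0 t H (val x).
Proof.
rewrite cobar_diff_genE /der_ext lextD lextN lext_lext -addrA.
congr (- _ + _); first by apply: eq_lext => y; apply: der_ext_desusp1.
rewrite lext_lext -lextBf; apply: eq_lext => u.
rewrite lextZ -/(der_ext _) mul1n mul0n sgn0 scale1r.
rewrite (@der_ext_mul (gdeg u.1).+1); last exact: pred_parity (@desusp1_deg _ u.1).
rewrite !der_ext_desusp1 (twist_ext_desusp1 t_deg) (twist_ext_desusp1 t'_deg).
rewrite scalerDr scalerA sgnS mulrN sgn_sqr scaleN1r.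
by [].
Qed.

(** On a generator, [H_eq] and [der_ext_gen] add up to the difference of [t] and [t']. For longer
    words the derivation law makes the mixed products of the first letter with the rest cancel or
    telescope. *)
Lemma der_word_homotopy (w : O) :
  diffm (der_word w) + der_ext (cobar_diff w) = F w - G w.
Proof.
elim: w => [|g w IH].
  by rewrite diffm_lext /der_ext !lext0 addr0 subrr.
have Hp : parity (gdeg (val g)) (H (val g)) := homog_parity (@H_deg (val g)).
have tp := @deg_parity C R t t_deg (val g).
have gE : sgn (gen_deg g) = - sgn (gdeg (val g)).
  by rewrite -[in RHS](prednK (valP g)) sgnS opprK.
rewrite cobar_diff_cons !alg_ext_word_cons.
rewrite der_word_cons.
rewrite diffmD diffmZ (diffm_mul hR _ Hp) (diffm_mul hR _ tp).
have -> : diffm (G w) = twist_ext t' (cobar_diff w).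
  by rewrite -(alg_extU _ w) -/(twist_ext t') -twist_ext_diff // diffmU.
rewrite der_extD der_extZ.
rewrite (@der_ext_mul (gen_deg g).+1); last first.
  exact: pred_parity (@cobar_diff_gen_deg C cop_deg diff_deg g).
rewrite (@der_ext_mul (gen_deg g)); last by apply: allsuppU; rewrite /= big_seq1.
rewrite (twist_ext_gen t_deg) -t_twist der_ext_gen.
have -> : diffm (der_word w) = F w - G w - der_ext (cobar_diff w).
  by rewrite -IH addrK.
have -> : diffm (H (val g)) = lext H (cdiff (val g)) +
    homotopy_rhs (@ccop C) (@mulm R) t t' H (val g).
  by rewrite -H_eq /der sgn0 scale1r addrCA subrr addr0.
rewrite !twist_extU !alg_ext_word_cons !der_extU der_word_cons.
rewrite !(dga_mul1r hR) mulm0r scaler0 addr0.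
have -> : - lext t (cdiff (val g)) + der (@cdiff C) (@diffm R) 1 t (val g) =
    diffm (t (val g)).
  by rewrite /der /sgn expr1; module.
rewrite /homotopy_rhs add1n !sgnS gE.
move: (cup _ _ 1 H t' _) (cup _ _ 0 t H _) (lext H _) (diffm (t _)) => c1 c0 lH dt.
move: (F w) (G w) (der_word w) (der_ext _) (twist_ext t' _) => Fw Gw hw hdw Gdw.
move: (t _) (t' _) (H _) => tg tg' Hg.
rewrite !(mulmDl, mulmDr, mulmNl, mulmNr).
by case: (sgn_cases (gdeg (val g))) => ->; module.
Qed.

Lemma der_ext_homotopy : derivation_homotopy (twist_ext t) (twist_ext t') der_ext.
Proof.
split.
- exact: twist_ext_chain_map.
- exact: twist_ext_chain_map.
- split.
  + exact: lext_is_linear.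
  + by move=> n x hx; apply: (allsupp_lext hx) => w <-; apply: der_word_deg.
  + by move=> n x y hx; rewrite !mulmE; apply: der_ext_mul; apply: homog_parity.
move=> x; rewrite !diffmE -[x]lext_id [diffm (lext _ _)]diffm_lext /der_ext !twist_extE.
rewrite !lext_lext diffm_lext lext_lext -lextDf -lextBf; apply: eq_lext => w.
by rewrite !lextU -diffm_lext; apply: der_word_homotopy.
Qed.

End DerivationHomotopy.
End AlgebraExtension.

(** * Milgram's map *)

Lemma fst_pair (T U : Type) (a : T) (b : U) : (a, b).1 = a. Proof. by []. Qed.
Lemma snd_pair (T U : Type) (a : T) (b : U) : (a, b).2 = b. Proof. by []. Qed.

Lemma addrNACA (V : zmodType) (a b c d : V) :
  - a + b + (- c + d) + (a + c) = b + d.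
Proof. by rewrite addrACA [- a + b + a]addrAC addNr add0r [- c + d + c]addrAC addNr add0r. Qed.

Lemma addr_congr4 (V : zmodType) (a a' b b' c c' e e' : V) :
  a = a' -> b = b' -> c = c' -> e = e' -> a + b + c + e = a' + b' + c' + e'.
Proof. by move=> -> -> -> ->. Qed.

Section Milgram.
Variables (K : sset) (hK : one_reduced K).
Local Notation C := (chains K).
Local Notation O := (cobar C).
Local Notation N := (coalg_tens C C).
Local Notation A := (dga_tens O O).

Let hO : dga_laws O := cobar_laws (@ccop_deg K) (@cdiff_deg K).
Let hA : dga_laws A := tens_laws hO hO.

Lemma desusp1_deg0 (x : C) : gdeg x = 0%N -> desusp1 x = 0.
Proof. by move=> x0; rewrite desusp1E insubF // x0. Qed.

Lemma desusp1_parity (x : C) : parity (gdeg x).+1 (desusp1 x).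
Proof. exact: pred_parity (@desusp1_deg C x). Qed.

(** Desuspension is the universal twisting cochain. In positive degrees this is the formula for the
    cobar differential; in degree 0 all terms vanish. *)
Lemma desusp1_twist (x : C) : diffm (desusp1 x) + lext (@desusp1 C) (cdiff x) =
  lext (fun t : C * C => sgn (gdeg t.1) *: mulm (desusp1 t.1) (desusp1 t.2))
    (ccop x).
Proof.
have [x0|x1] := posnP (gdeg x).
  rewrite desusp1_deg0 // diffm_lext lext0 add0r.
  rewrite (lext_eq0_in (@cdiff_deg K x)); last by move=> y; rewrite x0.
  rewrite (lext_eq0_in (@ccop_deg K x)) // => t; rewrite x0 => /eqP.
  by rewrite addn_eq0 => /andP[/eqP t1 _]; rewrite desusp1_deg0 // mulm0l scaler0.
rewrite -[x]/(val (Sub x x1 : cobar_gen C)).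
set g : cobar_gen C := Sub x x1.
rewrite desusp1_val diffmU -[adiff _]/(cobar_diff [:: g]) cobar_diff_cons.
rewrite -[cobar_diff [::]]/(0 : {malg O}) mulm0r scaler0 addr0.
by rewrite -cobar_oneE (dga_mul1r hO) cobar_diff_genE addrAC addNr add0r.
Qed.

Lemma counitl (B : choiceType) (G : C -> {malg B}) (x : C) :
  lext (fun t : C * C => if gdeg t.1 == 0%N then G t.2 else 0) (ccop x) = G x.
Proof.
rewrite -[RHS]lextU -[in RHS]ccop_counitl lext_lext; apply: eq_lext => t.
by case: eqP => _; rewrite ?lextU ?lext0.
Qed.

Lemma counitr (B : choiceType) (G : C -> {malg B}) (x : C) :
  lext (fun t : C * C => if gdeg t.2 == 0%N then G t.1 else 0) (ccop x) = G x.
Proof.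
rewrite -[RHS]lextU -[in RHS]ccop_counitr lext_lext; apply: eq_lext => t.
by case: eqP => _; rewrite ?lextU ?lext0.
Qed.

Definition inl_desusp (x : C) : {malg A} := ten (desusp1 x) (aone O).
Definition inr_desusp (y : C) : {malg A} := ten (aone O) (desusp1 y).

(* As [inl_desusp] and [inr_desusp] vanish in degree 0, the two terms are never
   simultaneously nonzero. *)
Definition milgram_twist (u : N) : {malg A} :=
  (if gdeg u.2 == 0%N then inl_desusp u.1 else 0) +
  (if gdeg u.1 == 0%N then inr_desusp u.2 else 0).

Lemma inl_deg (x : C) : allsupp (fun r : A => (gdeg r).+1 = gdeg x) (inl_desusp x).
Proof.
apply: (allsuppW (allsupp_ten (@desusp1_deg C x) (aone_deg hO))) => r [r1 r2].
by rewrite -[LHS]/(gdeg r.1 + gdeg r.2).+1 r2 addn0.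
Qed.

Lemma inr_deg (x : C) : allsupp (fun r : A => (gdeg r).+1 = gdeg x) (inr_desusp x).
Proof.
apply: (allsuppW (allsupp_ten (aone_deg hO) (@desusp1_deg C x))) => r [r1 r2].
by rewrite -[LHS]/(gdeg r.1 + gdeg r.2).+1 r1 add0n.
Qed.

Lemma milgram_twist_deg (u : N) :
  allsupp (fun r : A => (gdeg r).+1 = gdeg u) (milgram_twist u).
Proof.
rewrite /milgram_twist -[gdeg u]/(gdeg u.1 + gdeg u.2)%N.
apply: allsuppD; case: eqP => [->|_]; try exact: allsupp0.
  by rewrite addn0; apply: inl_deg.
exact: inr_deg.
Qed.

Lemma milgram_genE (g : cobar_gen N) : milgram_gen g = milgram_twist (val g).
Proof.
rewrite /milgram_gen /milgram_twist; case: (val g) => x y.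
rewrite -[(x, y).1]/x -[(x, y).2]/y !tenE -/(desusp1 x) -/(desusp1 y).
case: eqP => [y0|_]; last by rewrite add0r.
case: eqP => [x0|_]; last by rewrite addr0.
by rewrite /inr_desusp [desusp1 y]desusp1_deg0 // ten0r addr0.
Qed.

(** [milgram_twist] only sees tensors with a factor of degree 0, for which the Koszul sign is
    trivial; the switch then exchanges the two copies of the cobar construction. *)
Lemma milgram_twist_swap (u : N) :
  sgn (gdeg u.1 * gdeg u.2) *: milgram_twist (u.2, u.1) = sw (milgram_twist u).
Proof.
have p1 : parity 0 (aone O) := homog_parity (aone_deg hO).
rewrite swD /milgram_twist /=.
have L x : sw (inl_desusp x) = inr_desusp x.
  by rewrite (sw_ten (@desusp1_parity x) p1) muln0 sgn0 scale1r.
have R x : sw (inr_desusp x) = inl_desusp x.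
  by rewrite (sw_ten p1 (@desusp1_parity x)) mul0n sgn0 scale1r.
rewrite addrC scalerDr; congr (_ + _); case: eqP => [->|_].
- by rewrite muln0 sgn0 scale1r L.
- by rewrite /sw lext0 scaler0.
- by rewrite mul0n sgn0 scale1r R.
by rewrite /sw lext0 scaler0.
Qed.

Lemma diffm_inl (x : C) : diffm (inl_desusp x) =
  - lext inl_desusp (cdiff x) +
  lext (fun t : C * C => sgn (gdeg t.1) *: mulm (inl_desusp t.1) (inl_desusp t.2))
    (ccop x).
Proof.
have p1 : parity 0 (aone O) := homog_parity (aone_deg hO).
rewrite (diffm_ten _ (@desusp1_parity x)) (diffm1 hO) ten0r scaler0 addr0.
have -> : diffm (desusp1 x) = - lext (@desusp1 C) (cdiff x) +
  lext (fun t : C * C => sgn (gdeg t.1) *: mulm (desusp1 t.1) (desusp1 t.2))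
    (ccop x) by rewrite -desusp1_twist addrCA addNr addr0.
rewrite tenDl tenNl !ten_lextl; congr (_ + _); apply: eq_lext => t.
rewrite (mulm_ten _ _ p1 (@desusp1_parity t.2)) mul0n sgn0 scale1r.
by rewrite (dga_mul1l hO) tenZl.
Qed.

Lemma diffm_inr (x : C) : diffm (inr_desusp x) =
  - lext inr_desusp (cdiff x) +
  lext (fun t : C * C => sgn (gdeg t.1) *: mulm (inr_desusp t.1) (inr_desusp t.2))
    (ccop x).
Proof.
have p1 : parity 0 (aone O) := homog_parity (aone_deg hO).
rewrite (diffm_ten _ p1) (diffm1 hO) ten0l add0r sgn0 scale1r.
have -> : diffm (desusp1 x) = - lext (@desusp1 C) (cdiff x) +
  lext (fun t : C * C => sgn (gdeg t.1) *: mulm (desusp1 t.1) (desusp1 t.2))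
    (ccop x) by rewrite -desusp1_twist addrCA addNr addr0.
rewrite tenDr tenNr !ten_lextr; congr (_ + _); apply: eq_lext => t.
rewrite (mulm_ten _ _ (@desusp1_parity t.1) p1) muln0 sgn0 scale1r.
by rewrite (dga_mul1l hO) tenZr.
Qed.

Lemma mulm_inl_inr (x y : C) :
  mulm (inl_desusp x) (inr_desusp y) = ten (desusp1 x) (desusp1 y).
Proof.
have p1 : parity 0 (aone O) := homog_parity (aone_deg hO).
rewrite (mulm_ten _ _ p1 p1) muln0 sgn0 scale1r.
by rewrite (dga_mul1l hO) (dga_mul1r hO).
Qed.

Lemma mulm_inr_inl (x y : C) : mulm (inr_desusp y) (inl_desusp x) =
  sgn ((gdeg y).+1 * (gdeg x).+1) *: ten (desusp1 x) (desusp1 y).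
Proof.
rewrite (mulm_ten _ _ (@desusp1_parity y) (@desusp1_parity x)).
by rewrite (dga_mul1l hO) (dga_mul1r hO).
Qed.

(** Expresses that q is compatible with differentials. In the cup square the mixed products of the
    two copies of the cobar construction cancel, because these copies commute up to sign. *)
Lemma milgram_twist_twist (u : N) :
  diffm (milgram_twist u) + lext milgram_twist (cdiff u) =
  cupN (@mulm A) (@ccop N) 1 milgram_twist milgram_twist u.
Proof.
case: u => x y.
transitivity (
  (if gdeg y == 0%N then lext (fun t : C * C =>
    sgn (gdeg t.1) *: mulm (inl_desusp t.1) (inl_desusp t.2)) (ccop x) else 0) +
  (if gdeg x == 0%N then lext (fun t : C * C =>
    sgn (gdeg t.1) *: mulm (inr_desusp t.1) (inr_desusp t.2)) (ccop y) else 0)).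
  have D1 : lext (fun a => milgram_twist (a, y)) (cdiff x) =
      if gdeg y == 0%N then lext inl_desusp (cdiff x) else 0.
    rewrite (eq_lext_in (@cdiff_deg K x)
      (g := fun a => if gdeg y == 0%N then inl_desusp a else 0)); last first.
      move=> a ax; rewrite /milgram_twist -[(a, y).1]/a -[(a, y).2]/y.
      (* A boundary component of degree 0 would come from an element of degree 1, which a 1-reduced
         simplicial set does not have. *)
      case: (gdeg a =P 0%N) => [a0|_]; last by rewrite addr0.
      by case/eqP: (gdeg_neq1 hK x); rewrite -ax a0.
    by case: eqP => _; rewrite ?lext0f.
  have D2 : lext (fun a => milgram_twist (x, a)) (cdiff y) =
      if gdeg x == 0%N then lext inr_desusp (cdiff y) else 0.
    rewrite (eq_lext_in (@cdiff_deg K y)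
      (g := fun a => if gdeg x == 0%N then inr_desusp a else 0)); last first.
      move=> a ay; rewrite /milgram_twist -[(x, a).1]/x -[(x, a).2]/a.
      case: (gdeg a =P 0%N) => [a0|_]; last by rewrite add0r.
      by case/eqP: (gdeg_neq1 hK y); rewrite -ay a0.
    by case: eqP => _; rewrite ?lext0f.
  rewrite cdiff_tensE lextD lextZ !lext_ten.
  have -> : lext (fun a => lext (fun b => milgram_twist (a, b)) (mon y)) (cdiff x) =
      lext (fun a => milgram_twist (a, y)) (cdiff x).
    by apply: eq_lext => a; rewrite lextU.
  rewrite -[(x, y).1]/x -[(x, y).2]/y [lext _ (mon x)]lextU D1 D2.
  rewrite /milgram_twist -[(x, y).1]/x -[(x, y).2]/y diffmD.
  case: (gdeg y =P 0%N) => [y0|_]; case: (gdeg x =P 0%N) => [x0|_].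
  - rewrite x0 sgn0 scale1r diffm_inl diffm_inr.
    exact: addrNACA.
  - rewrite diffm_inl [diffm 0]diffm_lext lext0 scaler0; module.
  - rewrite diffm_inr x0 sgn0 [diffm 0]diffm_lext lext0; module.
  by rewrite [diffm 0]diffm_lext lext0 scaler0; module.
rewrite /cupN ccop_tensE lext_lext lext_ten.
(* In [Pij], [i] and [j] select the summand of [milgram_twist] used on the first and on the second
   tensor factor: 1 for the left copy, 2 for the right. The degree tests become counits, which [E11]
   to [E22] evaluate. *)
pose P11 (s r : C * C) : {malg A} := if gdeg r.1 == 0%N then if gdeg r.2 == 0%N then
  sgn (gdeg s.1) *: mulm (inl_desusp s.1) (inl_desusp s.2) else 0 else 0.
pose P12 (s r : C * C) : {malg A} := if gdeg r.1 == 0%N then if gdeg s.2 == 0%N then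
  sgn (gdeg s.1) *: ten (desusp1 s.1) (desusp1 r.2) else 0 else 0.
pose P21 (s r : C * C) : {malg A} := if gdeg r.2 == 0%N then if gdeg s.1 == 0%N then
  - sgn (gdeg s.2) *: ten (desusp1 s.2) (desusp1 r.1) else 0 else 0.
pose P22 (s r : C * C) : {malg A} := if gdeg s.1 == 0%N then if gdeg s.2 == 0%N then
  sgn (gdeg r.1) *: mulm (inr_desusp r.1) (inr_desusp r.2) else 0 else 0.
transitivity (lext (fun s => lext (fun r =>
    P11 s r + P12 s r + P21 s r + P22 s r) (ccop y)) (ccop x)); last first.
  apply: eq_lext => -[s1 s2]; apply: eq_lext => -[r1 r2]; rewrite lextZ lextU.
  have E a b : gdeg ((a, b) : N) = (gdeg a + gdeg b)%N by [].
  rewrite mul1n /milgram_twist /P11 /P12 /P21 /P22 {P11 P12 P21 P22} !fst_pair !snd_pair E.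
  symmetry; rewrite [LHS]scalerA -sgnD.
  rewrite [in LHS]mulmDl [X in _ *: (X + _)]mulmDr [X in _ *: (_ + X)]mulmDr.
  rewrite [LHS]scalerDr [X in X + _ = _]scalerDr [X in _ + X = _]scalerDr [LHS]addrA.
  apply: addr_congr4.
  - case: eqP => [->|_]; last by rewrite mulm0l scaler0.
    case: eqP => _; last by rewrite mulm0r scaler0.
    by rewrite muln0 add0n addn0.
  - case: eqP => [->|_]; last by rewrite mulm0l scaler0.
    case: eqP => _; last by rewrite mulm0r scaler0.
    by rewrite muln0 add0n addn0 mulm_inl_inr.
  - case: (gdeg s1 =P 0%N) => [->|_]; last by rewrite mulm0l scaler0 if_same.
    case: (gdeg r2 =P 0%N) => _; last by rewrite mulm0r scaler0.
    rewrite mulm_inr_inl scalerA -sgnD add0n; congr (_ *: _).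
    rewrite -[RHS]sgnS !sgn_odd !(oddD, oddM, oddS).
    by do 2!case: odd.
  case: eqP => [->|_]; last by rewrite mulm0l scaler0.
  case: eqP => [->|_]; last by rewrite mulm0r scaler0.
  by rewrite mul0n add0n.
transitivity (lext (fun s => lext (P11 s) (ccop y)) (ccop x) +
    lext (fun s => lext (P12 s) (ccop y)) (ccop x) +
    lext (fun s => lext (P21 s) (ccop y)) (ccop x) +
    lext (fun s => lext (P22 s) (ccop y)) (ccop x)); last first.
  rewrite -2!lextDf -lextDf; apply: eq_lext => s.
  by rewrite -2!lextDf -lextDf.
have E11 : lext (fun s => lext (P11 s) (ccop y)) (ccop x) =
  if gdeg y == 0%N then lext (fun t : C * C =>
    sgn (gdeg t.1) *: mulm (inl_desusp t.1) (inl_desusp t.2)) (ccop x) else 0.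
  rewrite (eq_lext _ (fun s => counitl (fun b => if gdeg b == 0%N then
    sgn (gdeg s.1) *: mulm (inl_desusp s.1) (inl_desusp s.2) else 0) y)).
  by case: eqP => _; rewrite ?lext0f.
have E12 : lext (fun s => lext (P12 s) (ccop y)) (ccop x) =
    sgn (gdeg x) *: ten (desusp1 x) (desusp1 y).
  rewrite (eq_lext _ (fun s => counitl (fun b => if gdeg s.2 == 0%N then
    sgn (gdeg s.1) *: ten (desusp1 s.1) (desusp1 b) else 0) y)).
  by rewrite (counitr (fun a => sgn (gdeg a) *: ten (desusp1 a) (desusp1 y))).
have E21 : lext (fun s => lext (P21 s) (ccop y)) (ccop x) =
    - sgn (gdeg x) *: ten (desusp1 x) (desusp1 y).
  rewrite (eq_lext _ (fun s => counitr (fun b => if gdeg s.1 == 0%N then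
    - sgn (gdeg s.2) *: ten (desusp1 s.2) (desusp1 b) else 0) y)).
  by rewrite (counitl (fun a => - sgn (gdeg a) *: ten (desusp1 a) (desusp1 y))).
have E22 : lext (fun s => lext (P22 s) (ccop y)) (ccop x) =
  if gdeg x == 0%N then lext (fun t : C * C =>
    sgn (gdeg t.1) *: mulm (inr_desusp t.1) (inr_desusp t.2)) (ccop y) else 0.
  rewrite -(counitl (fun a => if gdeg a == 0%N then lext (fun t : C * C =>
    sgn (gdeg t.1) *: mulm (inr_desusp t.1) (inr_desusp t.2)) (ccop y) else 0) x).
  by apply: eq_lext => s; rewrite /P22; do 2?[case: eqP => _]; rewrite ?lext0f.
by apply: etrans (esym (addr_congr4 E11 E12 E21 E22)); rewrite scaleNr addrK.
Qed.

End Milgram.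

(** * The twisting cochain of the cobar diagonal *)

(** A Cauchy product: nonzero terms have i < p and j < q, hence i + j < n, so the square of indices
    may be replaced by the triangle. *)
Lemma mulm_sum_diag (R : dga) (a b : nat -> {malg R}) p q n :
  (forall i, (0 < i)%N -> (p <= i)%N -> a i = 0) ->
  (forall j, (0 < j)%N -> (q <= j)%N -> b j = 0) -> (p + q <= n)%N ->
  mulm (\sum_(1 <= i < n) a i) (\sum_(1 <= j < n) b j) =
  \sum_(1 <= k < n) \sum_(1 <= i < k) mulm (a i) (b (k - i)%N).
Proof.
move=> a0 b0 pqn.
rewrite (big_morph (fun x => mulm x _) (fun x y => mulmDl x y _) (mulm0l _)).
transitivity (\sum_(1 <= k < n) \sum_(1 <= i < n | (i < k)%N) mulm (a i) (b (k - i)%N)).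
  rewrite (exchange_big_dep_nat xpredT) //=; apply: eq_big_nat => i /andP[i0 ni].
  have [pi|ip] := leqP p i.
    rewrite a0 // mulm0l big1 // => k _; exact: mulm0l.
  rewrite (big_morph (mulm (a i)) (mulmDr (a i)) (mulm0r (a i))).
  transitivity (\sum_(1 <= j < (n - i)%N) mulm (a i) (b j)).
    rewrite (@big_cat_nat _ _ _ (n - i)%N) //=; [|lia|lia].
    rewrite [X in _ + X]big_nat [X in _ + X]big1 ?addr0 // => j /andP[nj _].
    by rewrite b0 ?mulm0r //; lia.
  transitivity (\sum_(i.+1 <= k < n) mulm (a i) (b (k - i)%N)).
    by rewrite -[i.+1]add1n big_addn; apply: eq_bigr => j _; rewrite addnK.
  by rewrite (big_nat_widenl i.+1 1).
by apply: eq_big_nat => k /andP[_ kn]; rewrite [RHS](big_nat_widen _ _ n) // ltnW.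
Qed.

Lemma desusp_deg (C : coalg) (w : seq C) :
  allsupp (fun v : cobar C => (gdeg v + size w)%N = sumn [seq gdeg u | u <- w]) (desusp w).
Proof.
elim: w => [|u w IH].
  by rewrite desusp_nil cobar_oneE; apply: allsuppU; rewrite addn0 /= big_nil.
rewrite -cat1s desusp_cat; apply: allsuppZ; rewrite mulm_lext.
apply: (allsupp_lext (allsupp_ten (@desusp1_deg C u) IH)) => v [v1 v2].
apply: (allsuppW (@cobar_amul_deg C v.1 v.2)) => c ->.
rewrite size_cat map_cat sumn_cat -v2 -[sumn [seq _ | _ <- [:: u]]]/(gdeg u + 0)%N -v1.
by rewrite -[size [:: u]]/1%N; move: (gdeg v.1) (gdeg v.2) => a b; lia.
Qed.

Section TildeTwist.
Variables K L : sset.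
Local Notation M := (chains (sprod K L)).
Local Notation N := (coalg_tens (chains K) (chains L)).
Local Notation O := (cobar N).

Lemma F_recS n k (x : M) : F_rec n.+1 k x =
  if k == 1%N then lext (fun u : N => mon [:: u]) (alexander_whitney x)
  else - \sum_(1 <= i < k) sgn (i.-1 * (k - i)) *:
    lext (fun t : M * M => sgn ((k - i).-1 * gdeg t.1) *:
       lext (fun w : seq N * seq N => mon (w.1 ++ w.2))
            (ten (F_rec n i t.1) (F_rec n (k - i) t.2)))
      (lext (@ccop M) (phi x)).
Proof.
transitivity ((if k == 1%N then
      fun x : M => lin (fun t : N => << [:: t] >>) (alexander_whitney x)
    else
      fun x : M => - \sum_(1 <= i < k)
        sgn (i.-1 * (k - i)) *:
        lin (fun w : seq N * seq N => << w.1 ++ w.2 >>)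
          (lin (tensmap (k - i).-1 (F_rec n i) (F_rec n (k - i)))
             (lin ccop (phi x : {malg M})))) x); first by [].
case: ifP => _; first by rewrite lextE; apply: eq_lext => u; rewrite monE.
congr (- _); apply: eq_bigr => i _; congr (_ *: _); rewrite !lextE [LHS]lext_lext.
apply: eq_lext => t; rewrite /tensmap lextZ tenE; congr (_ *: _).
by apply: eq_lext => w; rewrite monE.
Qed.

Lemma F_rec_deg n k (x : M) :
  allsupp (fun w => size w = k /\ (sumn [seq gdeg u | u <- w]).+1 = (gdeg x + k)%N)
    (F_rec n k x).
Proof.
elim: n k x => [|n IH] k x; first exact: allsupp0.
rewrite F_recS; case: eqP => [->|_].
  apply: (allsupp_lext (@aw_deg K L x)) => u ux; apply: allsuppU.
  by split=> //; rewrite -[LHS]/(gdeg u + 0).+1 ux addn0 addn1.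
apply: allsuppN; rewrite big_nat; apply: allsupp_sum => i /andP[i1 ik].
apply: allsuppZ; apply: (@allsupp_lext _ _ (fun t => (gdeg t.1 + gdeg t.2)%N = (gdeg x).+1)).
  apply: (allsupp_lext (@phi_deg K L x)) => z <-; exact: ccop_deg.
move=> t tx; apply: allsuppZ.
apply: (allsupp_lext (allsupp_ten (IH i t.1) (IH (k - i)%N t.2))).
move=> w [[s1 d1] [s2 d2]]; apply: allsuppU.
rewrite size_cat map_cat sumn_cat s1 s2; split; first lia.
move: d1 d2 tx; move: (sumn _) (sumn _) (gdeg t.1) (gdeg t.2) (gdeg x) => a b c e f; lia.
Qed.

Lemma F_rec_stable n k (x : M) : (k <= n)%N -> F_rec n k x = F k x.
Proof.
suff H m : forall n k (x : M), (k <= m)%N -> (k <= n)%N ->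
    F_rec n k x = F_rec k k x by exact: H.
elim: m => [|m IH] {}n {}k {}x.
  rewrite leqn0 => /eqP -> _; case: n => // n.
  by rewrite F_recS big_geq // oppr0.
case: k => [_ _|k]; first by case: n => // n; rewrite F_recS big_geq // oppr0.
case: n => [//|n]; rewrite !ltnS => km kn.
rewrite [LHS]F_recS [RHS]F_recS; case: eqP => _; first by [].
apply: (congr1 -%R); apply: eq_big_nat => i /andP[i1 ik].
apply: (congr1 ( *:%R _)); apply: eq_lext => t.
have H j (y : M) : (j <= k)%N -> F_rec n j y = F_rec k j y.
  by move=> jk; rewrite (IH n j y) 1?(IH k j y) //; lia.
have -> := H i t.1 ltac:(lia); have -> // := H (k.+1 - i)%N t.2 ltac:(lia).
Qed.

Definition tilde_part (k : nat) (x : M) : {malg O} := lext (@desusp N) (F k x).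

Lemma tilde_partE k (x : M) : (0 < k)%N -> tilde_part k x =
  (if k == 1%N then lext (@desusp1 N) (alexander_whitney x) else 0) -
  \sum_(1 <= i < k)
    lext (cup (@ccop M) (@mulm O) 1 (tilde_part i) (tilde_part (k - i))) (phi x).
Proof.
case: k => // k _; rewrite /tilde_part /F F_recS; case: eqP => [->|_].
  by rewrite big_geq // subr0 lext_lext; apply: eq_lext => u; rewrite lextU.
rewrite lextN sub0r lext_sum; congr (- _).
apply: eq_big_nat => i /andP[i1 ik]; rewrite lextZ lext_lext lext_lext -lextZf.
apply: eq_lext => z; rewrite -lextZf; apply: eq_lext => t.
rewrite lextZ scalerA lext_lext mul1n.
have -> : F_rec k i t.1 = F_rec i i t.1 by apply: F_rec_stable; lia.
have -> : F_rec k (k.+1 - i) t.2 = F_rec (k.+1 - i) (k.+1 - i) t.2.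
  by apply: F_rec_stable; lia.
rewrite mulm_lextl lext_ten -!lextZf.
apply: (eq_lext_in (@F_rec_deg i i t.1)) => w1 [s1 d1].
rewrite mulm_lextr -!lextZf.
apply: (eq_lext_in (@F_rec_deg (k.+1 - i) (k.+1 - i) t.2)) => w2 [s2 _].
rewrite lextU desusp_cat scalerA s2; congr (_ *: _).
(* With j the length of the second word and e the degree of [t.1], the signs of [F_rec], [tensmap]
   and [desusp_cat] have exponents (i-1)j, (j-1)e and j(e+i-1). Their sum is congruent to e modulo
   2, the exponent in a cup product of maps of degree -1. *)
rewrite -!sgnD !sgn_odd; congr (_ ^+ _).
have -> : i = i.-1.+1 by rewrite prednK.
have [j ->] : exists j, (k.+1 - i.-1.+1)%N = j.+1 by exists (k - i.-1.+1)%N; lia.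
have -> : sumn [seq gdeg u | u <- w1] = (gdeg t.1 + i.-1)%N by lia.
rewrite /= !(oddD, oddM, oddS); by do 3!case: odd.
Qed.

Hypotheses (hK : one_reduced K) (hL : one_reduced L).

Lemma tilde_part_eq0 k (x : M) : (0 < k)%N -> (gdeg x <= k)%N -> tilde_part k x = 0.
Proof.
elim/ltn_ind: k x => k IH x k0 xk; rewrite tilde_partE // big_nat big1 => [|i /andP[i0 ik]].
  rewrite subr0; case: (k =P 1%N) => // k1.
  apply: (lext_eq0_in (@aw_deg K L x)) => u ux.
  rewrite desusp1E insubF //; apply/negbTE; rewrite -leqNgt leqn0.
  move: ux (gdeg_neq1 hK u.1) (gdeg_neq1 hL u.2).
  rewrite -[gdeg u]/(gdeg u.1 + gdeg u.2)%N; move: xk; rewrite k1.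
  by move: (gdeg x) (gdeg u.1) (gdeg u.2) => [|[|a]] [|[|b]] [|[|c]].
apply: (lext_eq0_in (@phi_deg K L x)) => z zx.
apply: (lext_eq0_in (@ccop_deg _ z)) => t; rewrite zx => tx.
(* The degrees of [t.1] and [t.2] add up to at most k + 1, so one of them is bounded by its index i
   or k - i. *)
have [t1|t1] := leqP (gdeg t.1) i; first by rewrite (IH i) // mulm0l scaler0.
by rewrite (IH (k - i)%N) ?mulm0r ?scaler0 //; lia.
Qed.

Definition tilde_twist (x : M) : {malg O} :=
  \sum_(1 <= k < (gdeg x).+1) tilde_part k x.

(** Parts of index at least the degree vanish. This freedom in the bound lets the sums at [x], [t.1]
    and [t.2] be compared. *)
Lemma tilde_twistE n (x : M) : (gdeg x <= n)%N ->
  tilde_twist x = \sum_(1 <= k < n) tilde_part k x.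
Proof.
move=> xn; rewrite /tilde_twist.
case: (posnP n) xn => [->|n0 xn].
  by rewrite leqn0 => /eqP ->; rewrite !big_geq.
transitivity (\sum_(1 <= k < n.+1) tilde_part k x).
  rewrite [RHS](big_cat_nat (n := (gdeg x).+1)) //= [X in _ + X]big_nat.
  rewrite [X in _ + X]big1 ?addr0 // => k /andP[xk _].
  by apply: tilde_part_eq0; [apply: leq_trans xk | apply: ltnW].
by rewrite big_nat_recr //= tilde_part_eq0 // addr0.
Qed.

Lemma tilde_twist_rec (x : M) : tilde_twist x =
  lext (@desusp1 N) (alexander_whitney x) -
  lext (cup (@ccop M) (@mulm O) 1 tilde_twist tilde_twist) (phi x).
Proof.
(* The bound must exceed 1 to keep the part of index 1 even in degree 0, and must be at least the
   total degree of [t], one more than that of [x]. *)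
set n := (gdeg x).+2.
rewrite (@tilde_twistE n) /n; last lia.
rewrite big_nat (eq_bigr (fun k =>
  (if k == 1%N then lext (@desusp1 N) (alexander_whitney x) else 0) -
  \sum_(1 <= i < k) lext (cup (@ccop M) (@mulm O) 1 (tilde_part i)
    (tilde_part (k - i))) (phi x))); last by move=> k /andP[k0 _]; apply: tilde_partE.
rewrite -big_nat sumrB; congr (_ - _).
  rewrite big_ltn //= big_nat big1 ?addr0 // => k /andP[k1 _].
  by case: eqP k1 => // ->.
under [LHS]eq_bigr => k _ do rewrite -lext_sumf.
rewrite -lext_sumf.
apply: (eq_lext_in (@phi_deg K L x)) => z zx; rewrite /cup.
under [LHS]eq_bigr => k _ do rewrite -lext_sumf.
rewrite -lext_sumf.
apply: (eq_lext_in (@ccop_deg _ z)) => t; rewrite zx => tx.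
rewrite (@tilde_twistE n t.1) 1?(@tilde_twistE n t.2); [|lia|lia].
rewrite (@mulm_sum_diag _ _ _ (gdeg t.1) (gdeg t.2)); last lia.
- by rewrite scaler_sumr; apply: eq_bigr => k _; rewrite scaler_sumr.
- by move=> i i0 ti; apply: tilde_part_eq0.
by move=> i i0 ti; apply: tilde_part_eq0.
Qed.

Lemma tilde_twist_deg (x : M) : allsupp (fun v : O => (gdeg v).+1 = gdeg x) (tilde_twist x).
Proof.
apply: allsupp_sum => k _; apply: (allsupp_lext (@F_rec_deg k k x)) => w [wk wd].
apply: (allsuppW (@desusp_deg N w)) => v; rewrite wk => vd; move: wd; rewrite -vd.
move: (gdeg v) (gdeg x) => a b; lia.
Qed.

End TildeTwist.

(** * Pullback of twisting cochains and homotopies along simplicial maps *)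

Section Pullback.
Variables (S S' : sset) (g : forall n, S n -> S' n).
Hypothesis g_act : forall m n (a : simpop m n) (x : S n), g (act a x) = act a (g x).
Variable R : dga.
Implicit Types a b : chains S' -> {malg R}.

Definition pullback a (x : chains S) : {malg R} := lext a (push g x).

Lemma cup_pullback e a b x :
  lext (cup (@ccop (chains S')) (@mulm R) e a b) (push g x) =
  cup (@ccop (chains S)) (@mulm R) e (pullback a) (pullback b) x.
Proof.
exact: (cup_nab (@mulm_linl R) (@mulm_linr R) (@push_deg _ _ g)
  (push_ccop g_act) e a b x).
Qed.

Lemma der_pullback p a x :
  lext (der (@cdiff (chains S')) (@diffm R) p a) (push g x) =
  der (@cdiff (chains S)) (@diffm R) p (pullback a) x.
Proof.
rewrite /der lextBf lextZf diffm_lext lext_lext.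
congr (_ - _ *: _); first by apply: eq_lext => y; rewrite diffm_lext.
by rewrite -(lext_lext a) (push_cdiff g_act) lext_lext.
Qed.

Lemma pullback_twist a :
  (forall x, der (@cdiff (chains S')) (@diffm R) 1 a x =
             cup (@ccop (chains S')) (@mulm R) 1 a a x) ->
  forall x, der (@cdiff (chains S)) (@diffm R) 1 (pullback a) x =
            cup (@ccop (chains S)) (@mulm R) 1 (pullback a) (pullback a) x.
Proof. by move=> ta x; rewrite -der_pullback (eq_lext _ ta) cup_pullback. Qed.

Lemma pullback_homotopy t t' H :
  (forall x, der (@cdiff (chains S')) (@diffm R) 0 H x =
             homotopy_rhs (@ccop (chains S')) (@mulm R) t t' H x) ->
  forall x, der (@cdiff (chains S)) (@diffm R) 0 (pullback H) x =
    homotopy_rhs (@ccop (chains S)) (@mulm R) (pullback t) (pullback t')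
      (pullback H) x.
Proof.
move=> tH x; rewrite -der_pullback (eq_lext _ tH) /homotopy_rhs.
by rewrite lextDf !lextBf !cup_pullback.
Qed.

Lemma pullback_pred a : (forall x, allsupp (fun r => (gdeg r).+1 = gdeg x) (a x)) ->
  forall x, allsupp (fun r => (gdeg r).+1 = gdeg x) (pullback a x).
Proof. by move=> ad x; apply: (allsupp_lext (@push_deg _ _ g x)) => y <-. Qed.

Lemma pullback_homog a : (forall x, homog (gdeg x) (a x)) ->
  forall x, homog (gdeg x) (pullback a x).
Proof. by move=> ad x; apply: (allsupp_lext (@push_deg _ _ g x)) => y <-; apply: ad. Qed.

Lemma pullback0 a : (forall x, gdeg x = 0%N -> a x = 0) ->
  forall x, gdeg x = 0%N -> pullback a x = 0.
Proof.
by move=> a0 x x0; apply: (lext_eq0_in (@push_deg _ _ g x)) => y yx; rewrite a0 // yx.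
Qed.

End Pullback.

Lemma alg_ext_comp (C D : coalg) (R : dga) (hR : dga_laws R)
    (f : cobar_gen D -> {malg R}) (g : cobar_gen C -> {malg cobar D}) c :
  alg_ext f (alg_ext g c) = alg_ext (fun x => alg_ext f (g x)) c.
Proof.
rewrite [alg_ext g]alg_extE [RHS](congr1 (fun h => h c) (alg_extE _)).
rewrite [LHS](congr1 (fun h => h _) (alg_extE f)) lext_lext; apply: eq_lext => w.
rewrite -alg_extE; elim: w => [|x w IH]; first exact: alg_ext_one.
by rewrite !alg_ext_word_cons (alg_ext_mul hR) IH.
Qed.

Section SwitchTwist.
Variables (C : coalg) (A : dga) (hA : dga_laws A).
Local Notation T := (dga_tens A A).
Variable a : C -> {malg T}.
Local Notation a' := (fun x => @sw A (a x)).

Lemma sw_twist :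
  (forall x, der (@cdiff C) (@diffm T) 1 a x = cup (@ccop C) (@mulm T) 1 a a x) ->
  forall x, der (@cdiff C) (@diffm T) 1 a' x = cup (@ccop C) (@mulm T) 1 a' a' x.
Proof.
move=> ta x; transitivity (sw (der (@cdiff C) (@diffm T) 1 a x)).
  by rewrite /der /sgn expr1 !scaleN1r !opprK swD (sw_diff hA) sw_lext.
rewrite ta /cup sw_lext; apply: eq_lext => t.
by rewrite swZ (sw_mul hA).
Qed.

Lemma sw_twist_ext c : sw (twist_ext a c) = twist_ext a' c.
Proof.
rewrite !twist_extE sw_lext; apply: eq_lext => w.
elim: w => [|g w IH].
  have p1 := homog_parity (aone_deg hA).
  rewrite -[LHS]/(sw (tens (aone A) (aone A))) -[RHS]/(tens (aone A) (aone A)) tenE.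
  by rewrite (sw_ten p1 p1) sgn0 scale1r.
by rewrite !alg_ext_word_cons (sw_mul hA) IH.
Qed.

Lemma sw_pred : (forall x, allsupp (fun r => (gdeg r).+1 = gdeg x) (a x)) ->
  forall x, allsupp (fun r => (gdeg r).+1 = gdeg x) (a' x).
Proof.
move=> ad x; apply: (@allsuppW _ (fun r : T => gdeg r = (gdeg x).-1 /\ (0 < gdeg x)%N)).
  apply: allsuppI.
    by apply: (@sw_deg A); apply: (allsuppW (@ad x)) => r <-.
  by apply: (allsupp_lext (@ad x)) => r rx; apply: allsuppZ; apply: allsuppU; rewrite -rx.
by move=> r [-> x0]; rewrite prednK.
Qed.

End SwitchTwist.

(** * The cobar diagonal and its switch as extensions of twisting cochains *)

Section Diagonal.
Variables (K : sset) (hK : one_reduced K).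
Local Notation C := (chains K).
Local Notation M := (chains (sprod K K)).
Local Notation O := (cobar C).
Local Notation N := (coalg_tens C C).
Local Notation A := (dga_tens O O).

Let hO : dga_laws O := cobar_laws (@ccop_deg K) (@cdiff_deg K).
Let hA : dga_laws A := tens_laws hO hO.
Let hM : one_reduced (sprod K K) := one_reduced_prod hK hK.

Definition diag_twist (x : M) : {malg A} :=
  twist_ext (@milgram_twist K) (@tilde_twist K K x).

(** q is an algebra map, so it carries the cup square in [tilde_twist_rec] to a cup square. *)
Lemma diag_twist_rec (x : M) : diag_twist x =
  lext (@milgram_twist K) (alexander_whitney x) -
  lext (cup (@ccop M) (@mulm A) 1 diag_twist diag_twist) (phi x).
Proof.
rewrite /diag_twist (tilde_twist_rec hK hK) twist_extD twist_extN !twist_ext_lext.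
congr (_ - _).
  by apply: eq_lext => u; apply: (twist_ext_desusp1 hA (@milgram_twist_deg K)).
apply: eq_lext => z; rewrite twist_ext_lext; apply: eq_lext => t.
by rewrite twist_extZ (twist_ext_mul hA).
Qed.

Lemma diag_twist_deg (x : M) : allsupp (fun r : A => (gdeg r).+1 = gdeg x) (diag_twist x).
Proof.
rewrite /diag_twist twist_extE.
apply: (allsupp_lext (@tilde_twist_deg K K x)) => v <-.
rewrite -twist_extU.
apply: (@allsuppW _ (fun r : A => gdeg r = gdeg v)) => [|r -> //].
apply: (twist_ext_deg hA (@milgram_twist_deg K)); exact: allsuppU.
Qed.

Lemma diag_twist_facts :
  (forall u : N, lext diag_twist (nab u) = milgram_twist u) /\
  (forall x, der (@cdiff M) (@diffm A) 1 diag_twist x =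
             cup (@ccop M) (@mulm A) 1 diag_twist diag_twist x).
Proof.
apply: (transfer_twisting (@mulm_linl A) (@mulm_linr A) (dga_mulA hA) (@diffm_lin A)
  (diffm_mul hA) (@ccop_deg _) (@ccopA _) (@cdiff_deg _) (@cdiff_cop _)
  (gdeg_neq1 hM) (@phi_deg K K) (@nab_deg K K) (@nab_cop K K) (@aw_nab K K)
  (@phi_nab K K) (@phi_homotopy K K) (@aw_cdiff K K) (milgram_twist_twist hK)
  diag_twist_rec).
- exact: deg_parity diag_twist_deg.
- exact: deg_zero diag_twist_deg.
Qed.

Let g (n : nat) (x : K n) : sprod K K n := (x, x).
Let sg := @swap_simplex K K.
Definition diag_twist' (x : M) : {malg A} := sw (pullback sg diag_twist x).

Lemma diag_twist'_deg (x : M) :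
  allsupp (fun r : A => (gdeg r).+1 = gdeg x) (diag_twist' x).
Proof. by move: x; apply: sw_pred; apply: pullback_pred diag_twist_deg. Qed.

Lemma diag_twist'_twist x : der (@cdiff M) (@diffm A) 1 diag_twist' x =
  cup (@ccop M) (@mulm A) 1 diag_twist' diag_twist' x.
Proof. by apply: (sw_twist hO) x; apply: (pullback_twist _ diag_twist_facts.2). Qed.

(** Exchanging factors gives nabla and [milgram_twist] the same Koszul sign, and the two signs
    cancel. *)
Lemma diag_twist'_nab (u : N) : lext diag_twist (nab u) = lext diag_twist' (nab u).
Proof.
rewrite /diag_twist' -sw_lext /pullback -lext_lext -/(@swap K K) swap_nab lextZ.
rewrite !diag_twist_facts.1 swZ -milgram_twist_swap scalerA.
by rewrite [(gdeg (u.2, u.1).1 * _)%N]mulnC sgn_sqr scale1r -surjective_pairing.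
Qed.

Definition diag_homotopy : M -> {malg A} :=
  homotopy (@ccop M) (@mulm A) (@phi K K) diag_twist diag_twist'.

Lemma diag_homotopyE x : der (@cdiff M) (@diffm A) 0 diag_homotopy x =
  homotopy_rhs (@ccop M) (@mulm A) diag_twist diag_twist' diag_homotopy x.
Proof.
exact: (homotopy_eq (@mulm_linl A) (@mulm_linr A) (dga_mulA hA) (@diffm_lin A)
  (diffm_mul hA) (@ccop_deg _) (@ccopA _) (@cdiff_deg _) (@cdiff_cop _)
  (gdeg_neq1 hM) (@phi_deg K K) (@nab_deg K K) (@nab_cop K K)
  (@phi_nab K K) (@phi_homotopy K K) diag_twist_facts.2 diag_twist'_twist
  diag_twist_deg diag_twist'_deg diag_twist'_nab (mulm_homog hA)).
Qed.

Lemma diag_homotopy_deg x : homog (gdeg x) (diag_homotopy x).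
Proof.
exact: (@homotopy_deg M A (@ccop M) (@mulm A) (@mulm_linl A) (@mulm_linr A)
  (@ccop_deg _) (gdeg_neq1 hM) _ (@phi_deg K K) _ _ diag_twist_deg diag_twist'_deg
  (mulm_homog hA)).
Qed.

Lemma diag_homotopy0 x : gdeg x = 0%N -> diag_homotopy x = 0.
Proof.
exact: (homotopy0 (@mulm_linl A) (@mulm_linr A) (@ccop_deg _) (gdeg_neq1 hM)
  (@phi_deg K K) (@phi_deg0 K K) diag_twist_deg diag_twist'_deg).
Qed.

(** A composite of algebra extensions is determined on generators ([alg_ext_comp]), where it is
    [diag_twist] evaluated on the diagonal. *)
Lemma cobar_diagonalE (c : {malg O}) :
  @cobar_diagonal K c = twist_ext (pullback g diag_twist) c.
Proof.
have omegaE (x : cobar_gen M) : omega_tilde_f_gen x = @tilde_twist K K (val x).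
  by apply: eq_bigr => k _; rewrite lextE.
have genE : @milgram_gen C C = fun x => milgram_twist (val x).
  by apply: functional_extensionality_dep => x; apply: milgram_genE.
have tildeE z : @milgram C C (@omega_tilde_f K K z) = twist_ext diag_twist z.
  rewrite /omega_tilde_f /milgram (alg_ext_comp hA) genE.
  apply: (congr1 (fun f : cobar_gen M -> {malg A} => alg_ext f z)).
  by apply: functional_extensionality_dep => y; rewrite omegaE.
rewrite /cobar_diagonal tildeE /cobar_map [LHS](alg_ext_comp hA).
apply: (congr1 (fun f : cobar_gen C -> {malg A} => alg_ext f c)).
apply: functional_extensionality_dep => x.
rewrite lextE -[LHS]/(twist_ext diag_twist (lext (@desusp1 M) (diag (val x)))).
rewrite twist_ext_lext /pullback -(diag_push (val x)).
by apply: eq_lext => y; apply: (twist_ext_desusp1 hA diag_twist_deg).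
Qed.

(** The outer exchange in [diag_twist'] passes through the extension because it is an algebra map;
    the inner one is absorbed by the diagonal of [K]. *)
Lemma switch_cobar_diagonal (c : {malg O}) :
  switch (@cobar_diagonal K c) = twist_ext (pullback g diag_twist') c.
Proof.
rewrite switchE cobar_diagonalE (sw_twist_ext hO).
apply: (congr1 (fun f : C -> {malg A} => twist_ext f c)).
apply: functional_extensionality_dep => b.
rewrite /pullback /diag_twist' -sw_lext /pullback -lext_lext.
by rewrite -/(@swap K K) -(diag_push b) swap_diag.
Qed.

End Diagonal.

Theorem proposition4p1 (K : sset) (hK : one_reduced K) :
  exists h : {malg cobar (chains K)} ->
             {malg dga_tens (cobar (chains K)) (cobar (chains K))},
    derivation_homotopy
      (@cobar_diagonal K)
      (fun c => switch (@cobar_diagonal K c))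
      h.
Proof.
have hO := cobar_laws (@ccop_deg K) (@cdiff_deg K).
have hA := tens_laws hO hO.
pose g (n : nat) (x : K n) : sprod K K n := (x, x).
have g_act m n (a : simpop m n) (x : K n) : g m (act a x) = act a (g n x) by [].
(* The derivation whose values on generators are the homotopy pulled back along the diagonal of
   [K]. *)
exists (der_ext (pullback g (@diag_twist K)) (pullback g (@diag_twist' K))
  (pullback g (@diag_homotopy K))).
rewrite (functional_extensionality_dep (@switch_cobar_diagonal K)).
rewrite (functional_extensionality_dep (@cobar_diagonalE K)).
apply: (der_ext_homotopy hA (@ccop_deg K) (@cdiff_deg K)).
- by apply: pullback_pred; apply: diag_twist_deg.
- by apply: pullback_pred; apply: diag_twist'_deg.
- by apply: (pullback_twist g_act); apply: (diag_twist_facts hK).2.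
- by apply: (pullback_twist g_act); apply: (diag_twist'_twist hK).
- by apply: pullback_homog; apply: (diag_homotopy_deg hK).
- by apply: pullback0; apply: (diag_homotopy0 hK).
by apply: (pullback_homotopy g_act); apply: (diag_homotopyE hK).
Qed.
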